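(* Let $R$ be an aperiodic, countable Borel measure-preserving equivalence relation on a standard probability space $(X,\mu)$. Then $R$ is sofic if and only if the full group $[R]$ embeds isometrically into an ultraproduct $\prod_{\mathcal{U}}\mathfrak{S}_{n_k}$ (for some free ultrafilter $\mathcal{U}$ on $\mathbb{N}$ and some sequence $(n_k)$ of positive integers).
   Context: A standard probability space $(X,\mu)$ is a standard Borel space with a Borel probability measure. A countable Borel equivalence relation $R$ on $X$ is an equivalence relation that is Borel in $X\times X$ with all classes countable. $R$ is aperiodic if $\mu$-a.e. class of $R$ is infinite. $[[R]]_B$ is the set of Borel isomorphisms $g:\operatorname{dom}g\to\operatorname{ran}g$ between Borel subsets of $X$ with $(x,gx)\in R$ for all $x\in\operatorname{dom}g$; it is an inverse monoid under composition of partial maps. $R$ is measure-preserving if $\mu(g(A))=\mu(A)$ for all $g\in[[R]]_B$ and Borel $A\subseteq\operatorname{dom}g$. The full semigroup $[[R]]$ is the quotient of $[[R]]_B$ by the pseudometric $d_\mu(g,h)=\mu(\operatorname{dom}g\triangle\operatorname{dom}h)+\mu\{x\in\operatorname{dom}g\cap\operatorname{dom}h:gx\ne hx\}$. The full group $[R]$, with metric $d_\mu$, is the image in $[[R]]$ of those $g$ with $\operatorname{dom}g=\operatorname{ran}g=X$. For $N\in\mathbb{N}$, $[N]=\{0,\dots,N-1\}$ carries normalized counting measure $\mu_\#$, $[[N]]$ is the set of all partial bijections of $[N]$, $\mathfrak{S}_N\subseteq[[N]]$ is the permutation group, and $d_\#$ is the analogous metric defined with $\mu_\#$ (on $\mathfrak{S}_N$,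 the normalized Hamming distance). $R$ is sofic if for each finite $K\subseteq[[R]]$ and $\epsilon>0$ there exist $N\in\mathbb{N}$ and $\pi:[[R]]\to[[N]]$ with: (i) $\pi(\operatorname{id}_X)=1_{[N]}$ and $\pi(\varnothing)=\varnothing$; (ii) $d_\#(\pi(\varphi\psi),\pi(\varphi)\pi(\psi))<\epsilon$ for all $\varphi,\psi\in K$; (iii) $|\mu\{x:\varphi(x)=x\}-\mu_\#\{m:\pi(\varphi)(m)=m\}|<\epsilon$ for all $\varphi\in K$. $\prod_{\mathcal{U}}\mathfrak{S}_{n_k}$ is the metric ultraproduct: the quotient of $\prod_k\mathfrak{S}_{n_k}$ by the pseudometric $d_{\mathcal{U}}((x_k),(y_k))=\lim_{k\to\mathcal{U}}d_\#(x_k,y_k)$, a group under coordinatewise product. To embed isometrically means that there is an isometric group homomorphism. *)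

(* Defs.v *)
From HB Require Import structures.
From mathcomp Require Import all_boot all_order all_algebra all_fingroup.
From mathcomp Require Import generic_quotient.
From mathcomp Require Import all_classical all_reals all_analysis.

Set Implicit Arguments.
Unset Strict Implicit.
Unset Printing Implicit Defensive.

Import Order.TTheory GRing.Theory Num.Theory.
Import numFieldNormedType.Exports.

Local Open Scope classical_set_scope.
Local Open Scope ring_scope.
Local Open Scope quotient_scope.

Record pseudometric (R : realType) (T : Type) := Pseudometric {
  pdist :> T -> T -> R;
  pdistxx : forall x, pdist x x = 0;
  pdistC : forall x y, pdist x y = pdist y x;
  pdist_triangle : forall y x z, pdist x z <= pdist x y + pdist y z
}.

Section metric_quotient.
Context (R : realType) (T : Type) (d : pseudometric R T).

Lemma pdist_ge0 x y : 0 <= d x y.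
Proof.
have := pdist_triangle d y x x; rewrite pdistxx (pdistC d y x) -mulr2n.
by rewrite pmulrn_lge0.
Qed.

Lemma pdist_congr x x' y y' : d x x' = 0 -> d y y' = 0 -> d x y = d x' y'.
Proof.
move=> xx' yy'; apply/eqP; rewrite eq_le; apply/andP; split.
  apply: le_trans (pdist_triangle d x' x y) _; rewrite xx' add0r.
  apply: le_trans (pdist_triangle d y' x' y) _.
  by rewrite (pdistC d y' y) yy' addr0.
apply: le_trans (pdist_triangle d x x' y') _; rewrite pdistC xx' add0r.
by apply: le_trans (pdist_triangle d y x y') _; rewrite yy' addr0.
Qed.

Definition pdist0 (x y : {classic T}) : bool := d x y == 0.

Let pdist0_refl : reflexive pdist0.
Proof. by move=> x; rewrite /pdist0 pdistxx. Qed.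

Let pdist0_sym : symmetric pdist0.
Proof. by move=> x y; rewrite /pdist0 pdistC. Qed.

Let pdist0_trans : transitive pdist0.
Proof.
by move=> y x z /eqP xy /eqP yz; rewrite /pdist0 (pdist_congr xy (pdistxx d z)) yz.
Qed.

Canonical pdist0_equiv := EquivRel pdist0 pdist0_refl pdist0_sym pdist0_trans.

Definition metric_quotient : Type := {eq_quot pdist0}.

Definition mclass (x : T) : metric_quotient := \pi_({eq_quot pdist0}) x.

Definition mrepr (a : metric_quotient) : T := repr (a : {eq_quot pdist0}).

Definition mdist_quotient (a b : metric_quotient) : R := d (mrepr a) (mrepr b).

Lemma mreprK a : mclass (mrepr a) = a.
Proof. exact: reprK. Qed.

Lemma mclassP x y : mclass x = mclass y <-> d x y = 0.
Proof.
split=> [/eqP|dxy]; first by rewrite eqmodE => /eqP.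
by apply/eqP; rewrite eqmodE; exact/eqP.
Qed.

Lemma mrepr_class x : d (mrepr (mclass x)) x = 0.
Proof. by apply/mclassP; rewrite mreprK. Qed.

Lemma mdist_quotientE x y : mdist_quotient (mclass x) (mclass y) = d x y.
Proof. by apply: pdist_congr; exact: mrepr_class. Qed.

End metric_quotient.

Section partial_maps.
Context (T : Type).
Implicit Types f g : T -> option T.

Definition pdom f : set T := [set x | exists y, f x = Some y].
Definition ppre f (B : set T) : set T := [set x | exists2 y, B y & f x = Some y].
Definition pimg f (A : set T) : set T := [set y | exists2 x, A x & f x = Some y].
Definition pran f : set T := pimg f setT.
Definition pfix f : set T := [set x | f x = Some x].
Definition pinj f : Prop :=
  forall x x' y, f x = Some y -> f x' = Some y -> x = x'.

Definition pdiff f g : set T :=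
  [set x | exists y z, [/\ f x = Some y, g x = Some z & y <> z]].

Definition pmap_dist (R : realType) (m : set T -> R) f g : R :=
  m (pdom f `+` pdom g) + m (pdiff f g).

Lemma pdom_pre f : pdom f = ppre f setT.
Proof. by apply/seteqP; split=> x [y]; exists y. Qed.

Lemma pinj_id : pinj (@Some T).
Proof. by move=> x x' y [->] [->]. Qed.

Lemma pinj_empty : pinj (fun=> None).
Proof. by []. Qed.

Lemma pcomp_Some f g x y :
  pcomp f g x = Some y <-> exists2 z, g x = Some z & f z = Some y.
Proof.
rewrite /pcomp; case: (g x) => [z|] /=; split => //.
- by move=> fz; exists z.
- by move=> [_ [<-]].
- by move=> [].
Qed.

Lemma pinj_comp f g : pinj f -> pinj g -> pinj (pcomp f g).
Proof.
move=> fi gi x x' y /pcomp_Some[z gz fz] /pcomp_Some[z' gz' fz'].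
by apply: gi gz _; rewrite (fi _ _ _ fz fz').
Qed.

Lemma ppre_comp f g B : ppre (pcomp f g) B = ppre g (ppre f B).
Proof.
apply/seteqP; split=> x.
  by move=> [y By /pcomp_Some[z gz fz]]; exists z => //; exists y.
by move=> [z [y By fz] gz]; exists y => //; apply/pcomp_Some; exists z.
Qed.

Lemma pimg_comp f g A : pimg (pcomp f g) A = pimg f (pimg g A).
Proof.
apply/seteqP; split=> y.
  by move=> [x Ax /pcomp_Some[z gz fz]]; exists z => //; exists x.
by move=> [z [x Ax gz] fz]; exists x => //; apply/pcomp_Some; exists z.
Qed.

Lemma pneqE f g : [set x | f x <> g x] = (pdom f `+` pdom g) `|` pdiff f g.
Proof.
apply/seteqP; split=> x /=.
  case fx: (f x) => [y|]; case gx: (g x) => [z|] // fg.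
  - by right; exists y, z; split => // yz; apply: fg; rewrite yz.
  - by left; left; split; [exists y|case=> z; rewrite gx].
  - by left; right; split; [exists z|case=> y; rewrite fx].
case=> [[[[y fx] gx]|[[z gx] fx]]|[y [z [-> -> yz [/yz]]]]] //.
  by rewrite fx => gy; apply: gx; exists y.
by rewrite gx => fz; apply: fx; exists z.
Qed.

Lemma pneq_disj f g : (pdom f `+` pdom g) `&` pdiff f g = set0.
Proof.
apply/seteqP; split=> x //= [[] [[u fx] gx] [y [z [fy gz _]]]].
  by apply: gx; exists z.
by apply: gx; exists y.
Qed.

End partial_maps.

(* [metricType R] need not be pointed, so completeness is spelled out instead
   of being inherited from the library's structure of complete uniform spaces. *)
Definition polish (R : realType) (P : metricType R) : Prop :=
  (forall F : set_system P, ProperFilter F -> cauchy F -> exists p : P, F --> p)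
  /\ exists2 D : set P, countable D & dense D.

(* Measurable spaces that are isomorphic to a Polish space with its Borel
   sigma-algebra [<<s open >>]. *)
HB.mixin Record isStandardBorel (R : realType) (d : measure_display) T
    & Measurable d T := {
  standard_borelP : exists (P : metricType R) (f : T -> P),
    [/\ polish P, bijective f &
        forall A : set P, measurable (f @^-1` A) <-> <<s open >> A]
}.

#[short(type="standardBorelType")]
HB.structure Definition StandardBorel (R : realType) (d : measure_display) :=
  {T of Measurable d T & isStandardBorel R d T}.

Section standard_borel.
Context (R : realType) (d : measure_display) (X : standardBorelType R d).

Lemma open_mball (P : metricType R) (p : P) (e : R) :
  open [set q | mdist p q < e].
Proof.
rewrite openE => q /= pq; apply/nbhs_ballP; exists (e - mdist p q) => /=.
  by rewrite subr_gt0.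
move=> r; rewrite ballEmdist /= => qr.
by apply: le_lt_trans (metric_triangle p q r) _; rewrite -ltrBrDl.
Qed.

Lemma standard_borel_separating : exists B : nat * nat -> set X,
  (forall i, measurable (B i)) /\
  (forall x y, x <> y -> exists i, B i x /\ ~ B i y).
Proof.
have [P [f [[_ [D D_count D_dense]] f_bij f_meas]]] := @standard_borelP R d X.
have [u Du] : exists u : nat -> P, forall q, D q -> exists n, u n = q.
  have [D0|[u]] := pfcard_geP D_count.
    by exists (fun=> f point) => q; rewrite D0.
  by exists u => q /(@surj _ _ _ _ u)[n _ <-]; exists n.
exists (fun i => f @^-1` [set q | mdist (u i.1) q < i.2.+1%:R^-1]).
split=> [i|x y xy].
  by apply/f_meas; apply: sub_sigma_algebra; exact: open_mball.
have fxy : f x <> f y by move=> /(bij_inj f_bij)/xy.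
have e0 : 0 < mdist (f x) (f y) / 2.
  by rewrite divr_gt0// mdist_gt0; exact/eqP.
have [n ne] : exists n, n.+1%:R^-1 < mdist (f x) (f y) / 2.
  by have [n _ /(_ n (leqnn n)) ne] := near_infty_natSinv_lt (PosNum e0); exists n.
have [|q [/= xq /Du[k uk]]] :=
  D_dense [set q | mdist (f x) q < n.+1%:R^-1] _ (open_mball _ _).
  by exists (f x); rewrite /= mdistxx invr_gt0.
exists (k, n); rewrite /= uk; split; first by rewrite metric_sym.
move=> qy; have := metric_triangle (f x) q (f y); apply/negP; rewrite -ltNge.
by rewrite (splitr (mdist (f x) (f y))) ltrD// (lt_trans _ ne).
Qed.

Lemma measurable_pdiff (g h : X -> option X) :
    (forall B, measurable B -> measurable (ppre g B)) ->
    (forall B, measurable B -> measurable (ppre h B)) ->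
  measurable (pdiff g h).
Proof.
move=> mg mh; have [B [mB Bsep]] := standard_borel_separating.
have -> : pdiff g h = \bigcup_i (ppre g (B i) `&` ppre h (~` B i)).
  apply/seteqP; split=> [x [y [z [gx hx /Bsep[i [Biy Biz]]]]]|x [i _]].
    by exists i => //; split; [exists y|exists z].
  by move=> [[y By gx] [z Bz hx]]; exists y, z; split=> // yz; apply: Bz; rewrite -yz.
apply: countable_bigcupT_measurable => // i; apply: measurableI.
  exact: mg.
by apply/mh/measurableC.
Qed.

End standard_borel.

Record cber (d : measure_display) (X : measurableType d) := Cber {
  cber_rel :> X -> X -> Prop;
  cber_measurable : measurable [set xy : X * X | cber_rel xy.1 xy.2];
  cber_refl : forall x, cber_rel x x;
  cber_sym : forall x y, cber_rel x y -> cber_rel y x;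
  cber_trans : forall y x z, cber_rel x y -> cber_rel y z -> cber_rel x z;
  cber_countable : forall x, countable [set y | cber_rel x y]
}.

(* The elements of the pseudogroup of [E], before identification modulo null
   sets. Taking [A = setT] in the last two fields shows that
   the domain and the range are Borel; the fields then say that the bijection
   from the domain to the range and its inverse are Borel. *)
Record pborel (d : measure_display) (X : measurableType d) (E : cber X) :=
    PBorel {
  pborel_fun :> X -> option X;
  pborel_inj : pinj pborel_fun;
  pborel_cber : forall x y, pborel_fun x = Some y -> E x y;
  pborel_pre : forall A, measurable A -> measurable (ppre pborel_fun A);
  pborel_img : forall A, measurable A -> measurable (pimg pborel_fun A)
}.

Section pborel_monoid.
Context (d : measure_display) (X : measurableType d) (E : cber X).

Lemma measurable_pdom (g : pborel E) : measurable (pdom g).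
Proof. by rewrite pdom_pre; exact: pborel_pre. Qed.

Lemma measurable_pran (g : pborel E) : measurable (pran g).
Proof. exact: pborel_img. Qed.

Let id_cber (x y : X) : Some x = Some y -> E x y.
Proof. by move=> [->]; exact: cber_refl. Qed.

Let id_pre (A : set X) : measurable A -> measurable (ppre Some A).
Proof.
move=> mA; suff -> : ppre Some A = A by [].
by apply/seteqP; split=> [x [y Ay [->]]|x Ax] //; exists x.
Qed.

Let id_img (A : set X) : measurable A -> measurable (pimg Some A).
Proof.
move=> mA; suff -> : pimg Some A = A by [].
by apply/seteqP; split=> [x [y Ay [<-]]|x Ax] //; exists x.
Qed.

Definition pborel_id : pborel E := PBorel (@pinj_id X) id_cber id_pre id_img.

Let empty_cber (x y : X) : None = Some y -> E x y.
Proof. by []. Qed.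

Let empty_pre (A : set X) : measurable A -> measurable (ppre (fun=> None) A).
Proof.
move=> _; suff -> : ppre (fun=> None) A = set0 by exact: measurable0.
by apply/seteqP; split=> x // [].
Qed.

Let empty_img (A : set X) : measurable A -> measurable (pimg (fun=> None) A).
Proof.
move=> _; suff -> : pimg (fun=> None) A = set0 by exact: measurable0.
by apply/seteqP; split=> x // [].
Qed.

Definition pborel_empty : pborel E :=
  PBorel (@pinj_empty X) empty_cber empty_pre empty_img.

Section composition.
Variables g h : pborel E.

Let comp_cber (x y : X) : pcomp g h x = Some y -> E x y.
Proof.
move=> /pcomp_Some[z hz gz]; apply: cber_trans (pborel_cber hz) _.
exact: pborel_cber gz.
Qed.

Let comp_pre (A : set X) : measurable A -> measurable (ppre (pcomp g h) A).
Proof. by move=> mA; rewrite ppre_comp; do 2!apply: pborel_pre. Qed.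

Let comp_img (A : set X) : measurable A -> measurable (pimg (pcomp g h) A).
Proof. by move=> mA; rewrite pimg_comp; do 2!apply: pborel_img. Qed.

Definition pborel_comp : pborel E :=
  PBorel (pinj_comp (@pborel_inj _ _ _ g) (@pborel_inj _ _ _ h))
    comp_cber comp_pre comp_img.

End composition.

End pborel_monoid.

Section full_semigroup.
Context (R : realType) (d : measure_display) (X : standardBorelType R d).
Variables (mu : probability X R) (E : cber X).

Definition measure_preserving : Prop :=
  forall (g : pborel E) (A : set X),
    measurable A -> A `<=` pdom g -> mu (pimg g A) = mu A.

Definition aperiodic : Prop :=
  {ae mu, forall x, infinite_set [set y | E x y]}.

Definition pborel_dist (g h : pborel E) : R :=
  pmap_dist (fun A => fine (mu A)) g h.

Lemma measurable_pborel_diff (g h : pborel E) : measurable (pdiff g h).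
Proof. by apply: measurable_pdiff => B; exact: pborel_pre. Qed.

Lemma measurable_pborel_symdiff (g h : pborel E) :
  measurable (pdom g `+` pdom h).
Proof. by apply: measurableU; apply: measurableD; exact: measurable_pdom. Qed.

Lemma measurable_pborel_neq (g h : pborel E) :
  measurable [set x | g x <> h x].
Proof.
rewrite pneqE; apply: measurableU; first exact: measurable_pborel_symdiff.
exact: measurable_pborel_diff.
Qed.

Lemma pborel_distE (g h : pborel E) :
  pborel_dist g h = fine (mu [set x | g x <> h x]).
Proof.
have mD := measurable_pborel_diff g h; have mS := measurable_pborel_symdiff g h.
rewrite pneqE measureU//; last exact: pneq_disj.
by rewrite fineD// fin_num_measure.
Qed.

Let pborel_distxx g : pborel_dist g g = 0.
Proof.
rewrite pborel_distE; suff -> : [set x | g x <> g x] = set0.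
  by rewrite measure0.
by apply/seteqP; split.
Qed.

Let pborel_distC g h : pborel_dist g h = pborel_dist h g.
Proof.
rewrite !pborel_distE; congr (fine (mu _)).
by apply/seteqP; split=> x /= /nesym.
Qed.

Let pborel_dist_triangle h g k :
  pborel_dist g k <= pborel_dist g h + pborel_dist h k.
Proof.
have mneq := measurable_pborel_neq.
rewrite !pborel_distE -fineD ?fin_num_measure// fine_le ?fin_numD ?fin_num_measure//.
apply: (@le_trans _ _ (mu ([set x | g x <> h x] `|` [set x | h x <> k x]))).
  apply: le_measure; rewrite ?inE//; first exact: measurableU.
  move=> x /= gk; have [gh|gh] := pselect (g x = h x); last by left.
  by right; rewrite -gh.
exact: measureU2.
Qed.

Definition pborel_pseudometric : pseudometric R (pborel E) :=
  Pseudometric pborel_distxx pborel_distC pborel_dist_triangle.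

Definition full_semigroup : Type := metric_quotient pborel_pseudometric.

Definition fsclass (g : pborel E) : full_semigroup :=
  mclass pborel_pseudometric g.

Definition fsdist (phi psi : full_semigroup) : R := mdist_quotient phi psi.
Definition fsid : full_semigroup := fsclass (pborel_id E).
Definition fsempty : full_semigroup := fsclass (pborel_empty E).

(* These two operations are computed on representatives; see [fscomp_class]
   and [fsfix_class] for the independence from their choice. *)
Definition fscomp (phi psi : full_semigroup) : full_semigroup :=
  fsclass (pborel_comp (mrepr phi) (mrepr psi)).
Definition fsfix (phi : full_semigroup) : R := fine (mu (pfix (mrepr phi))).

Definition full_group : set full_semigroup :=
  [set fsclass g | g in [set g : pborel E | pdom g = setT /\ pran g = setT]].

Lemma fsdist_class g h : fsdist (fsclass g) (fsclass h) = pborel_dist g h.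
Proof. exact: mdist_quotientE. Qed.

Lemma fsclassP g h :
  fsclass g = fsclass h <-> mu [set x | g x <> h x] = 0%E.
Proof.
have -> : fsclass g = fsclass h <-> pborel_dist g h = 0.
  exact: (mclassP pborel_pseudometric).
rewrite pborel_distE; split=> [mu0|->//].
by rewrite -[LHS]fineK ?mu0// fin_num_measure//; exact: measurable_pborel_neq.
Qed.

Lemma fscomp_class g h : measure_preserving ->
  fscomp (fsclass g) (fsclass h) = fsclass (pborel_comp g h).
Proof.
move=> mp; have mneq := measurable_pborel_neq.
set g' := mrepr (fsclass g); set h' := mrepr (fsclass h).
have /fsclassP gg' : fsclass g' = fsclass g by exact: mreprK.
have /fsclassP hh' : fsclass h' = fsclass h by exact: mreprK.
apply/fsclassP; set N := [set x | g' x <> g x].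
have mN : measurable N by exact: mneq.
have preN0 : mu (ppre h N) = 0%E.
  rewrite -(mp h); last 2 first.
  - exact: pborel_pre.
  - by move=> x [y _ hy]; exists y.
  apply: (subset_measure0 _ mN _ gg'); first by apply/pborel_img/pborel_pre.
  by move=> y [x [z Nz hz]]; rewrite hz => -[<-].
apply: (subset_measure0 (B := [set x | h' x <> h x] `|` ppre h N)).
- exact: mneq.
- by apply: measurableU => //; exact: pborel_pre.
- move=> x /=; have [hx|hx] := pselect (h' x = h x); last by left.
  rewrite /pcomp hx; case hz : (h x) => [z|] //= gz.
  by right; exists z.
- apply/eqP; rewrite eq_le measure_ge0 andbT -[leRHS]adde0 -{1}hh' -preN0.
  by apply: measureU2 => //; exact: pborel_pre.
Qed.

Lemma full_group_comp phi psi : measure_preserving ->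
  full_group phi -> full_group psi -> full_group (fscomp phi psi).
Proof.
move=> mp [g [gT gran] <-] [h [hT hran] <-].
exists (pborel_comp g h); last by rewrite fscomp_class.
split; last by rewrite /pran pimg_comp -/(pran h) hran.
by rewrite pdom_pre ppre_comp -!pdom_pre gT -pdom_pre.
Qed.

Lemma measurable_pfix (g : pborel E) : measurable (pfix g).
Proof.
rewrite (_ : pfix g = ~` [set x | g x <> pborel_id E x]).
  exact/measurableC/measurable_pborel_neq.
by apply/seteqP; split=> x /=; [move=> -> /(_ erefl)|move=> /contrapT].
Qed.

Lemma fsfix_class g : fsfix (fsclass g) = fine (mu (pfix g)).
Proof.
have mneq := measurable_pborel_neq; set g' := mrepr (fsclass g).
have /fsclassP gg' : fsclass g' = fsclass g by exact: mreprK.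
rewrite /fsfix -/g'; congr fine.
have le_fix (h k : pborel E) : mu [set x | h x <> k x] = 0%E ->
    (mu (pfix h) <= mu (pfix k))%E.
  move=> hk; rewrite -[leRHS]adde0 -hk.
  apply: (@le_trans _ _ (mu (pfix k `|` [set x | h x <> k x]))).
    apply: le_measure; rewrite ?inE; first exact: measurable_pfix.
    + by apply: measurableU => //; exact: measurable_pfix.
    + move=> x /= hx; have [hkx|] := pselect (h x = k x); last by right.
      by left; rewrite /pfix/= -hkx.
  by apply: measureU2 => //; exact: measurable_pfix.
apply/eqP; rewrite eq_le; apply/andP; split; apply: le_fix => //.
by rewrite -gg'; congr (mu _); apply/seteqP; split=> x /= /nesym.
Qed.

End full_semigroup.
Arguments full_group {R d X} mu E _.

Record pbij (N : nat) := PBij {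
  pbij_fun :> 'I_N -> option 'I_N;
  pbij_inj : pinj pbij_fun
}.

Section pbij_monoid.
Context (N : nat).

Definition pbij_id : pbij N := PBij (@pinj_id 'I_N).
Definition pbij_empty : pbij N := PBij (@pinj_empty 'I_N).
Definition pbij_comp (f g : pbij N) : pbij N :=
  PBij (pinj_comp (@pbij_inj N f) (@pbij_inj N g)).

Lemma pinj_perm (s : 'S_N) : pinj (fun i => Some (s i)).
Proof. by move=> i i' j [<-] [/perm_inj]. Qed.

Definition perm_pbij (s : 'S_N) : pbij N := PBij (@pinj_perm s).

End pbij_monoid.

Definition mu_count (R : realType) (N : nat) (A : set 'I_N) : R :=
  #|A|%:R / N%:R.

Definition pbij_dist (R : realType) (N : nat) (f g : pbij N) : R :=
  pmap_dist (@mu_count R N) f g.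

Definition sofic (R : realType) (d : measure_display)
    (X : standardBorelType R d) (mu : probability X R) (E : cber X) : Prop :=
  forall (K : set (full_semigroup mu E)) (eps : R), finite_set K -> 0 < eps ->
  exists (N : nat) (p : full_semigroup mu E -> pbij N),
    (0 < N)%N /\
    [/\ p (fsid mu E) = pbij_id N /\ p (fsempty mu E) = pbij_empty N,
        forall phi psi, K phi -> K psi ->
          pbij_dist R (p (fscomp phi psi)) (pbij_comp (p phi) (p psi)) < eps &
        forall phi, K phi ->
          `|fsfix phi - mu_count R (pfix (p phi))| < eps].

Definition perm_dist (R : realType) (N : nat) (s t : 'S_N) : R :=
  pbij_dist R (perm_pbij s) (perm_pbij t).

Section perm_dist.
Context (R : realType) (N : nat).
Implicit Types s t : 'S_N.

Lemma perm_distE s t :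
  perm_dist R s t = #|[pred i | s i != t i]|%:R / N%:R.
Proof.
rewrite /perm_dist /pbij_dist /pmap_dist /mu_count.
have domT u : pdom (perm_pbij u) = setT.
  by apply/seteqP; split=> // i _; exists (u i).
rewrite !domT setYK (_ : #|(set0 : set 'I_N)| = 0)%N; last first.
  by apply: eq_card0 => i; rewrite in_set0.
rewrite mul0r add0r; congr (_%:R / _); apply: eq_card => i.
rewrite [in RHS]inE; apply/idP/idP => [|/eqP st].
  by rewrite inE => -[_ [_ [[<-] [<-] /eqP]]].
by rewrite inE; exists (s i), (t i).
Qed.

Lemma perm_dist_ge0 s t : 0 <= perm_dist R s t.
Proof. by rewrite perm_distE divr_ge0. Qed.

Lemma perm_dist_le1 s t : perm_dist R s t <= 1.
Proof.
rewrite perm_distE; case: N s t => [|n] s t; first by rewrite invr0 mulr0.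
by rewrite ler_pdivrMr// mul1r ler_nat -[leqRHS]card_ord max_card.
Qed.

Lemma perm_distxx s : perm_dist R s s = 0.
Proof.
rewrite perm_distE (_ : #|_| = 0)%N ?mul0r//.
by apply: eq_card0 => i; rewrite inE eqxx.
Qed.

Lemma perm_distC s t : perm_dist R s t = perm_dist R t s.
Proof.
rewrite !perm_distE; congr (_%:R / _); apply: eq_card => i.
by rewrite !inE eq_sym.
Qed.

Lemma perm_dist_triangle t s u :
  perm_dist R s u <= perm_dist R s t + perm_dist R t u.
Proof.
rewrite !perm_distE -mulrDl ler_wpM2r// -natrD ler_nat.
rewrite -cardUI; apply: leq_trans (leq_addr _ _).
apply/subset_leq_card/fintype.subsetP => i; rewrite !inE.
by apply: contraR; rewrite negb_or !negbK => /andP[/eqP-> /eqP->].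
Qed.

Lemma perm_dist_mul s s' t t' :
  perm_dist R (s * t)%g (s' * t')%g <= perm_dist R s s' + perm_dist R t t'.
Proof.
apply: le_trans (perm_dist_triangle (s' * t)%g _ _) _; apply: lerD.
  rewrite !perm_distE ler_wpM2r// ler_nat; apply/subset_leq_card/fintype.subsetP.
  by move=> i; rewrite !inE !permM; apply: contra => /eqP->.
rewrite !perm_distE ler_wpM2r// ler_nat.
rewrite -(fintype.card_image (@perm_inj _ s')).
apply/subset_leq_card/fintype.subsetP => _ /fintype.imageP[i + ->].
by rewrite !inE !permM.
Qed.

End perm_dist.

Section ultraproduct.
Context (R : realType) (U : set_system nat) {UU : UltraFilter U}.
Variable n : nat -> nat.
Implicit Types x y z : forall k, 'S_(n k).

Definition seq_dist x y : R := lim (perm_dist R (x k) (y k) @[k --> U]).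

Lemma seq_dist_cvg x y : perm_dist R (x k) (y k) @[k --> U] --> seq_dist x y.
Proof.
suff [l xyl] : exists l : R, perm_dist R (x k) (y k) @[k --> U] --> l.
  exact: (cvgP l xyl).
have [l [_ cl]] : `[0, 1]%classic `&`
    cluster (perm_dist R (x k) (y k) @[k --> U]) !=set0.
  apply: (@segment_compact R 0 1).
  suff : \forall k \near U, `[0, 1]%classic (perm_dist R (x k) (y k)) by [].
  by apply: filterE => k; rewrite /= in_itv/= perm_dist_ge0 perm_dist_le1.
exists l => A lA.
have [//|UnA] := in_ultra_setVsetC
  ((fun k => perm_dist R (x k) (y k)) @^-1` A) UU.
by have [r [nAr]] := cl (~` A) A UnA lA.
Qed.

Let seq_distxx x : seq_dist x x = 0.
Proof.
apply/cvg_lim => //; under eq_fun do rewrite perm_distxx; exact: cvg_cst.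
Qed.

Let seq_distC x y : seq_dist x y = seq_dist y x.
Proof.
by rewrite /seq_dist; under eq_fun do rewrite perm_distC.
Qed.

Let seq_dist_triangle y x z :
  seq_dist x z <= seq_dist x y + seq_dist y z.
Proof.
apply: (ler_cvg_to (@seq_dist_cvg x z)
  (cvgD (@seq_dist_cvg x y) (@seq_dist_cvg y z))).
by apply: filterE => k; exact: perm_dist_triangle.
Qed.

Definition seq_pseudometric : pseudometric R (forall k, 'S_(n k)) :=
  Pseudometric seq_distxx seq_distC seq_dist_triangle.

Definition ultraproduct : Type := metric_quotient seq_pseudometric.

Definition uclass (x : forall k, 'S_(n k)) : ultraproduct :=
  mclass seq_pseudometric x.

Definition udist (a b : ultraproduct) : R := mdist_quotient a b.

(* Permutations act on the right in the library: [(s * t)%g] maps [i] to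
   [t (s i)], hence the swap, which makes this product the one induced by the
   composition of functions, in accordance with [fscomp]. It is computed on
   representatives; see [ucomp_class] for the independence from their choice. *)
Definition ucomp (a b : ultraproduct) : ultraproduct :=
  uclass (fun k => (mrepr b k * mrepr a k)%g).

Lemma ucomp_class x y :
  ucomp (uclass x) (uclass y) = uclass (fun k => (y k * x k)%g).
Proof.
apply/(mclassP seq_pseudometric)/eqP; rewrite eq_le pdist_ge0 andbT.
set x' := mrepr (uclass x); set y' := mrepr (uclass y).
have xx' : seq_dist x' x = 0 by exact: (mrepr_class seq_pseudometric).
have yy' : seq_dist y' y = 0 by exact: (mrepr_class seq_pseudometric).
rewrite -[leRHS]addr0 -{1}yy' -xx'.
apply: (ler_cvg_to (@seq_dist_cvg _ _)
  (cvgD (@seq_dist_cvg y' y) (@seq_dist_cvg x' x))).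
by apply: filterE => k; exact: perm_dist_mul.
Qed.

End ultraproduct.
Arguments ultraproduct R U {UU} n.

Definition embeds_isometrically (R : realType) (d : measure_display)
    (X : standardBorelType R d) (mu : probability X R) (E : cber X)
    (U : set_system nat) {UU : UltraFilter U} (n : nat -> nat) : Prop :=
  exists theta : full_semigroup mu E -> ultraproduct R U n,
    (forall phi psi, full_group mu E phi -> full_group mu E psi ->
       theta (fscomp phi psi) = ucomp (theta phi) (theta psi)) /\
    (forall phi psi, full_group mu E phi -> full_group mu E psi ->
       udist (theta phi) (theta psi) = fsdist phi psi).
Arguments embeds_isometrically {R d X} mu E U {UU} n.

Definition free_filter (U : set_system nat) : Prop :=
  \bigcap_(A in U) A = set0.

(* Main.v *)
Require Import Defs.
From HB Require Import structures.
From mathcomp Require Import all_boot all_order all_algebra all_fingroup.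
From mathcomp Require Import all_classical all_reals all_analysis.
From mathcomp Require Import lra.

Set Implicit Arguments.
Unset Strict Implicit.
Unset Printing Implicit Defensive.

Import Order.TTheory GRing.Theory Num.Theory.
Import numFieldNormedType.Exports.

Local Open Scope classical_set_scope.
Local Open Scope ring_scope.

(** Everything rests on a countable family of partial Borel isomorphisms whose
graphs cover the relation almost everywhere.  Its existence is a measured form
of the Lusin-Novikov theorem ([lusin_novikov_ideal]): a Borel subset of a
square is the projection of a closed set, so each of its points is coded by a
branch of a countably branching tree; discarding from every node the part of
the base over which countably many Borel functions already suffice leaves, over
almost every point of the base, a tree in which each node splits, and such a
tree would have uncountably many branches.  Measure preservation then makes the
saturation of a null set null, and aperiodicity makes partial transversals null.
Greedy exhaustion along the covering family yields two facts about the full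
group: every partial isomorphism is almost everywhere the restriction of one of
its elements ([full_extension]), and every Borel set is, up to a null set, the
support of one of its elements ([exists_support]).  The covering family and the
separability of the measure algebra also make the full group separable
([full_group_separable]).

An isometric embedding of the full group into the ultraproduct remembers
supports.  The support of a product of permutations lies in the union of the
supports, and an isometry preserves their measures, so elements with disjoint
supports go to permutations with asymptotically disjoint supports.  With
[exists_support], this induces an embedding of the measure algebra, sending a
set to the support of any element that it supports, and this embedding
intertwines the two actions.  An element of the full semigroup is sent to the
permutation of an extending element of the full group, cut down to the set
attached to its domain; this is asymptotically multiplicative and preserves the
measures of the sets of fixed points ([embedding_sofic]).

Conversely, an approximation of finitely many elements of the full group and of
their inverses is nearly a permutation on each of them, because a product with
an inverse is the identity.  It is nearly isometric, because the distance from
one element to another is one minus the measure of the fixed points of a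
quotient ([sofic_permutations]).  Choosing such approximations for larger and
larger finite parts of a countable dense set, and sending an arbitrary element
at stage [k] to the image of its nearest point among the first ones, gives an
isometric homomorphism without any completeness argument
([sofic_embedding]). *)

(** * Polish metrics and analytic sets *)

Lemma ex_natSinv_lt (R : realType) (e : R) : 0 < e -> exists n, n.+1%:R^-1 < e.
Proof.
move=> e0; have [n _ /(_ n (leqnn n)) ne] := near_infty_natSinv_lt (PosNum e0).
by exists n.
Qed.

Lemma natSinv_gt0 (R : realType) n : 0 < (n.+1%:R^-1 : R).
Proof. by rewrite invr_gt0 ltr0n. Qed.

Lemma natSinv_anti (R : realType) m n :
  (m <= n)%N -> (n.+1%:R^-1 : R) <= m.+1%:R^-1.
Proof. by move=> mn; rewrite lef_pV2 ?posrE ?ltr0n// ler_nat. Qed.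

(** A standard Borel type does not carry a topology.  The metric of the Polish
space behind it is transported here to the type itself, as a function. *)
Record polish_metric (R : realType) (T : Type) := PolishMetric {
  pm_dist :> pseudometric R T;
  pm_eq : forall x y, pm_dist x y = 0 -> x = y;
  pm_seq : nat -> T;
  pm_dense : forall x e, 0 < e -> exists n, pm_dist x (pm_seq n) < e;
  pm_complete : forall v : nat -> T,
    (forall e, 0 < e -> exists N, forall m n,
       (N <= m)%N -> (N <= n)%N -> pm_dist (v m) (v n) < e) ->
    exists x, forall e, 0 < e -> exists N, forall n,
      (N <= n)%N -> pm_dist (v n) x < e
}.

Section polish_metric_theory.
Context (R : realType) (T : Type) (rho : polish_metric R T).

Definition sigma_closed (D : set (set T)) : Prop :=
  (forall A, D A -> D (~` A)) /\
  (forall F : nat -> set T, (forall n, D (F n)) -> D (\bigcup_n F n)).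

Lemma open_sigma_closed (D : set (set T)) (U : set T) : sigma_closed D ->
  D set0 -> (forall i k, D [set y | rho (pm_seq rho i) y < k.+1%:R^-1]) ->
  (forall x, U x -> exists2 e, 0 < e & forall y, rho x y < e -> U y) -> D U.
Proof.
move=> [DC DU] D0 Db oU.
pose F n := if (unpickle n : option (nat * nat)) is Some (i, k) then
   if pselect (forall y, rho (pm_seq rho i) y < k.+1%:R^-1 -> U y)
   then [set y | rho (pm_seq rho i) y < k.+1%:R^-1] else set0 else set0.
suff -> : U = \bigcup_n F n.
  apply: DU => n; rewrite /F; case: unpickle => [[i k]|//].
  by case: pselect => h /=; [exact: Db|exact: D0].
apply/seteqP; split => [x Ux|x [n _]].
  have [e e0 eU] := oU _ Ux.
  have [k ke] : exists k, k.+1%:R^-1 < e / 2 by apply: ex_natSinv_lt; lra.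
  have [i xi] := pm_dense rho x (natSinv_gt0 R k).
  exists (pickle (i, k)) => //; rewrite /F pickleK; case: pselect => [_|]/=.
    by rewrite pdistC.
  move=> h; exfalso; apply: h => y iy; apply: eU.
  move: ke xi iy (pdist_triangle rho (pm_seq rho i) x y).
  by set a := k.+1%:R^-1 => *; lra.
rewrite /F; case: unpickle => [[i k]|//]; case: pselect => //= h; exact: h.
Qed.

(** Closedness in the product of [T] with the Baire space, in terms of basic
neighbourhoods. *)
Definition pm_closed (F : T -> (nat -> nat) -> Prop) : Prop :=
  forall x s, (forall n, exists y t, [/\ rho x y <= n.+1%:R^-1,
    forall i, (i < n)%N -> t i = s i & F y t]) -> F x s.

(** The projections along the Baire space of closed sets.  The class is not
closed under complements; Borel sets are reached through the sets that are
analytic together with their complement. *)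
Definition analytic (B : set T) : Prop :=
  exists2 F, pm_closed F & forall x, B x <-> exists s, F x s.

(** The first entry of the branch tells which of the sets is meant. *)
Lemma analytic_bigcup (B : nat -> set T) :
  (forall n, analytic (B n)) -> analytic (\bigcup_n B n).
Proof.
move=> /(_ _)/cid2 aB.
pose F n := sval (aB n).
have Fc n : pm_closed (F n) by rewrite /F; case: (aB n).
have FP n x : B n x <-> exists s, F n x s by rewrite /F; case: (aB n).
exists (fun x s => F (s 0%N) x (fun n => s n.+1)).
  move=> x s h; apply: Fc => n.
  have [y [t [xy ts Ft]]] := h n.+1.
  exists y, (fun n => t n.+1); split.
  - by apply: le_trans xy _; apply: natSinv_anti.
  - by move=> i ni; apply: ts.
  - by rewrite -ts.
move=> x; split=> [[n _ /FP[s Fs]]|[s Fs]].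
  by exists (fun k => if k is k'.+1 then s k' else n).
by exists (s 0%N) => //; apply/FP; eexists; exact: Fs.
Qed.

(** A branch is cut into countably many branches along a pairing of the
naturals, one for each set. *)
Lemma analytic_bigcap (B : nat -> set T) :
  (forall n, analytic (B n)) -> analytic (\bigcap_n B n).
Proof.
move=> /(_ _)/cid2 aB.
pose F n := sval (aB n).
have Fc n : pm_closed (F n) by rewrite /F; case: (aB n).
have FP n x : B n x <-> exists s, F n x s by rewrite /F; case: (aB n).
exists (fun x s => forall k, F k x (fun n => s (pickle (k, n)))).
  move=> x s h k; apply: Fc => n.
  have [y [t [xy ts Ft]]] := h (\max_(i < n) (pickle (k, i : nat)).+1 + n)%N.
  exists y, (fun n => t (pickle (k, n))); split => //.
    by apply: le_trans xy _; apply: natSinv_anti; apply: leq_addl.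
  move=> i ni; apply: ts; apply: leq_trans (leq_addr _ _).
  exact: (@leq_bigmax _ (fun i : (ordinal n) => (pickle (k, i : nat)).+1) (Ordinal ni)).
move=> x; split=> [Bx|[s Fs] k _]; last by apply/FP; eexists; exact: Fs.
have /(_ _)/cid Ex k : exists s, F k x s by apply/FP/Bx.
pose s k := sval (Ex k); have Fs k : F k x (s k) by rewrite /s; case: (Ex k).
exists (fun m => if unpickle m is Some (k, n) then s k n else 0%N) => k.
suff -> : (fun n => if unpickle (pickle (k, n)) is Some (k, n) then s k n else 0%N)
   = s k by [].
by apply/funext => n; rewrite pickleK.
Qed.

Lemma analytic_closed (C : set T) :
  (forall x, (forall n, exists2 y, rho x y <= n.+1%:R^-1 & C y) -> C x) ->
  analytic C.
Proof.
move=> cC; exists (fun x _ => C x).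
  by move=> x s h; apply: cC => n; have [y [t []]] := h n; exists y.
by move=> x; split=> [Cx|[]//]; exists (fun=> 0%N).
Qed.

Lemma analytic_open (U : set T) :
  (forall x, U x -> exists2 e, 0 < e & forall y, rho x y < e -> U y) ->
  analytic U.
Proof.
move=> oU.
pose B n := [set x | forall y, rho x y < n.+1%:R^-1 -> U y].
suff -> : U = \bigcup_n B n.
  apply: analytic_bigcup => n; apply: analytic_closed => x h y xy.
  have [k] := @ex_natSinv_lt R (n.+1%:R^-1 - rho x y) ltac:(by rewrite subr_gt0).
  have [z xz Bz] := h k.
  move=> ke; apply: Bz.
  move: ke xz (pdist_triangle rho x z y); rewrite (pdistC _ z x).
  by set a := n.+1%:R^-1; set b := k.+1%:R^-1 => *; lra.
apply/seteqP; split => [x Ux|x [n _]].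
  have [e e0 eU] := oU _ Ux; have [n ne] := ex_natSinv_lt e0.
  by exists n => // y xy; apply: eU; exact: lt_trans xy ne.
by apply; rewrite pdistxx natSinv_gt0.
Qed.

Lemma sigma_closed_analytic :
  sigma_closed [set B | analytic B /\ analytic (~` B)].
Proof.
split=> [A []|F aF]; first by rewrite /= setCK.
split; first by apply: analytic_bigcup => n; apply: (aF n).1.
by rewrite setC_bigcup; apply: analytic_bigcap => n; apply: (aF n).2.
Qed.

End polish_metric_theory.

Section polish_prod.
Context (R : realType) (T : Type) (rho : polish_metric R T).

Definition prod_dist (z w : T * T) : R := Num.max (rho z.1 w.1) (rho z.2 w.2).

Let dxx z : prod_dist z z = 0.
Proof. by rewrite /prod_dist !pdistxx maxxx. Qed.

Let dC z w : prod_dist z w = prod_dist w z.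
Proof. by rewrite /prod_dist pdistC (pdistC _ z.2). Qed.

Let dtri y x z : prod_dist x z <= prod_dist x y + prod_dist y z.
Proof.
rewrite /prod_dist ge_max; apply/andP; split.
  by apply: le_trans (pdist_triangle _ y.1 _ _) _; apply: lerD;
    rewrite le_max lexx.
by apply: le_trans (pdist_triangle _ y.2 _ _) _; apply: lerD;
  rewrite le_max lexx orbT.
Qed.

Definition prod_pseudo : pseudometric R (T * T) := Pseudometric dxx dC dtri.

Let deq z w : prod_pseudo z w = 0 -> z = w.
Proof.
move=> /= h.
have h1 : rho z.1 w.1 <= 0 by rewrite -h /prod_dist le_max lexx.
have h2 : rho z.2 w.2 <= 0 by rewrite -h /prod_dist le_max lexx orbT.
case: z w h h1 h2 => [z1 z2] [w1 w2] _ /= h1 h2.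
by congr (_, _); apply: (pm_eq (p := rho)); apply/eqP; rewrite eq_le pdist_ge0 andbT.
Qed.

Definition prod_seq n : T * T :=
  let ij := odflt (0%N, 0%N) (unpickle n) in
  (pm_seq rho ij.1, pm_seq rho ij.2).

Let ddense z e : 0 < e -> exists n, prod_pseudo z (prod_seq n) < e.
Proof.
move=> e0; have [i hi] := pm_dense rho z.1 e0.
have [j hj] := pm_dense rho z.2 e0.
by exists (pickle (i, j)); rewrite /= /prod_dist /prod_seq pickleK/= gt_max hi hj.
Qed.

Let dcomplete (v : nat -> T * T) :
    (forall e, 0 < e -> exists N, forall m n,
       (N <= m)%N -> (N <= n)%N -> prod_pseudo (v m) (v n) < e) ->
    exists x, forall e, 0 < e -> exists N, forall n,
      (N <= n)%N -> prod_pseudo (v n) x < e.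
Proof.
move=> h.
have [e e0|x1 h1] := @pm_complete _ _ rho (fun n => (v n).1).
  have [N hN] := h e e0; exists N => m n Nm Nn.
  by have := hN m n Nm Nn; rewrite /= /prod_dist gt_max => /andP[].
have [e e0|x2 h2] := @pm_complete _ _ rho (fun n => (v n).2).
  have [N hN] := h e e0; exists N => m n Nm Nn.
  by have := hN m n Nm Nn; rewrite /= /prod_dist gt_max => /andP[].
exists (x1, x2) => e e0; have [N1 H1] := h1 e e0; have [N2 H2] := h2 e e0.
exists (maxn N1 N2) => n; rewrite geq_max => /andP[n1 n2].
by rewrite /= /prod_dist gt_max H1 ?H2.
Qed.

Definition polish_prod : polish_metric R (T * T) :=
  PolishMetric deq ddense dcomplete.

Lemma polish_prodE z w : polish_prod z w = Num.max (rho z.1 w.1) (rho z.2 w.2).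
Proof. by []. Qed.

End polish_prod.

Section standard_borel_metric.
Context (R : realType) (d : measure_display) (X : standardBorelType R d).

(** The second clause is generation by the open sets, in the form of an induction
principle for Borel sets. *)
Lemma standard_borel_metric : exists rho : polish_metric R X,
  (forall x e, measurable [set y | rho x y < e]) /\
  (forall D : set (set X), sigma_closed D ->
     (forall U : set X, (forall x, U x ->
        exists2 e, 0 < e & forall y, rho x y < e -> U y) -> D U) ->
     forall A, measurable A -> D A).
Proof.
have [P [f [[Pc [S S_count S_dense]] f_bij f_meas]]] := @standard_borelP R d X.
have [g fK gK] := f_bij.
have [u Su] : exists u : nat -> P, forall q, S q -> exists n, u n = q.
  have [S0|[u]] := pfcard_geP S_count.
    by exists (fun=> f point) => q; rewrite S0.
  by exists u => q /(@surj _ _ _ _ u)[n _ <-]; exists n.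
pose rho0 x y := mdist (f x) (f y).
have r0 x : rho0 x x = 0 by exact: mdistxx.
have rC x y : rho0 x y = rho0 y x by exact: metric_sym.
have rT y x z : rho0 x z <= rho0 x y + rho0 y z by exact: metric_triangle.
pose rho1 := Pseudometric r0 rC rT.
have req x y : rho1 x y = 0 -> x = y.
  move=> h; apply: (bij_inj f_bij); apply/eqP; apply/negPn/negP => fxy.
  by have := mdist_gt0 (f x) (f y); rewrite fxy; move: h; rewrite /= /rho0 => ->; rewrite ltxx.
have rdense x e : 0 < e -> exists n, rho1 x (g (u n)) < e.
  move=> e0; have [|q [/= xq /Su[n un]]] :=
    S_dense [set q | mdist (f x) q < e] _ (open_mball _ _).
    by exists (f x); rewrite /= mdistxx.
  by exists n; rewrite /= /rho0 gK un.
have rcomplete (v : nat -> X) :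
    (forall e, 0 < e -> exists N, forall m n,
       (N <= m)%N -> (N <= n)%N -> rho1 (v m) (v n) < e) ->
    exists x, forall e, 0 < e -> exists N, forall n,
      (N <= n)%N -> rho1 (v n) x < e.
  move=> h; have [|p vp] := Pc ((f \o v) @ \oo) _.
    apply: cauchy_exP => e e0; have [N hN] := h _ e0.
    exists (f (v N)); exists N => // n /= Nn.
    by rewrite ballEmdist; apply: hN.
  exists (g p) => e e0.
  have [N _ hN] := vp _ (nbhsx_ballx p e e0).
  exists N => n Nn; have := hN _ Nn.
  by rewrite ballEmdist /= /rho0 gK metric_sym.
exists (PolishMetric req rdense rcomplete); split=> /= [x e|D [DC DU] Do A mA].
  have -> : [set y | rho0 x y < e] = f @^-1` [set q | mdist (f x) q < e] by [].
  by apply/f_meas; apply: sub_sigma_algebra; exact: open_mball.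
have AE : A = f @^-1` (g @^-1` A).
  by apply/seteqP; split=> x /=; rewrite fK.
rewrite AE in mA *; have {mA}/f_meas := mA; set B := _ @^-1` A.
apply: (@smallest_sub _ _ _ [set B | D (f @^-1` B)]).
  split=> /=.
  - rewrite preimage_set0; apply: Do => x [].
  - by move=> C /DC; rewrite setTD.
  - by move=> F /DU; rewrite -preimage_bigcup.
move=> U oU; apply: Do => x /= Ux.
have /nbhs_ballP[e /= e0 eU] : nbhs (f x) U by exact: open_nbhs_nbhs.
by exists e => // y xy; apply: eU; rewrite ballEmdist.
Qed.

(** The sets that are analytic together with their complement form a
sigma-algebra, and every preimage of an open set under a projection is one. *)
Lemma analytic_measurable (rho : polish_metric R X) :
  (forall D : set (set X), sigma_closed D ->
     (forall U : set X, (forall x, U x ->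
        exists2 e, 0 < e & forall y, rho x y < e -> U y) -> D U) ->
     forall A, measurable A -> D A) ->
  forall B : set (X * X), measurable B -> analytic (polish_prod rho) B.
Proof.
move=> gen B mB.
pose D : set (set (X * X)) :=
  [set B | analytic (polish_prod rho) B /\ analytic (polish_prod rho) (~` B)].
have [DC DU] : sigma_closed D by exact: sigma_closed_analytic.
suff DB : D B by case: DB.
have rect (pr : X * X -> X) :
    (forall z w, rho (pr z) (pr w) <= polish_prod rho z w) ->
    forall A, measurable A -> D (pr @^-1` A).
  move=> prr; apply: (gen [set A | D (pr @^-1` A)]).
    by split => /= [A /DC//|F /DU]; rewrite -preimage_bigcup.
  move=> U oU; split.
    apply: analytic_open => z /oU[e e0 eU]; exists e => // w zw.
    by apply: eU; apply: le_lt_trans zw.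
  apply: analytic_closed => z h /= Uz; have [e e0 eU] := oU _ Uz.
  have [n ne] := ex_natSinv_lt e0; have [w zw] := h n; apply; apply: eU.
  by apply: le_lt_trans ne; apply: le_trans zw.
move: B mB; rewrite measurable_prod_measurableType.
apply: smallest_sub.
  split=> //=.
  - have := rect fst _ set0 measurable0.
    by rewrite preimage_set0; apply => z w; rewrite polish_prodE le_max lexx.
  - by move=> C /DC; rewrite setTD.
move=> _ [A mA [B mB] <-].
have -> : A `*` B = ~` ((fst @^-1` (~` A)) `|` (snd @^-1` (~` B))).
  rewrite setCU !preimage_setC !setCK; by apply/seteqP; split.
apply: DC.
have -> : fst @^-1` (~` A) `|` snd @^-1` (~` B) =
    \bigcup_n (if n is 0 then fst @^-1` (~` A) else snd @^-1` (~` B)).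
  apply/seteqP; split=> [z []|z [[|n] _]]; [by exists 0%N|by exists 1%N|by left|by right].
apply: DU => -[|n].
  by apply: rect; [move=> z w; rewrite polish_prodE le_max lexx|exact: measurableC].
by apply: rect; [move=> z w; rewrite polish_prodE le_max lexx orbT|exact: measurableC].
Qed.

End standard_borel_metric.

(** * Essential suprema and null ideals *)

Section real_valued_probability.
Context (R : realType) (d : measure_display) (X : measurableType d).
Variable mu : probability X R.

Definition rmu (A : set X) : R := fine (mu A).

Lemma rmuE A : measurable A -> mu A = (rmu A)%:E.
Proof. by move=> mA; rewrite /rmu fineK// fin_num_measure. Qed.

Lemma rmu_ge0 A : 0 <= rmu A.
Proof. by rewrite /rmu fine_ge0. Qed.

Lemma rmu0 : rmu set0 = 0. Proof. by rewrite /rmu measure0. Qed.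

Lemma rmuT : rmu setT = 1. Proof. by rewrite /rmu probability_setT. Qed.

Lemma rmu_le A B : measurable A -> measurable B -> A `<=` B -> rmu A <= rmu B.
Proof.
move=> mA mB AB; rewrite -lee_fin -!rmuE//.
by apply: le_measure => //; rewrite inE.
Qed.

Lemma rmu_le1 A : measurable A -> rmu A <= 1.
Proof. by move=> mA; rewrite -rmuT; apply: rmu_le. Qed.

Lemma rmuU A B : measurable A -> measurable B -> A `&` B = set0 ->
  rmu (A `|` B) = rmu A + rmu B.
Proof.
move=> mA mB AB; apply: EFin_inj; rewrite EFinD -!rmuE//.
  by rewrite measureU.
exact: measurableU.
Qed.

Lemma rmuDI A B : measurable A -> measurable B ->
  rmu A = rmu (A `\` B) + rmu (A `&` B).
Proof.
move=> mA mB; rewrite -rmuU; [by rewrite setUC setUIDK|exact: measurableD|exact: measurableI|].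
by apply/seteqP; split => // x [[_ nB] [_ /nB]].
Qed.

Lemma rmuC A : measurable A -> rmu (~` A) = 1 - rmu A.
Proof.
move=> mA; rewrite -rmuT (@rmuDI setT A)// setTD setTI addrK//.
Qed.

Lemma rmuUle A B : measurable A -> measurable B ->
  rmu (A `|` B) <= rmu A + rmu B.
Proof.
move=> mA mB; rewrite -lee_fin EFinD -!rmuE//; last exact: measurableU.
exact: measureU2.
Qed.

Lemma rmu_eq0 A : measurable A -> rmu A = 0 <-> mu.-negligible A.
Proof.
move=> mA; split=> [A0|/(negligibleP _ mA) A0]; last by rewrite /rmu A0.
by apply/(negligibleP _ mA); exact: (etrans (rmuE mA) (congr1 EFin A0)).
Qed.

Lemma rmu_cat A B : measurable A -> measurable B ->
  mu.-negligible (A `\` B) -> rmu A <= rmu B.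
Proof.
move=> mA mB /rmu_eq0; rewrite (rmuDI mA mB) => ->; last exact: measurableD.
by rewrite add0r; apply: rmu_le => //; exact: measurableI.
Qed.

Lemma rmu_eq_ae A B : measurable A -> measurable B ->
  mu.-negligible (A `\` B) -> mu.-negligible (B `\` A) -> rmu A = rmu B.
Proof. by move=> mA mB AB BA; apply/eqP; rewrite eq_le !rmu_cat. Qed.

Lemma rmuU_ae A B : measurable A -> measurable B ->
  mu.-negligible (A `&` B) -> rmu (A `|` B) = rmu A + rmu B.
Proof.
move=> mA mB AB0.
have mD : measurable (B `\` A) by exact: measurableD.
rewrite (_ : A `|` B = A `|` (B `\` A)); last first.
  apply/seteqP; split=> x [Ax|Bx]; [by left| |by left|by right; case: Bx].
  by have [Ax|nA] := pselect (A x); [left|right].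
rewrite rmuU//; last by apply/seteqP; split=> // x [Ax []].
rewrite (rmuDI mB mA) setIC (_ : rmu (A `&` B) = 0) ?addr0//.
by apply/rmu_eq0 => //; exact: measurableI.
Qed.

(** Take a sequence of members whose union has the largest possible measure: a
member that added mass to this union would contradict maximality. *)
Lemma ess_supremum (J : Type) (F : J -> set X) (j0 : J) :
  (forall j, measurable (F j)) ->
  exists s : nat -> J, forall j, mu.-negligible (F j `\` \bigcup_n F (s n)).
Proof.
move=> mF.
pose U (s : nat -> J) := \bigcup_n F (s n).
have mU s : measurable (U s) by apply: bigcupT_measurable.
pose S : set R := range (fun s => rmu (U s)).
have hS : has_sup S.
  split; first by exists (rmu (U (fun=> j0))), (fun=> j0).
  by exists 1 => _ [s _ <-]; exact: rmu_le1.
have /(_ _)/cid appr k : exists s, sup S - k.+1%:R^-1 < rmu (U s).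
  by have [_ [s _ <-] h] := sup_adherent (natSinv_gt0 R k) hS; exists s.
pose t k := sval (appr k).
have tP k : sup S - k.+1%:R^-1 < rmu (U (t k)) by rewrite /t; case: (appr k).
pose s n := let p := odflt (0%N, 0%N) (unpickle n) in t p.1 p.2.
have Uts k : U (t k) `<=` U s.
  by move=> x [n _ Fx]; exists (pickle (k, n)) => //; rewrite /s pickleK.
exists s => j.
have mD : measurable (F j `\` U s) by exact: measurableD.
apply/rmu_eq0 => //; apply/eqP; rewrite eq_le rmu_ge0 andbT leNgt.
apply/negP => /ex_natSinv_lt[k kj].
have : rmu (U (fun n => if n is n'.+1 then s n' else j)) <= sup S.
  by apply: ub_le_sup; [exact: hS.2|exists (fun n => if n is n'.+1 then s n' else j)].
have -> : U (fun n => if n is n'.+1 then s n' else j) = U s `|` (F j `\` U s).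
  apply/seteqP; split=> x.
    move=> [[|n] _ Fx]; last by left; exists n.
    by have [|nU] := pselect (U s x); [left|right].
  by move=> [[n _ Fx]|[Fx _]]; [exists n.+1|exists 0%N].
rewrite rmuU//; last by apply/seteqP; split=> // x [Ux []].
have := rmu_le (mU (t k)) (mU s) (Uts k).
by move: (tP k) kj; set a := k.+1%:R^-1; set b := sup S => *; lra.
Qed.

End real_valued_probability.

(** A sigma-ideal satisfying the countable chain condition, stated as the
existence of essential suprema.  The ideal need not come from a single measure:
[pullback_ideal] is given by countably many image measures at once. *)
Record null_ideal (d : measure_display) (X : measurableType d) := NullIdeal {
  ni_set :> set X -> Prop;
  ni_sub : forall A B, A `<=` B -> ni_set B -> ni_set A;
  ni_bigcup : forall A : nat -> set X,
    (forall n, ni_set (A n)) -> ni_set (\bigcup_n A n);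
  ni_ess : forall S : set (set X), S `<=` measurable -> S !=set0 ->
    exists2 A : nat -> set X, (forall n, S (A n)) &
      forall B, S B -> ni_set (B `\` \bigcup_n A n)
}.

Definition pmeas (d : measure_display) (X : measurableType d)
  (f : X -> option X) : Prop := forall B, measurable B -> measurable (ppre f B).

Lemma ppre_bigcup (T : Type) (f : T -> option T) (A : nat -> set T) :
  ppre f (\bigcup_n A n) = \bigcup_n ppre f (A n).
Proof.
apply/seteqP; split=> [x [y [n _ Ay] fx]|x [n _ [y Ay fx]]].
  by exists n => //; exists y.
by exists y => //; exists n.
Qed.

Lemma ppre_setD (T : Type) (f : T -> option T) (A B : set T) :
  ppre f (A `\` B) = ppre f A `\` ppre f B.
Proof.
apply/seteqP; split=> [x [y [Ay nBy] fx]|x [[y Ay fx] nB]].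
  by split; [exists y|move=> [z Bz]; rewrite fx => -[yz]; apply: nBy; rewrite yz].
by exists y => //; split => // By; apply: nB; exists y.
Qed.

(** The sets whose preimage under each of the given partial maps is negligible.
They form the null ideal of the images of [mu] under these maps, without any
need to sum these images to a finite measure. *)
Section pullback_ideal.
Context (R : realType) (d : measure_display) (X : measurableType d).
Variables (mu : probability X R) (phi : nat -> X -> option X).
Hypothesis mphi : forall i, pmeas (phi i).

Let null (A : set X) : Prop := forall i, mu.-negligible (ppre (phi i) A).

Let null_sub A B : A `<=` B -> null B -> null A.
Proof.
move=> AB nB i; apply: negligibleS (nB i) => x [y Ay fx].
by exists y => //; exact: AB.
Qed.

Let null_bigcup (A : nat -> set X) :
  (forall n, null (A n)) -> null (\bigcup_n A n).
Proof.
by move=> nA i; rewrite ppre_bigcup; apply: negligible_bigcup => n; exact: nA.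
Qed.

Let null_ess (S : set (set X)) : S `<=` measurable -> S !=set0 ->
  exists2 A : nat -> set X, (forall n, S (A n)) &
    forall B, S B -> null (B `\` \bigcup_n A n).
Proof.
move=> mS [A0 SA0].
have /(_ _)/cid ex i := @ess_supremum _ _ _ mu {A | S A}
  (fun A => ppre (phi i) (sval A)) (exist _ A0 SA0)
  (fun A => mphi i (mS _ (svalP A))).
pose s i := sval (ex i).
exists (fun n => let p := odflt (0%N, 0%N) (unpickle n) in sval (s p.1 p.2)).
  by move=> n; exact: svalP.
move=> B SB i; have := svalP (ex i) (exist _ B SB) => /=.
apply: negligibleS; rewrite ppre_setD => x [Bx nx]; split => // -[n _ hx].
apply: nx; rewrite ppre_bigcup; exists (pickle (i, n)) => //=.
by rewrite pickleK.
Qed.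

Definition pullback_ideal : null_ideal X :=
  NullIdeal null_sub null_bigcup null_ess.

End pullback_ideal.

Lemma mkseq_eqP (T : Type) (f g : nat -> T) n :
  mkseq f n = mkseq g n <-> forall i, (i < n)%N -> f i = g i.
Proof.
split=> [h i ni|h]; last by apply: (@eq_from_nth _ (f 0%N)) => [|i]; rewrite !size_mkseq// => ni; rewrite !nth_mkseq// h.
by rewrite -(nth_mkseq (f 0%N) f ni) h nth_mkseq.
Qed.

Section extension.
Context (T : eqType).

Definition ext (s t : seq T) : Prop :=
  (size s < size t)%N /\ take (size s) t = s.

Lemma extP (x0 : T) (s t : seq T) : ext s t <->
  (size s < size t)%N /\ forall i, (i < size s)%N -> nth x0 t i = nth x0 s i.
Proof.
split=> -[st h]; split=> //; first by move=> i i_s; rewrite -[in RHS]h nth_take.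
apply: (@eq_from_nth _ x0) => [|i]; rewrite size_takel ?(ltnW st)// => i_s.
by rewrite nth_take// h.
Qed.

Lemma ext_chain (t : nat -> seq T) : (forall n, ext (t n) (t n.+1)) ->
  exists xi : nat -> T, forall n, mkseq xi (size (t n)) = t n.
Proof.
move=> step.
have sz n : (n <= size (t n))%N.
  by elim: n => // n IH; apply: leq_ltn_trans IH _; case: (step n).
have x0 : T by case: (t 1%N) (sz 1%N).
have nthE m n i : (m <= n)%N -> (i < size (t m))%N ->
    nth x0 (t n) i = nth x0 (t m) i.
  elim: n => [|n IH]; first by rewrite leqn0 => /eqP->.
  rewrite leq_eqVlt => /orP[/eqP->//|mn im]; rewrite -IH//.
  have /(extP x0)[_ h] := step n; apply: h; apply: leq_trans im _.
  elim: n mn {IH} => [|n IH]; first by rewrite ltnS leqn0 => /eqP->.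
  rewrite ltnS leq_eqVlt => /orP[/eqP->//|mn].
  by apply: leq_trans (IH mn) _; case: (step n) => /ltnW.
exists (fun i => nth x0 (t i.+1) i) => n.
apply: (@eq_from_nth _ x0) => [|i]; rewrite size_mkseq// => ni.
rewrite nth_mkseq//; have [ni1|ni1] := leqP n i.+1; first exact: nthE.
by rewrite -(nthE _ _ _ (ltnW ni1))//; exact: sz.
Qed.

End extension.

Lemma measurable_bigcup_count (d : measure_display) (X : measurableType d)
    (K : countType) (D : set K) (F : K -> set X) :
  (forall k, D k -> measurable (F k)) -> measurable (\bigcup_(k in D) F k).
Proof.
move=> mF; rewrite bigcup_mkcond; apply: countable_bigcupT_measurable => // k.
by case: ifPn => // /set_mem; exact: mF.
Qed.

(** * A measured Lusin-Novikov theorem *)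

(** The set [E], with countable vertical sections, is the projection of the
closed set [F].  A code is a sequence of pairs: the first entries name balls that
shrink to a point of the square, and the second entries form a branch witnessing
that this point lies in [E].  The node [s] of the tree of codes stands for the
part [Gs s] of [E] having a code that extends [s]. *)
Section lusin_novikov.
Context (R : realType) (d : measure_display) (X : measurableType d).
Variables (rho : polish_metric R X) (J : null_ideal X).
Hypothesis mball : forall x e, measurable [set y | rho x y < e].
Hypothesis rho_gen : forall D : set (set X), sigma_closed D ->
  (forall U : set X, (forall x, U x ->
    exists2 e, 0 < e & forall y, rho x y < e -> U y) -> D U) ->
  forall A, measurable A -> D A.
Variables (E : set (X * X)) (F : X * X -> (nat -> nat) -> Prop).
Hypothesis F_closed : pm_closed (polish_prod rho) F.
Hypothesis FE : forall z, E z <-> exists s, F z s.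
Hypothesis E_count : forall x, countable [set y | E (x, y)].

Let Z := polish_prod rho.
Let u := pm_seq Z.
Let e (n : nat) : R := n.+1%:R^-1.
Local Notation code := (nat * nat)%type.

Let e_gt0 n : 0 < e n. Proof. exact: natSinv_gt0. Qed.

Let le_ball (z c : X * X) r : Z z c <= r -> rho z.1 c.1 <= r /\ rho z.2 c.2 <= r.
Proof. by rewrite /Z polish_prodE ge_max => /andP. Qed.

Let mcball x r : measurable [set y | rho y x <= r].
Proof.
have -> : [set y | rho y x <= r] = \bigcap_n [set y | rho x y < r + e n].
  apply/seteqP; split=> [y /= yx n _|y h /=].
    by rewrite /= pdistC; apply: le_lt_trans yx _; rewrite ltrDl.
  rewrite pdistC; apply/ler_addgt0Pr => eps eps0.
  have [n ne] := ex_natSinv_lt eps0; have /ltW h' := h n I.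
  by apply: le_trans h' _; rewrite lerD2l ltW.
by apply: bigcapT_measurable => n; exact: mball.
Qed.

Let G (z : X * X) (xi : nat -> code) : Prop :=
  (forall n, Z z (u (xi n).1) <= e n) /\ F z (fun n => (xi n).2).

Let Gs (s : seq code) z : Prop := exists2 xi, mkseq xi (size s) = s & G z xi.

Let EGs z : E z -> Gs [::] z.
Proof.
move=> /FE[s Fs].
have /(_ _)/cid h n : exists i, Z z (u i) < e n by exact: pm_dense.
by exists (fun n => (sval (h n), s n)) => //; split=> //= n; rewrite ltW// (svalP (h n)).
Qed.

Let G_Gs xi z n : G z xi -> Gs (mkseq xi n) z.
Proof. by exists xi => //; rewrite size_mkseq. Qed.

Let Gs_le xi m n z : (n <= m)%N -> Gs (mkseq xi m) z -> Gs (mkseq xi n) z.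
Proof.
move=> nm [t]; rewrite size_mkseq => /mkseq_eqP h Gt.
exists t => //; rewrite size_mkseq; apply/mkseq_eqP => i i_n; apply: h.
exact: leq_trans nm.
Qed.

Let Gs_rcons s z : Gs s z -> exists a, Gs (rcons s a) z.
Proof.
move=> [xi h Gz]; exists (xi (size s)), xi => //.
by rewrite size_rcons mkseqS h.
Qed.

Let Gs_ball xi n k z : (k < n)%N -> Gs (mkseq xi n) z -> Z z (u (xi k).1) <= e k.
Proof.
move=> kn [t]; rewrite size_mkseq => /mkseq_eqP h [h1 _].
by rewrite -h.
Qed.

(** Completeness of the metric and closedness of [F]: a branch whose finite
stages are all nonempty codes a point of [E]. *)
Let branch_limit xi :
  (forall n, exists2 m, (n <= m)%N & exists z, Gs (mkseq xi m) z) ->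
  exists z, G z xi.
Proof.
move=> h.
have /(_ _)/cid h' n : exists z, Gs (mkseq xi n) z.
  by have [m nm [z Gz]] := h n; exists z; exact: Gs_le Gz.
pose v n := sval (h' n); have vP n : Gs (mkseq xi n) (v n) := svalP (h' n).
have [r r0|z vz] := @pm_complete _ _ Z v.
  have [k kr] : exists k, e k < r / 2 by apply: ex_natSinv_lt; lra.
  exists k.+1 => m n km kn.
  have := Gs_ball km (vP m); have := Gs_ball kn (vP n).
  move: kr (pdist_triangle Z (u (xi k).1) (v m) (v n)).
  by rewrite (pdistC Z (u _)); set a := e k => *; lra.
exists z; split=> [n|].
  apply/ler_addgt0Pr => r r0; have [N hN] := vz r r0.
  have := hN (maxn N n.+1) (leq_maxl _ _).
  have := Gs_ball (leq_maxr N n.+1) (vP (maxn N n.+1)).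
  move: (pdist_triangle Z (v (maxn N n.+1)) z (u (xi n).1)).
  by rewrite (pdistC Z z (v _)) => *; lra.
apply: F_closed => n; have [N hN] := vz _ (e_gt0 n).
have [t ht [_ Ft]] := vP (maxn N n).
exists (v (maxn N n)), (fun n => (t n).2); split => //.
  by rewrite pdistC ltW// hN// leq_maxl.
move=> i i_n; move: ht; rewrite size_mkseq => /mkseq_eqP -> //.
by apply: leq_trans i_n _; rewrite leq_maxr.
Qed.

Let uncovered (f : nat -> X -> option X) (A : set X) s : set X :=
  [set x | A x /\ exists2 y, Gs s (x, y) & forall n, f n x <> Some y].

Let admissible (f : X -> option X) : Prop :=
  pmeas f /\ forall x y, f x = Some y -> E (x, y).

Let small (A : set X) s : Prop :=
  exists2 f : nat -> X -> option X, (forall n, admissible (f n)) &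
    J (uncovered f A s).

Let admissible_None : admissible (fun=> None).
Proof.
split=> // B _; suff -> : ppre (fun=> None) B = set0 by [].
by apply/seteqP; split=> x // [].
Qed.

Let small_count (K : countType) (f : K -> X -> option X) (A : set X) s :
  (forall k, admissible (f k)) ->
  J [set x | A x /\ exists2 y, Gs s (x, y) & forall k, f k x <> Some y] ->
  small A s.
Proof.
move=> fa Ih.
exists (fun n => if unpickle n is Some k then f k else fun=> None).
  by move=> n; case: unpickle.
apply: ni_sub Ih => x [Ax [y Gy hy]]; split=> //; exists y => // k.
by have := hy (pickle k); rewrite pickleK.
Qed.

Let small_bigcup (A : nat -> set X) s :
  (forall n, small (A n) s) -> small (\bigcup_n A n) s.
Proof.
move=> /(_ _)/cid2 sA; pose f n := sval (sA n).
have fa n k : admissible (f n k) by rewrite /f; case: (sA n).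
have fI n : J (uncovered (f n) (A n) s) by rewrite /f; case: (sA n).
apply: (@small_count (nat * nat)%type (fun p => f p.1 p.2)).
  by move=> p; exact: fa.
apply: ni_sub (ni_bigcup fI) => x [[n _ Ax] [y Gy hy]]; exists n => //.
by split=> //; exists y => // k; exact: (hy (n, k)).
Qed.

Let J0 : J set0.
Proof.
have [N _ /(_ set0)] := @ni_ess _ _ J [set set0] (fun A => ltac:(by move=> ->)) (ex_intro _ set0 erefl).
by rewrite set0D; apply.
Qed.

Let J_bigcup_count (K : countType) (A : K -> set X) :
  (forall k, J (A k)) -> J (\bigcup_(k in setT) A k).
Proof.
move=> JA.
have h n : J (if unpickle n is Some k then A k else set0).
  by case: unpickle.
apply: ni_sub (ni_bigcup h) => x [k _ Ax]; exists (pickle k) => //.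
by rewrite pickleK.
Qed.

Let small_vacuous (A : set X) s :
  (forall x y, A x -> ~ Gs s (x, y)) -> small A s.
Proof.
move=> h; exists (fun _ _ => None) => //.
by apply: ni_sub J0 => x [Ax [y /(h _ _ Ax)]].
Qed.

(** By the chain condition, there is a largest set over which the node [s] is
covered by countably many functions; [W s] is its complement. *)
Let ex_maximal s : exists W : set X, [/\ measurable W, small (~` W) s &
  forall A, measurable A -> small A s -> J (A `&` W)].
Proof.
have [||A SA Ah] := @ni_ess _ _ J [set A | measurable A /\ small A s].
- by move=> A [].
- by exists set0; split => //; apply: small_vacuous.
exists (~` \bigcup_n A n); split.
- by apply/measurableC/bigcupT_measurable => n; exact: (SA n).1.
- by rewrite setCK; apply: small_bigcup => n; exact: (SA n).2.
- by move=> B mB sB; rewrite -setDE; apply: Ah.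
Qed.

Let W s : set X := sval (cid (ex_maximal s)).
Let mW s : measurable (W s). Proof. by rewrite /W; case: cid => ? []. Qed.
Let smallW s : small (~` W s) s. Proof. by rewrite /W; case: cid => ? []. Qed.
Let W_small s A : measurable A -> small A s -> J (A `&` W s).
Proof. by rewrite /W; case: cid => V [mV sV hV]; exact: hV. Qed.

Let CX (s : seq code) : set X :=
  [set x | forall i, (i < size s)%N -> rho x (u (nth (0,0)%N s i).1).1 <= e i].
Let CY (s : seq code) : set X :=
  [set y | forall i, (i < size s)%N -> rho y (u (nth (0,0)%N s i).1).2 <= e i].

Let mCX s : measurable (CX s).
Proof.
have -> : CX s = \bigcap_i [set x | (i < size s)%N ->
    rho x (u (nth (0,0)%N s i).1).1 <= e i].
  by apply/seteqP; split=> [x h i _ /h|x h i]//; exact: h.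
apply: bigcapT_measurable => i; case: (ltnP i (size s)) => i_s.
  rewrite (_ : mkset _ = [set x | rho x (u (nth (0,0)%N s i).1).1 <= e i]).
    exact: mcball.
  by apply/seteqP; split=> x /=; [exact|].
by rewrite (_ : mkset _ = setT)//; apply/seteqP; split.
Qed.

Let GsCX s x y : Gs s (x, y) -> CX s x.
Proof.
move=> [xi <- Gxy] i; rewrite size_mkseq => i_s; rewrite nth_mkseq//.
by have [] := le_ball (Gxy.1 i).
Qed.

Let CY_mkseq xi n y : CY (mkseq xi n) y <->
  forall i, (i < n)%N -> rho y (u (xi i).1).2 <= e i.
Proof.
by split=> h i; have := h i; rewrite size_mkseq => + i_n;
  rewrite nth_mkseq//; exact.
Qed.

Let GCY x y xi n : G (x, y) xi -> CY (mkseq xi n) y.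
Proof. by move=> Gxy; apply/CY_mkseq => i _; have [] := le_ball (Gxy.1 i). Qed.

(** The exceptional sets of a node are null.  Off them, a point of [W s] lies in
some [W] of a child of [s] ([N1]), lies in the balls that [s] prescribes for the
first coordinate ([N2]), and [Gs s] is nonempty ([N3]): in each case the node
would otherwise be covered there, by the functions of its children or by none. *)
Let N1 s : set X := W s `\` \bigcup_(a in [set: code]) W (rcons s a).
Let N2 s : set X := W s `\` CX s.
Let N3 s : set X := if pselect (exists z, Gs s z) then set0 else W s.

Let JN1 s : J (N1 s).
Proof.
rewrite /N1 -{1}(setIid (W s)) setDE -setIA setIC -setDE; apply: W_small.
  by apply: measurableD => //; apply: measurable_bigcup_count.
have /(_ _)/cid2 h a : small (~` W (rcons s a)) (rcons s a) by exact: smallW.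
pose f a := sval (h a).
have fa a k : admissible (f a k) by rewrite /f; case: (h a).
have fI a : J (uncovered (f a) (~` W (rcons s a)) (rcons s a)) by rewrite /f; case: (h a).
apply: (@small_count (code * nat)%type (fun p => f p.1 p.2)).
  by move=> p; exact: fa.
apply: ni_sub (J_bigcup_count (K := (nat * nat)%type) fI).
move=> x [[Wx nWx] [y /Gs_rcons[a Gy] hy]]; exists a => //; split.
  by move=> Wa; apply: nWx; exists a.
by exists y => // k; exact: (hy (a, k)).
Qed.

Let JN2 s : J (N2 s).
Proof.
rewrite /N2 setDE setIC; apply: W_small; first exact: measurableC.
by apply: small_vacuous => x y nC /GsCX.
Qed.

Let JN3 s : J (N3 s).
Proof.
have -> : N3 s = (if pselect (exists z, Gs s z) then set0 else setT) `&` W s.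
  by rewrite /N3; case: pselect => h /=; rewrite ?set0I ?setTI.
apply: W_small; first by case: pselect => h /=.
apply: small_vacuous => x y; case: pselect => //= h _ Gs'.
by apply: h; exists (x, y).
Qed.

Let good x : Prop := forall s, ~ (N1 s `|` N2 s `|` N3 s) x.

Let good_next s x : good x -> W s x -> exists a, W (rcons s a) x.
Proof.
move=> gx Wx; apply: contrapT => h; apply: (gx s); left; left; split=> // -[a _ Wa].
by apply: h; exists a.
Qed.

Let good_CX s x : good x -> W s x -> CX s x.
Proof. by move=> gx Wx; apply: contrapT => h; apply: (gx s); left; right. Qed.

Let good_Gs s x : good x -> W s x -> exists z, Gs s z.
Proof.
move=> gx Wx; apply: contrapT => h; apply: (gx s); right.
by rewrite /N3; case: pselect.
Qed.

Let cofinal x xi : Prop := forall n, exists2 m, (n <= m)%N & W (mkseq xi m) x.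

(** The limit of a branch lies over [x] itself since [x] belongs to the balls
prescribed by every stage of the branch. *)
Let good_branch x xi : good x -> cofinal x xi -> exists y, G (x, y) xi.
Proof.
move=> gx cx.
have [n|[x' y] Gxy] := @branch_limit xi.
  by have [m nm Wx] := cx n; exists m => //; exact: (good_Gs gx Wx).
suff -> : x = x' by exists y.
have small_e n : rho x x' <= e n *+ 2.
  have [m nm Wx] := cx n.+1; have := good_CX gx Wx (i := n).
  rewrite size_mkseq nth_mkseq// => /(_ nm) xn.
  have [/= + _] := le_ball (Gxy.1 n).
  move: xn (pdist_triangle rho (u (xi n).1).1 x x').
  rewrite (pdistC rho (u _).1); set a := e n; lra.
apply: (@pm_eq _ _ rho); apply/eqP; rewrite eq_le pdist_ge0 andbT.
rewrite leNgt; apply/negP => r0.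
have [n] := @ex_natSinv_lt _ (rho x x' / 2) ltac:(lra).
by move: (small_e n); rewrite -/(e n); set a := e n; lra.
Qed.

Let good_chain x (t : nat -> seq code) : good x ->
  (forall n, ext (t n) (t n.+1)) -> (forall n, W (t n) x) ->
  exists xi y, (forall n, mkseq xi (size (t n)) = t n) /\ G (x, y) xi.
Proof.
move=> gx tx Wt; have [xi xit] := ext_chain tx.
have [|y Gy] := @good_branch x xi gx; last by exists xi, y.
have sz n : (n <= size (t n))%N.
  by elim: n => // n IH; apply: leq_ltn_trans IH _; case: (tx n).
by move=> n; exists (size (t n)) => //; rewrite xit.
Qed.

Let good_extend x s : good x -> W s x ->
  exists xi y, [/\ mkseq xi (size s) = s, cofinal x xi & G (x, y) xi].
Proof.
move=> gx Wx.
pose next t := if pselect (exists a, W (rcons t a) x) is left h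
  then rcons t (sval (cid h)) else t.
have nextW t : W t x -> W (next t) x /\ ext t (next t).
  move=> Wt; rewrite /next; case: pselect => [h|[]]; last exact: good_next.
  by split; [exact: (svalP (cid h))|split; rewrite ?size_rcons// -cats1 take_size_cat].
have Wn n : W (iter n next s) x by elim: n => //= n IH; exact: (nextW _ IH).1.
have [xi [y [h Gy]]] := @good_chain x (fun n => iter n next s) gx
  (fun n => (nextW _ (Wn n)).2) Wn.
exists xi, y; split=> //; first exact: (h 0%N).
move=> n; exists (size (iter n next s)); last by rewrite h.
elim: n => // n IH; apply: leq_ltn_trans IH _.
by have [] := (nextW _ (Wn n)).2.
Qed.

Let incompat (s t : seq code) : Prop := forall y, CY s y -> CY t y -> False.

(** The obstruction to building a perfect tree above [s]: incompatible extensions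
are what lets a branch avoid a given second coordinate.  It is shown to be null. *)
Let no_split s : set X := W s `\`
  \bigcup_(p in [set p : seq code * seq code |
     [/\ ext s p.1, ext s p.2 & incompat p.1 p.2]]) (W p.1 `&` W p.2).

Let m_no_split s : measurable (no_split s).
Proof.
apply: measurableD => //; apply: measurable_bigcup_count => //.
by move=> p _; exact: measurableI.
Qed.

Let close_CY n xi y z : CY (mkseq xi n.+1) y -> CY (mkseq xi n.+1) z ->
  rho y z <= e n *+ 2.
Proof.
move=> /CY_mkseq/(_ n (leqnn _)) yn /CY_mkseq/(_ n (leqnn _)).
move: yn (pdist_triangle rho (u (xi n).1).2 y z).
by rewrite (pdistC rho (u _).2); set a := e n => *; lra.
Qed.

Let mkseq_ext (xi : nat -> code) s n : mkseq xi (size s) = s -> (size s < n)%N -> ext s (mkseq xi n).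
Proof.
move=> <-; rewrite size_mkseq => sn; apply/(extP (0,0)%N); rewrite !size_mkseq.
by split=> // i i_s; rewrite !nth_mkseq// (ltn_trans i_s).
Qed.

(** Two surviving branches with distinct second coordinates would, far enough
along, give two incompatible extensions of [s]. *)
Let no_split_uniq s x xi y xi' y' : no_split s x ->
  mkseq xi (size s) = s -> cofinal x xi -> G (x, y) xi ->
  mkseq xi' (size s) = s -> cofinal x xi' -> G (x, y') xi' -> y = y'.
Proof.
move=> [Wx nx] hs cx Gy hs' cx' Gy'; apply: (@pm_eq _ _ rho); apply/eqP.
rewrite eq_le pdist_ge0 andbT leNgt; apply/negP => r0.
have [n ne] := @ex_natSinv_lt _ (rho y y' / 4) ltac:(lra).
have [m nm Wm] := cx (maxn n.+1 (size s).+1).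
have [m' nm' Wm'] := cx' (maxn n.+1 (size s).+1).
move: nm nm'; rewrite !geq_max => /andP[nm sm] /andP[nm' sm'].
apply: nx; exists (mkseq xi m, mkseq xi' m') => //=; split.
- exact: mkseq_ext.
- exact: mkseq_ext.
move=> z /CY_mkseq zm /CY_mkseq zm'.
have h1 : rho y z <= e n *+ 2.
  apply: (@close_CY n xi); first exact: GCY Gy.
  by apply/CY_mkseq => i i_n; apply: zm; exact: leq_trans nm.
have h2 : rho y' z <= e n *+ 2.
  apply: (@close_CY n xi'); first exact: GCY Gy'.
  by apply/CY_mkseq => i i_n; apply: zm'; exact: leq_trans nm'.
move: ne h1 h2 (pdist_triangle rho z y y').
rewrite (pdistC rho z y') -/(e n); set a := e n; set b := rho y z; set c := rho y' z; lra.
Qed.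

Let goodset : set X := ~` \bigcup_(s in setT) (N1 s `|` N2 s `|` N3 s).

Let goodsetP x : goodset x <-> good x.
Proof.
split=> [h s hs|h [s _]]; last exact: h.
by apply: h; exists s.
Qed.

Let m_goodset : measurable goodset.
Proof.
apply: measurableC; apply: measurable_bigcup_count => // s _.
apply: measurableU; first apply: measurableU.
- by apply: measurableD => //; apply: measurable_bigcup_count.
- exact: measurableD.
- by rewrite /N3; case: pselect => h; [exact: measurable0|exact: mW].
Qed.

Let J_bad : J (~` goodset).
Proof.
rewrite setCK; apply: J_bigcup_count => s.
have h n : J (if n is 0 then N1 s else if n is 1 then N2 s else N3 s).
  by case: n => [|[|n]].
apply: ni_sub (ni_bigcup h) => x [[|]|] Nx.
- by exists 0%N.
- by exists 1%N.
- by exists 2%N.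
Qed.

Let branch_point s x : Prop := (goodset `&` no_split s) x.

Let branch_pointP s x : branch_point s x ->
  exists y, exists2 xi, mkseq xi (size s) = s & cofinal x xi /\ G (x, y) xi.
Proof.
move=> [/goodsetP gx nx]; have [xi [y [h1 h2 h3]]] := good_extend gx nx.1.
by exists y, xi.
Qed.

Let bmap s x : option X := if pselect (branch_point s x) is left h
  then Some (sval (cid (branch_pointP h))) else None.

Let bmapP s x y : bmap s x = Some y -> branch_point s x /\
  exists2 xi, mkseq xi (size s) = s & cofinal x xi /\ G (x, y) xi.
Proof.
rewrite /bmap; case: pselect => // h [<-]; split=> //.
exact: (svalP (cid (branch_pointP h))).
Qed.

Let bmapE s x y xi : branch_point s x -> mkseq xi (size s) = s ->
  cofinal x xi -> G (x, y) xi -> bmap s x = Some y.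
Proof.
move=> bx h1 h2 h3; rewrite /bmap; case: pselect => // h; congr Some.
have [xi' g1 [g2 g3]] := svalP (cid (branch_pointP h)).
exact: (no_split_uniq bx.2 g1 g2 g3 h1 h2 h3).
Qed.

(** The preimage of an open set is described by the nodes [t] above [s] with
second balls inside it, which is what makes [bmap s] measurable. *)
Let bmap_open s (U : set X) :
  (forall x, U x -> exists2 r, 0 < r & forall y, rho x y < r -> U y) ->
  ppre (bmap s) U = (goodset `&` no_split s) `&`
    \bigcup_(t in [set t | ext s t /\ CY t `<=` U]) W t.
Proof.
move=> oU; apply/seteqP; split=> [x [y Uy /bmapP[bx [xi h1 [h2 h3]]]]|x].
  split=> //; have [r r0 rU] := oU _ Uy.
  have [n ne] := @ex_natSinv_lt _ (r / 2) ltac:(lra).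
  have [m] := h2 (maxn n.+1 (size s).+1).
  rewrite geq_max => /andP[nm sm] Wm; exists (mkseq xi m) => //; split.
    exact: mkseq_ext.
  move=> z /CY_mkseq zm; apply: rU.
  have : rho y z <= e n *+ 2.
    apply: (@close_CY n xi); first exact: GCY h3.
    by apply/CY_mkseq => i i_n; apply: zm; exact: leq_trans nm.
  by move: ne; rewrite -/(e n); set a := e n => *; lra.
move=> [bx [t [st tU] Wt]].
have [xi [y [h1 h2 h3]]] := good_extend ((goodsetP x).1 bx.1) Wt.
exists y; first by apply: tU; rewrite -h1; exact: GCY h3.
apply: (bmapE bx _ h2 h3).
apply: (@eq_from_nth _ (0, 0)%N); rewrite size_mkseq// => i i_s.
have [sz /(_ _ i_s) <-] := (extP (0, 0)%N s t).1 st.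
by rewrite nth_mkseq// -h1 nth_mkseq// (ltn_trans i_s).
Qed.

Let bmap_admissible s : admissible (bmap s).
Proof.
split; last first.
  by move=> x y /bmapP[_ [xi _ [_ [_ h]]]]; apply/FE; eexists; exact: h.
have mU (U : set X) :
    (forall x, U x -> exists2 r, 0 < r & forall y, rho x y < r -> U y) ->
    measurable (ppre (bmap s) U).
  move=> oU; rewrite bmap_open//; apply: measurableI.
    by apply: measurableI.
  exact: measurable_bigcup_count.
apply: (rho_gen (D := [set B | measurable (ppre (bmap s) B)])) => //.
split=> /= [A mA|A mA].
  by rewrite -setTD ppre_setD; apply: measurableD => //; apply: mU => x _; exists 1.
by rewrite ppre_bigcup; exact: bigcupT_measurable.
Qed.

(** Over almost every point of [no_split s], a point of [Gs s] is either the value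
of [bmap s], if its code survives, or is covered by the functions attached to the
node at which its code dies.  Being small and contained in [W s], the set
[no_split s] is therefore null. *)
Let small_no_split s : small (no_split s) s.
Proof.
have /(_ _)/cid2 h t : small (~` W t) t by exact: smallW.
pose f t := sval (h t).
have fa t k : admissible (f t k) by rewrite /f; case: (h t).
have fI t : J (uncovered (f t) (~` W t) t) by rewrite /f; case: (h t).
apply: (@small_count (option (seq code * nat))
  (fun p => if p is Some p then f p.1 p.2 else bmap s)).
  by case=> // [[t k]]; exact: fa.
have IU : J (\bigcup_n (if n is 0 then ~` goodset else
    \bigcup_(t in setT) uncovered (f t) (~` W t) t)).
  by apply: ni_bigcup => -[//|_]; exact: J_bigcup_count.
apply: ni_sub IU => x [nx [y [xi h1 Gy] hy]].
have [gx|] := pselect (goodset x); last by exists 0%N.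
exists 1%N => //.
have [cx|] := pselect (cofinal x xi).
  by have := hy None; rewrite (bmapE (conj gx nx) h1 cx Gy).
move=> /existsNP[n nW].
exists (mkseq xi n) => //; split; first by move=> Wn; apply: nW; exists n.
by exists y => [|k]; [exact: G_Gs|exact: (hy (Some (mkseq xi n, k)))].
Qed.

Let J_no_split s : J (no_split s).
Proof.
have -> : no_split s = no_split s `&` W s.
  by apply/seteqP; split=> x; [move=> h; split=> //; exact: h.1|case].
exact: W_small.
Qed.

(** Off the exceptional sets every surviving node splits.  Given an enumeration
of the section, avoid its [n]-th term at the [n]-th step by choosing the right
one of two incompatible extensions: the limit is a point of the section that is
missing from the enumeration. *)
Let W_nil_bad : W [::] `<=` ~` goodset `|` \bigcup_(s in setT) no_split s.
Proof.
move=> x Wx; apply: contrapT => /not_orP[/contrapT gx nx].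
have gx' := (goodsetP x).1 gx.
have [y0 [xi0 _ [_ G0]]] : exists y, exists2 xi : nat -> code, True &
    cofinal x xi /\ G (x, y) xi.
  by have [xi [y [_ h2 h3]]] := good_extend gx' Wx; exists y, xi.
have [v vE] : exists v : nat -> X, forall y, E (x, y) -> exists n, v n = y.
  have [E0|[v]] := pfcard_geP (E_count x).
    exists (fun=> y0) => y Ey; exfalso.
    by have : [set y | E (x, y)] y by []; rewrite E0.
  by exists v => y /(@surj _ _ _ _ v)[n _ <-]; exists n.
have split_ y s : W s x -> exists2 t, ext s t & W t x /\ ~ CY t y.
  move=> Ws; have : ~ no_split s x by move=> h; apply: nx; exists s.
  move=> /not_andP[//|/contrapT[[t1 t2] /= [e1 e2 inc] [W1 W2]]].
  have [C1|] := pselect (CY t1 y); last by exists t1.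
  by exists t2 => //; split=> // C2; exact: inc C1 C2.
pose next n s := if pselect (W s x) is left h
  then s2val (cid2 (split_ (v n) s h)) else s.
pose t := fix t n := if n is n'.+1 then next n' (t n') else [::].
have tn n : W (t n) x -> [/\ ext (t n) (t n.+1), W (t n.+1) x & ~ CY (t n.+1) (v n)].
  rewrite /= /next => h; case: pselect => // h'.
  by case: cid2 => s /= e1 [e2 e3].
have Wt n : W (t n) x by elim: n => [//|n /tn[]].
have [xi [y [xit Gy]]] := good_chain gx' (fun n => (let: And3 h _ _ := tn n (Wt n) in h)) Wt.
have [n vn] : exists n, v n = y by apply/vE/FE; eexists; exact: Gy.2.
have [_ _] := tn n (Wt n); apply; rewrite vn -xit; exact: GCY Gy.
Qed.

Lemma lusin_novikov_ideal : exists2 f : nat -> X -> option X,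
  (forall n, pmeas (f n) /\ forall x y, f n x = Some y -> E (x, y)) &
  J [set x | exists2 y, E (x, y) & forall n, f n x <> Some y].
Proof.
have [f fa fI] := smallW [::]; exists f => //.
have IU : J (\bigcup_n (if n is 0 then uncovered f (~` W [::]) [::] else
    if n is 1 then ~` goodset else \bigcup_(s in setT) no_split s)).
  by apply: ni_bigcup => -[//|[//|_]]; exact: J_bigcup_count.
apply: ni_sub IU => x [y Ey hy].
have [Wx|nW] := pselect (W [::] x).
  by have [gx|nx] := W_nil_bad Wx; [exists 1%N|exists 2%N].
by exists 0%N => //; split=> //; exists y => //; exact: EGs.
Qed.

End lusin_novikov.

(** * Partial isomorphisms covering the relation *)

Section pborel_toolbox.
Context (R : realType) (d : measure_display) (X : standardBorelType R d).
Variable E : cber X.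

Lemma pborel_of_rel (Q : X -> X -> Prop) :
  (forall x y y', Q x y -> Q x y' -> y = y') ->
  (forall x x' y, Q x y -> Q x' y -> x = x') ->
  (forall x y, Q x y -> E x y) ->
  (forall B, measurable B -> measurable [set x | exists2 y, B y & Q x y]) ->
  (forall A, measurable A -> measurable [set y | exists2 x, A x & Q x y]) ->
  exists h : pborel E, forall x y, h x = Some y <-> Q x y.
Proof.
move=> Qfun Qinj QE Qpre Qimg.
pose h x := if pselect (exists y, Q x y) is left e then Some (sval (cid e)) else None.
have hP x y : h x = Some y <-> Q x y.
  rewrite /h; split.
    by case: pselect => // e [<-]; exact: (svalP (cid e)).
  move=> Qxy; case: pselect => [e|[]]; last by exists y.
  by congr Some; apply: Qfun Qxy; exact: (svalP (cid e)).
have hi : pinj h by move=> x x' y /hP Qx /hP; exact: Qinj.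
have hE x y : h x = Some y -> E x y by move=> /hP /QE.
have hpre B : measurable B -> measurable (ppre h B).
  move=> /Qpre; congr (measurable _); apply/seteqP; split => x [y By].
    by move=> Qxy; exists y => //; apply/hP.
  by move=> /hP; exists y.
have himg A : measurable A -> measurable (pimg h A).
  move=> /Qimg; congr (measurable _); apply/seteqP; split => y [x Ax].
    by move=> Qxy; exists x => //; apply/hP.
  by move=> /hP; exists x.
by exists (PBorel hi hE hpre himg).
Qed.

Lemma measurable_pfix_pmeas (f : X -> option X) : pmeas f -> measurable (pfix f).
Proof.
move=> mf; have -> : pfix f = pdom f `\` pdiff f Some.
  apply/seteqP; split=> x /=.
    move=> fx; split; first by exists x.
    by move=> [y [z [fy [<-] yx]]]; apply: yx; move: fy; rewrite fx => -[].
  move=> [[y fx] nd]; rewrite /pfix /= fx; congr Some; apply: contrapT => yx.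
  by apply: nd; exists y, x.
apply: measurableD; first by rewrite pdom_pre; exact: mf.
apply: measurable_pdiff => // B mB.
by rewrite (_ : ppre Some B = B)//; apply/seteqP; split=> [x [y By [->]]|x Bx] //; exists x.
Qed.

Definition ptotal (g : pborel E) : Prop := pdom g = setT /\ pran g = setT.

Lemma ptotalP (g : pborel E) : ptotal g <->
  (forall x, exists y, g x = Some y) /\ (forall y, exists x, g x = Some y).
Proof.
split=> [[gd gr]|[gd gr]]; split.
- by move=> x; have : pdom g x by rewrite gd.
- move=> y; have [x _ gx] : pran g y by rewrite gr.
  by exists x.
- by apply/seteqP; split=> x // _; exact: gd.
- by apply/seteqP; split=> y // _; have [x] := gr y; exists x.
Qed.

Lemma pborel_inv (g : pborel E) :
  exists h : pborel E, forall x y, h x = Some y <-> g y = Some x.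
Proof.
apply: pborel_of_rel => [x y y'|x x' y|x y /pborel_cber|B mB|A mA].
- exact: pborel_inj.
- by move=> -> [].
- exact: cber_sym.
- exact: pborel_img.
- exact: pborel_pre.
Qed.

Lemma ptotal_comp (g h : pborel E) : ptotal g -> ptotal h -> ptotal (pborel_comp g h).
Proof.
move=> /ptotalP[gd gr] /ptotalP[hd hr]; apply/ptotalP; split=> x.
  have [y hy] := hd x; have [z gz] := gd y; exists z; apply/pcomp_Some; by exists y.
have [y hy] := gr x; have [z gz] := hr y; exists z; apply/pcomp_Some; by exists y.
Qed.

Lemma ptotal_id : ptotal (pborel_id E).
Proof. by apply/ptotalP; split=> x; exists x. Qed.

Lemma ptotal_inv (g : pborel E) : ptotal g -> exists2 h : pborel E, ptotal h &
  forall x y, h x = Some y <-> g y = Some x.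
Proof.
move=> /ptotalP[gd gr]; have [h hP] := pborel_inv g; exists h => //.
apply/ptotalP; split=> x.
  by have [y gy] := gr x; exists y; apply/hP.
by have [y gy] := gd x; exists y; apply/hP.
Qed.

Lemma pborel_bigcup (g : nat -> pborel E) (S : nat -> set X) :
  (forall n, measurable (S n)) ->
  (forall m n x y y', S m x -> S n x -> g m x = Some y -> g n x = Some y' -> y = y') ->
  (forall m n x x' y, S m x -> S n x' -> g m x = Some y -> g n x' = Some y -> x = x') ->
  exists h : pborel E, forall x y, h x = Some y <-> exists2 n, S n x & g n x = Some y.
Proof.
move=> mS gfun ginj; apply: pborel_of_rel.
- by move=> x y y' [m Sm gm] [n Sn gn]; exact: (gfun m n x).
- by move=> x x' y [m Sm gm] [n Sn gn]; exact: (ginj m n _ _ y).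
- by move=> x y [n _ /pborel_cber].
- move=> B mB; rewrite (_ : mkset _ = \bigcup_n (S n `&` ppre (g n) B)).
    by apply: bigcupT_measurable => n; apply: measurableI => //; exact: pborel_pre.
  apply/seteqP; split=> [x [y By [n Sn gn]]|x [n _ [Sn [y By gn]]]].
    by exists n => //; split=> //; exists y.
  by exists y => //; exists n.
- move=> A mA; rewrite (_ : mkset _ = \bigcup_n (pimg (g n) (A `&` S n))).
    by apply: bigcupT_measurable => n; apply: pborel_img; exact: measurableI.
  apply/seteqP; split=> [y [x Ax [n Sn gn]]|y [n _ [x [Ax Sn] gn]]].
    by exists n => //; exists x.
  by exists x => //; exists n.
Qed.

End pborel_toolbox.

Section generators.
Context (R : realType) (d : measure_display) (X : standardBorelType R d).
Variables (mu : probability X R) (E : cber X).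

Lemma lusin_novikov (I : null_ideal X) : exists2 f : nat -> X -> option X,
  (forall n, pmeas (f n) /\ forall x y, f n x = Some y -> E x y) &
  I [set x | exists2 y, E x y & forall n, f n x <> Some y].
Proof.
have [rho [mball gen]] := standard_borel_metric X.
have [F Fc FE] := analytic_measurable gen (cber_measurable E).
have [f fP fI] := lusin_novikov_ideal I mball gen Fc FE (@cber_countable _ _ E).
by exists f.
Qed.

Let ppre_Some (A : set X) : ppre Some A = A.
Proof. by apply/seteqP; split=> [x [y Ay [->]]|x Ax] //; exists x. Qed.

(** Functions [h m] that cover the relation become injective, with Borel images,
once restricted to the points that some [h n] sends back.  For this to keep the
covering property, almost every point [x] must have its whole class in the good
set of [h].  Hence [h] is taken for the ideal pulled back along a first covering
family [f], which enumerates the class of [x]. *)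
Lemma pborel_generators : exists g : nat -> pborel E,
  mu.-negligible [set x | exists2 y, E x y & forall n, g n x <> Some y].
Proof.
have mSome (_ : nat) : pmeas (@Some X) by move=> B mB; rewrite ppre_Some.
have [f fE0 fI] := lusin_novikov (pullback_ideal mu mSome).
have mf n : pmeas (f n) := (fE0 n).1.
have [h mh hI] := lusin_novikov (pullback_ideal mu mf).
have /(_ _)/cid gex (p : nat * nat) : exists g : pborel E, forall x y,
    g x = Some y <-> h p.1 x = Some y /\ h p.2 y = Some x.
  have mQ (m n : nat) B : measurable B -> measurable
      [set x | exists2 y, B y & h m x = Some y /\ h n y = Some x].
    move=> mB; rewrite (_ : mkset _ = ppre (h m) B `&` pfix (pcomp (h n) (h m))).
      apply: measurableI; first exact: (mh m).1.
      apply: measurable_pfix_pmeas => C mC; rewrite ppre_comp.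
      by apply: (mh m).1; exact: (mh n).1.
    apply/seteqP; split=> [x [y By [h1 h2]]|x [[y By h1]]].
      by split; [exists y|apply/pcomp_Some; exists y].
    by move=> /pcomp_Some[z]; rewrite h1 => -[<-] h2; exists y.
  apply: pborel_of_rel.
  - by move=> x y y' [-> _] [[->]].
  - by move=> x x' y [_ ->] [_ [->]].
  - by move=> x y [/(mh p.1).2].
  - exact: mQ.
  - move=> A mA; rewrite (_ : mkset _ = [set y | exists2 x, A x &
      h p.2 y = Some x /\ h p.1 x = Some y]); first exact: mQ.
    by apply/seteqP; split=> y [x Ax [h1 h2]]; exists x.
pose g n := sval (gex (odflt (0, 0)%N (unpickle n))).
have gP m n x y : h m x = Some y -> h n y = Some x ->
    g (pickle (m, n)) x = Some y.
  by move=> h1 h2; rewrite /g pickleK; apply/(svalP (gex _)).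
exists g.
pose N := [set x | exists2 y, E x y & forall n, h n x <> Some y].
have fI0 := fI 0%N; rewrite ppre_Some in fI0.
have hI' : mu.-negligible (\bigcup_n ppre (f n) N) by apply: negligible_bigcup.
apply: negligibleS (negligibleU fI0 hI') => x [y Exy gy].
have [Nf|nf] := pselect (exists2 y, E x y & forall n, f n x <> Some y); first by left.
right.
have fE z : E x z -> exists n, f n x = Some z.
  move=> Exz; apply: contrapT => hz; apply: nf; exists z => // n fn.
  by apply: hz; exists n.
have [Nx|nNx] := pselect (N x).
  by have [n fn] := fE x (cber_refl E x); exists n => //; exists x.
have [Ny|nNy] := pselect (N y).
  by have [n fn] := fE y Exy; exists n => //; exists y.
exfalso.
have [m hm] : exists m, h m x = Some y.
  apply: contrapT => hz; apply: nNx; exists y => // n fn.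
  by apply: hz; exists n.
have [n hn] : exists m, h m y = Some x.
  apply: contrapT => hz; apply: nNy; exists x; first exact: cber_sym.
  by move=> n fn; apply: hz; exists n.
by have := gy (pickle (m, n)); apply; exact: gP.
Qed.

End generators.

(** * Extending partial isomorphisms, prescribing supports *)

Section pmp.
Context (R : realType) (d : measure_display) (X : standardBorelType R d).
Variables (mu : probability X R) (E : cber X).
Hypothesis E_pmp : measure_preserving mu E.

Lemma rmu_pimg (g : pborel E) A : measurable A -> A `<=` pdom g ->
  rmu mu (pimg g A) = rmu mu A.
Proof. by move=> mA Ag; rewrite /rmu E_pmp. Qed.

Lemma negligible_ppre (g : pborel E) N :
  mu.-negligible N -> mu.-negligible (ppre g N).
Proof.
move=> [A [mA A0 NA]]; apply: negligibleS (_ : mu.-negligible (ppre g A)).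
  by move=> x [y /NA Ay gy]; exists y.
have mp : measurable (ppre g A) by exact: pborel_pre.
apply/rmu_eq0 => //; rewrite -(@rmu_pimg g)//; last by move=> x [y _ gy]; exists y.
have mi : measurable (pimg g (ppre g A)) by exact: pborel_img.
apply/(rmu_eq0 mu mi).
apply: negligibleS (_ : mu.-negligible A); last by exists A; split.
by move=> y [x [z Az gz]]; rewrite gz => -[<-].
Qed.

Definition invariant (M : set X) : Prop := forall x y, E x y -> M x -> M y.

(** The covering family consists of countably many measure-preserving maps, so
the saturation of a null set is null; it is Borel once the points missed by the
family are included. *)
Lemma invariant_null N : mu.-negligible N ->
  exists M, [/\ measurable M, mu.-negligible M, N `<=` M & invariant M].
Proof.
move=> nN; have [g hg] := pborel_generators mu E.
have [A [mA A0 hA]] := negligibleU nN hg.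
have nA : mu.-negligible A by exists A; split.
exists (A `|` \bigcup_n ppre (g n) A); split.
- apply: measurableU => //; apply: bigcupT_measurable => n; exact: pborel_pre.
- by apply: negligibleU => //; apply: negligible_bigcup => n; exact: negligible_ppre.
- by move=> x Nx; left; apply: hA; left.
move=> x y Exy Mx; apply: contrapT => /not_orP[nAy nMy].
have gyE z : E y z -> exists n, g n y = Some z.
  move=> Eyz; apply: contrapT => h; apply: nAy; apply: hA; right; exists z => // n gn.
  by apply: h; exists n.
have Eyx := cber_sym Exy.
case: Mx => [Ax|[n _ [z Az gz]]].
  by have [n gn] := gyE x Eyx; apply: nMy; exists n => //; exists x.
have Eyz : E y z by apply: cber_trans Eyx _; exact: pborel_cber gz.
by have [m gm] := gyE z Eyz; apply: nMy; exists m => //; exists z.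
Qed.

Lemma good_generators : exists (g : nat -> pborel E) (M : set X),
  [/\ measurable M, mu.-negligible M, invariant M &
      forall x y, ~ M x -> E x y -> exists n, g n x = Some y].
Proof.
have [g hg] := pborel_generators mu E; have [M [mM M0 hM iM]] := invariant_null hg.
exists g, M; split=> // x y nMx Exy; apply: contrapT => h; apply: nMx; apply: hM.
by exists y => // n gn; apply: h; exists n.
Qed.

(** Off an invariant null set, [g] is a bijection; on it, the identity is used. *)
Lemma total_modification (g : pborel E) : mu.-negligible (~` pdom g) ->
  exists2 h : pborel E, ptotal h & mu.-negligible [set x | h x <> g x].
Proof.
move=> gd.
have md : measurable (pdom g) by exact: measurable_pdom.
have mr : measurable (pran g) by exact: measurable_pran.
have gr : mu.-negligible (~` pran g).
  apply/rmu_eq0; first exact: measurableC.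
  rewrite rmuC// /pran -[setT](setUv (pdom g)).
  have gE : pimg g (pdom g `|` ~` pdom g) = pimg g (pdom g).
    apply/seteqP; split=> y [x hx gx]; exists x => //; first by exists y.
    by left.
  rewrite gE rmu_pimg// -rmuC//; apply/rmu_eq0 => //; exact: measurableC.
have [M [mM M0 hM iM]] := invariant_null (negligibleU gd gr).
have iM' x y : E x y -> ~ M x -> ~ M y by move=> Exy nMx /(iM _ _ (cber_sym Exy)).
have [h hP] : exists h : pborel E, forall x y,
    h x = Some y <-> (~ M x /\ g x = Some y) \/ (M x /\ x = y).
  apply: pborel_of_rel.
  - move=> x y y' [[nM gx]|[Mx <-]] [[nM' gx']|[Mx' <-]] //.
    by move: gx'; rewrite gx => -[].
  - move=> x x' y [[nM gx]|[Mx <-]] [[nM' gx']|[Mx' xx']] //.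
    + exact: pborel_inj gx gx'.
    + by exfalso; apply: (iM' _ _ (pborel_cber gx) nM); rewrite -xx'.
    + by exfalso; apply: (iM' _ _ (pborel_cber gx') nM').
  - by move=> x y [[_ /pborel_cber]|[_ <-]] //; exact: cber_refl.
  - move=> B mB; rewrite (_ : mkset _ = (ppre g B `\` M) `|` (M `&` B)).
      apply: measurableU; last exact: measurableI.
      by apply: measurableD => //; exact: pborel_pre.
    apply/seteqP; split=> [x [y By [[nM gx]|[Mx xy]]]|x [[[y By gx] nM]|[Mx Bx]]].
    + by left; split => //; exists y.
    + by right; rewrite xy in Mx *.
    + by exists y => //; left.
    + by exists x => //; right.
  - move=> B mB; rewrite (_ : mkset _ = pimg g (B `\` M) `|` (M `&` B)).
      apply: measurableU; last exact: measurableI.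
      by apply: pborel_img; exact: measurableD.
    apply/seteqP; split=> [y [x Bx [[nM gx]|[Mx <-]]]|y [[x [Bx nM] gx]|[My By]]].
    + by left; exists x.
    + by right.
    + by exists x => //; left.
    + by exists y => //; right.
exists h.
  apply/ptotalP; split=> x.
    have [Mx|nM] := pselect (M x); first by exists x; apply/hP; right.
    have [y gy] : pdom g x by apply: contrapT => nd; apply: nM; apply: hM; left.
    by exists y; apply/hP; left.
  have [Mx|nM] := pselect (M x); first by exists x; apply/hP; right.
  have [y _ gy] : pran g x by apply: contrapT => nd; apply: nM; apply: hM; right.
  exists y; apply/hP; left; split=> //.
  by apply: iM' nM; apply: cber_sym; exact: pborel_cber gy.
apply: negligibleS M0 => x /= hx; apply: contrapT => nM; apply: hx.
have [y gy] : pdom g x by apply: contrapT => nd; apply: nM; apply: hM; left.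
by rewrite gy; apply/hP; left.
Qed.

(** Match points outside the domain with points outside the range, greedily along
the covering family.  In the end no unmatched point of the first kind is
equivalent to one of the second, so on the saturation [Y] of the unmatched points
of the first kind the extended map [psi] is onto; as it preserves the finite
measure of [Y], it is defined almost everywhere there. *)
Lemma full_extension (phi : pborel E) : exists2 g : pborel E, ptotal g &
  mu.-negligible [set x | exists2 y, phi x = Some y & g x <> Some y].
Proof.
have [g [M [mM M0 iM gM]]] := good_generators.
(* [A n] and [B n] hold the points still unmatched before step [n], where [g n]
   matches [S n]. *)
pose AB := fix AB n : set X * set X := if n is n'.+1 then
   let: (A, B) := AB n' in let S := A `&` ppre (g n') B in
   (A `\` S, B `\` pimg (g n') S)
  else (~` pdom phi, ~` pran phi).
pose A n := (AB n).1; pose B n := (AB n).2.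
pose S n := A n `&` ppre (g n) (B n).
have AS n : A n.+1 = A n `\` S n by rewrite /S /A /B /=; case: (AB n).
have BS n : B n.+1 = B n `\` pimg (g n) (S n) by rewrite /S /A /B /=; case: (AB n).
have mAB n : measurable (A n) /\ measurable (B n).
  elim: n => [|n [mA mB]].
    by split; apply: measurableC; [exact: measurable_pdom|exact: measurable_pran].
  have mS : measurable (S n) by apply: measurableI => //; exact: pborel_pre.
  rewrite AS BS; split; apply: measurableD => //; exact: pborel_img.
have mS n : measurable (S n).
  by have [mA mB] := mAB n; apply: measurableI => //; exact: pborel_pre.
have Ale m n : (m <= n)%N -> A n `<=` A m.
  elim: n => [|n IH]; first by rewrite leqn0 => /eqP->.
  rewrite leq_eqVlt => /orP[/eqP->//|/IH h]; rewrite AS => x [/h//].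
have Ble m n : (m <= n)%N -> B n `<=` B m.
  elim: n => [|n IH]; first by rewrite leqn0 => /eqP->.
  rewrite leq_eqVlt => /orP[/eqP->//|/IH h]; rewrite BS => x [/h//].
have Sdisj m n x : S m x -> S n x -> m = n.
  move=> Sm Sn; apply/eqP; rewrite eqn_leq; apply/andP; split; rewrite leqNgt; apply/negP => mn.
    by have := Ale _ _ mn _ Sm.1; rewrite AS => -[_].
  by have := Ale _ _ mn _ Sn.1; rewrite AS => -[_].
have gB n x y : S n x -> g n x = Some y -> B n y.
  by move=> [_ [z Bz gz]]; rewrite gz => -[<-].
have SBdisj m n x x' y : S m x -> S n x' -> g m x = Some y -> g n x' = Some y -> m = n.
  move=> Sm Sn gm gn; apply/eqP; rewrite eqn_leq; apply/andP; split; rewrite leqNgt; apply/negP => mn.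
    by have := Ble _ _ mn _ (gB _ _ _ Sm gm); rewrite BS => -[_]; apply; exists x'.
  by have := Ble _ _ mn _ (gB _ _ _ Sn gn); rewrite BS => -[_]; apply; exists x.
have notdom x n : S n x -> ~ pdom phi x by move=> [/(Ale _ _ (leq0n n))].
have notran n x y : S n x -> g n x = Some y -> ~ pran phi y.
  by move=> Sn /(gB _ _ _ Sn)/(Ble _ _ (leq0n n)).
pose Sx n := if n is n'.+1 then S n' else setT.
pose gx n := if n is n'.+1 then g n' else phi.
have [psi psiP] : exists h : pborel E, forall x y,
    h x = Some y <-> exists2 n, Sx n x & gx n x = Some y.
  apply: pborel_bigcup.
  - by case=> [|n]; [exact: measurableT|exact: mS].
  - move=> [|m] [|n] x y y' /= Sm Sn gm gn.
    + by move: gm; rewrite gn => -[].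
    + by exfalso; apply: (notdom _ _ Sn); exists y.
    + by exfalso; apply: (notdom _ _ Sm); exists y'.
    + by move: gm; rewrite (Sdisj _ _ _ Sm Sn) gn => -[].
  - move=> [|m] [|n] x x' y /= Sm Sn gm gn.
    + exact: pborel_inj gm gn.
    + by exfalso; apply: (notran _ _ _ Sn gn); exists x.
    + by exfalso; apply: (notran _ _ _ Sm gm); exists x'.
    + have mn := SBdisj _ _ _ _ _ Sm Sn gm gn; rewrite mn in gm.
      exact: pborel_inj gm gn.
have phipsi x y : phi x = Some y -> psi x = Some y.
  by move=> h; apply/psiP; exists 0%N.
have psidom x : ~ pdom psi x -> forall n, A n x.
  move=> nd; elim=> [[y hy]|n IH]; first by apply: nd; exists y; exact: phipsi.
  rewrite AS; split=> // Sn; apply: nd; have [_ [y _ gy]] := Sn.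
  by exists y; apply/psiP; exists n.+1.
have psiran y : ~ pran psi y -> forall n, B n y.
  move=> nd; elim=> [[x _ hx]|n IH]; first by apply: nd; exists x => //; exact: phipsi.
  rewrite BS; split=> // -[x Sx' gx']; apply: nd.
  by exists x => //; apply/psiP; exists n.+1.
have nomatch x y : ~ M x -> E x y -> ~ pdom psi x -> ~ pran psi y -> False.
  move=> nM Exy nd nr; have [n gn] := gM _ _ nM Exy; apply: (nd).
  exists y; apply/psiP; exists n.+1 => //=; split; first exact: psidom.
  by exists y => //; exact: psiran.
have mdom : measurable (pdom psi) by exact: measurable_pdom.
pose Y := ~` M `&` \bigcup_n ppre (g n) (~` pdom psi).
have mY : measurable Y.
  apply: measurableI; first exact: measurableC.
  by apply: bigcupT_measurable => n; apply: pborel_pre; exact: measurableC.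
have YP x : Y x <-> ~ M x /\ exists2 y, E x y & ~ pdom psi y.
  split=> [[nM [n _ [y nd gy]]]|[nM [y Exy nd]]].
    by split=> //; exists y => //; exact: pborel_cber gy.
  split=> //; have [n gn] := gM _ _ nM Exy; exists n => //; by exists y.
have iY x y : E x y -> Y x -> Y y.
  move=> Exy /YP[nM [z Exz nd]]; apply/YP; split.
    by move=> My; apply: nM; apply: iM My; exact: cber_sym.
  by exists z => //; apply: cber_trans Exz; exact: cber_sym.
have psiY : pimg psi (Y `&` pdom psi) = Y.
  apply/seteqP; split=> [y [x [Yx _] hx]|y Yy].
    by apply: iY Yx; exact: pborel_cber hx.
  have [x _ hx] : pran psi y.
    apply: contrapT => nr; have /YP[nM [z Eyz nd]] := Yy.
    apply: (nomatch z y) => //; last exact: cber_sym.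
    by move=> Mz; apply: nM; apply: iM Mz; exact: cber_sym.
  exists x => //; split; last by exists y.
  by apply: iY Yy; apply: cber_sym; exact: pborel_cber hx.
have Yd0 : mu.-negligible (Y `\` pdom psi).
  apply/rmu_eq0; first exact: measurableD.
  have := rmuDI mu mY mdom; rewrite -{1}psiY rmu_pimg; last 2 first.
  - exact: measurableI.
  - by move=> x [].
  by lra.
have [|h htot hpsi] := @total_modification psi.
  apply: negligibleS (negligibleU M0 Yd0) => x nd.
  have [|nM] := pselect (M x); [by left|right].
  by split=> //; apply/YP; split=> //; exists x => //; exact: cber_refl.
exists h => //; apply: negligibleS hpsi => x [y /phipsi hx hy] /=.
by rewrite hx.
Qed.

Hypothesis E_aper : aperiodic mu E.

(** By aperiodicity almost every point [x] of [T] lies in infinitely many of the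
sets [P k] where the [k]-th map takes a new value.  The images of the [P k] are
disjoint, since [T] has one point in each class, so the sum of the measures is
finite and the Borel-Cantelli lemma applies. *)
Lemma transversal_null (T : set X) : measurable T ->
  (forall x y, T x -> T y -> E x y -> x = y) -> mu.-negligible T.
Proof.
move=> mT Tuniq; have [g [M [mM M0 iM gM]]] := good_generators.
pose P k := (T `&` pdom (g k)) `\` \bigcup_(j in [set j | (j < k)%N]) [set x | ~ (g j x <> g k x)].
have mP k : measurable (P k).
  apply: measurableD; first by apply: measurableI => //; exact: measurable_pdom.
  by apply: bigcup_measurable => j _; apply: measurableC; exact: measurable_pborel_neq.
have mgP k : measurable (pimg (g k) (P k)) by exact: pborel_img.
have tI : trivIset setT (fun k => pimg (g k) (P k)).
  move=> i j _ _ [y [[x [[Tx _] ni] gx] [x' [[Tx' _] nj] gx']]].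
  have xx' : x = x'.
    apply: Tuniq => //; apply: cber_trans (pborel_cber gx) _.
    by apply: cber_sym; exact: pborel_cber gx'.
  rewrite -{x'}xx' in nj gx' Tx'; apply/eqP; rewrite eqn_leq.
  apply/andP; split; rewrite leqNgt; apply/negP => ij.
    by apply: ni; exists j => //=; rewrite gx gx'.
  by apply: nj; exists i => //=; rewrite gx gx'.
have muP : mu (lim_sup_set P) = 0%E.
  refine (@lim_sup_set_cvg0 _ _ _ mu P mP _).
  have -> : (\sum_(n <oo) mu (P n) = mu (\bigcup_n pimg (g n) (P n)))%E.
    rewrite measure_bigcup// [RHS](@eq_eseriesl R _ xpredT); last by move=> n; rewrite in_setT.
    apply: eq_eseriesr => n _.
    by apply: esym; apply: E_pmp => // x [[]].
  apply: le_lt_trans (probability_le1 mu (bigcupT_measurable _ mgP)) _.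
  exact: ltry.
have mL : measurable (lim_sup_set P).
  apply: bigcapT_measurable => n; exact: bigcup_measurable.
have nL : mu.-negligible (lim_sup_set P) by apply/negligibleP.
apply: negligibleS (negligibleU (negligibleU M0 nL) E_aper) => x Tx.
have [Mx|nM] := pselect (M x); first by left; left.
have [Lx|nLx] := pselect (lim_sup_set P x); first by left; right.
right => inf; apply: inf.
have [n hn] : exists n, forall k, (n <= k)%N -> ~ P k x.
  apply: contrapT => h; apply: nLx => n _ /=; apply: contrapT => h'.
  apply: h; exists n => k nk Pk; apply: h'; by exists k.
apply: (@sub_finite_set _ _ (\bigcup_(k in [set k | (k < n)%N]) [set y | g k x = Some y])).
  move=> y Exy; have [k0 gk0] := gM _ _ nM Exy.
  have ex : exists k, `[< g k x = Some y >] by exists k0; apply/asboolP.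
  pose k := ex_minn ex; have [gk kmin] : g k x = Some y /\ forall j, g j x = Some y -> (k <= j)%N.
    rewrite /k; case: ex_minnP => m /asboolP gm hm; split=> // j gj.
    by apply: hm; apply/asboolP.
  exists k => //=; rewrite ltnNge; apply/negP => nk; apply: (hn k nk).
  split; first by split=> //; exists y.
  by move=> [j /= jk /contrapT]; rewrite gk => /kmin; rewrite leqNgt jk.
apply: bigcup_finite; first exact: finite_II.
move=> k _; case gk : (g k x) => [y|].
  by apply: (@sub_finite_set _ _ [set y]) => [z [<-]|//].
by apply: (@sub_finite_set _ _ set0) => [z|//].
Qed.

End pmp.

Section supports.
Context (R : realType) (d : measure_display) (X : standardBorelType R d).
Variables (mu : probability X R) (E : cber X).
Hypothesis E_pmp : measure_preserving mu E.
Hypothesis E_aper : aperiodic mu E.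

(** Cut each map along the sets of a countable separating family, keeping the
points that it moves out of such a set. *)
Lemma disjoint_generators : exists (g : nat -> pborel E) (M : set X),
  [/\ mu.-negligible M, forall n x y, g n x = Some y -> ~ pran (g n) x &
      forall x y, ~ M x -> E x y -> x <> y -> exists n, g n x = Some y].
Proof.
have [g [M [mM M0 iM gM]]] := good_generators E_pmp.
have [B [mB Bsep]] := standard_borel_separating X.
have /(_ _)/cid hex (p : nat * (nat * nat)) : exists h : pborel E, forall x y,
    h x = Some y <-> [/\ B p.2 x, ~ B p.2 y & g p.1 x = Some y].
  apply: pborel_of_rel.
  - by move=> x y y' [_ _ ->] [_ _ [->]].
  - by move=> x x' y [_ _ h] [_ _ h']; exact: pborel_inj h h'.
  - by move=> x y [_ _ /pborel_cber].
  - move=> C mC; rewrite (_ : mkset _ = B p.2 `&` ppre (g p.1) (C `\` B p.2)).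
      by apply: measurableI => //; apply: pborel_pre; exact: measurableD.
    by apply/seteqP; split=> [x [y Cy [Bx By gx]]|x [Bx [y [Cy By] gx]]];
      [split=> //; exists y|exists y].
  - move=> C mC; rewrite (_ : mkset _ = pimg (g p.1) (C `&` B p.2) `\` B p.2).
      by apply: measurableD => //; apply: pborel_img; exact: measurableI.
    apply/seteqP; split=> [y [x Cx [Bx By gx]]|y [[x [Cx Bx] gx] By]].
      by split=> //; exists x.
    by exists x.
pose h n := sval (hex (odflt (0, (0, 0))%N (unpickle n))).
exists h, M; split=> // [n x y /(svalP (hex _))[Bx _ _] [z _ /(svalP (hex _))[_ + _]]|x y nM Exy xy].
  exact.
have [i [Bx By]] := Bsep _ _ xy; have [k gk] := gM _ _ nM Exy.
by exists (pickle (k, i)); rewrite /h pickleK; apply/(svalP (hex _)).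
Qed.

(** Exchange points of [A] greedily along [disjoint_generators].  The points left
over form a partial transversal, which is null.  The resulting involution is
symmetric as a relation [Q], so functionality gives injectivity. *)
Lemma exists_support (A : set X) : measurable A -> exists2 h : pborel E,
  ptotal h & mu.-negligible [set x | ~ (h x <> Some x <-> A x)].
Proof.
move=> mA; have [g [M [M0 gdisj gM]]] := disjoint_generators.
(* At step [n] the set [S n] is exchanged with its image [T n], and both sets
   leave the points still available. *)
pose AA := fix AA n : set X := if n is n'.+1 then
   let B := AA n' in let S := B `&` ppre (g n') B in
   B `\` (S `|` pimg (g n') S) else A.
pose S n := AA n `&` ppre (g n) (AA n).
pose T n := pimg (g n) (S n).
have AS n : AA n.+1 = AA n `\` (S n `|` T n) by [].
have mAA n : measurable (AA n).
  elim: n => // n mn; have mS : measurable (S n).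
    by apply: measurableI => //; exact: pborel_pre.
  rewrite AS; apply: measurableD => //; apply: measurableU => //; exact: pborel_img.
have mS n : measurable (S n) by apply: measurableI => //; exact: pborel_pre.
have mT n : measurable (T n) by exact: pborel_img.
have Ale m n : (m <= n)%N -> AA n `<=` AA m.
  elim: n => [|n IH]; first by rewrite leqn0 => /eqP->.
  by rewrite leq_eqVlt => /orP[/eqP->//|/IH h]; rewrite AS => x [/h].
have TA n : T n `<=` AA n.
  by move=> y [x [_ [z Az gz]]]; rewrite gz => -[<-].
have gE n x y : S n x -> g n x = Some y -> T n y by move=> Sx gx; exists x.
have level m n x : (S m `|` T m) x -> (S n `|` T n) x -> m = n.
  have lt i j z : (S i `|` T i) z -> (S j `|` T j) z -> (i < j)%N -> False.
    move=> hi hj ij; have Aj : AA j z by case: hj => [[]//|/TA].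
    by have := Ale _ _ ij _ Aj; rewrite AS => -[_]; apply.
  move=> hm hn; apply/eqP; rewrite eqn_leq; apply/andP; split; rewrite leqNgt;
    apply/negP; [exact: lt hn hm|exact: lt hm hn].
have ST n x : S n x -> T n x -> False.
  by move=> [_ [y _ /gdisj nr]] [z _ gz]; apply: nr; exists z.
pose Q x y := [\/ exists2 n, S n x & g n x = Some y,
  exists2 n, S n y & g n y = Some x | x = y /\ forall n, ~ (S n `|` T n) x].
have Qsym x y : Q x y -> Q y x.
  case=> [h|h|[<- h]]; [exact: Or32|exact: Or31|exact: Or33].
have Qfun x y y' : Q x y -> Q x y' -> y = y'.
  case=> [[n Sn gn]|[n Sn gn]|[<- h]].
  - case=> [[m Sm gm]|[m Sm gm]|[_ /(_ n)[]]]; last by left.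
      have nm := level _ _ x (or_introl Sn) (or_introl Sm).
      by move: gm; rewrite -nm gn => -[].
    have nm := level _ _ x (or_introl Sn) (or_intror (gE _ _ _ Sm gm)).
    by rewrite -nm in Sm gm; case: (ST n x) => //; exact: gE gm.
  - have Tx := gE _ _ _ Sn gn.
    case=> [[m Sm gm]|[m Sm gm]|[_ /(_ n)[]]]; last by right.
      have nm := level _ _ x (or_intror Tx) (or_introl Sm).
      by rewrite -nm in Sm; case: (ST n x).
    have nm := level _ _ x (or_intror Tx) (or_intror (gE _ _ _ Sm gm)).
    by rewrite -nm in gm; exact: pborel_inj gn gm.
  - case=> [[m Sm gm]|[m Sm gm]|[]//]; case: (h m); first by left.
    by right; exact: gE gm.
have mQ C : measurable C -> measurable [set x | exists2 y, C y & Q x y].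
  move=> mC; rewrite (_ : mkset _ = (\bigcup_n (S n `&` ppre (g n) C)) `|`
    (\bigcup_n (pimg (g n) (S n `&` C))) `|` (C `\` \bigcup_n (S n `|` T n))).
    apply: measurableU; first apply: measurableU.
    - apply: bigcupT_measurable => n; apply: measurableI => //; exact: pborel_pre.
    - apply: bigcupT_measurable => n; apply: pborel_img; exact: measurableI.
    - apply: measurableD => //; apply: bigcupT_measurable => n; exact: measurableU.
  apply/seteqP; split=> [x [y Cy [[n Sn gn]|[n Sn gn]|[-> h]]]|x].
  - by left; left; exists n => //; split=> //; exists y.
  - by left; right; exists n => //; exists y.
  - by right; split=> // -[n _ hn]; exact: h hn.
  - move=> [[[n _ [Sn [y Cy gy]]]|[n _ [y [Sn Cy] gy]]]|[Cx nh]].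
    + by exists y => //; apply: Or31; exists n.
    + by exists y => //; apply: Or32; exists n.
    + by exists x => //; apply: Or33; split=> // n hn; apply: nh; exists n.
have [h hP] : exists h : pborel E, forall x y, h x = Some y <-> Q x y.
  apply: pborel_of_rel => //.
  - by move=> x x' y /Qsym h /Qsym; exact: Qfun.
  - move=> x y [[n _ /pborel_cber]//|[n _ /pborel_cber/cber_sym]//|[<- _]].
    exact: cber_refl.
  - move=> C /mQ; congr (measurable _); apply/seteqP; split=> x [y Cy Qy];
      by exists y => //; exact: Qsym.
have hT x : exists y, h x = Some y.
  have [[n hn]|nh] := pselect (exists n, (S n `|` T n) x).
    case: hn => [Sn|[y Sy gy]].
      by have [_ [y _ gy]] := Sn; exists y; apply/hP; apply: Or31; exists n.
    by exists y; apply/hP; apply: Or32; exists n.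
  by exists x; apply/hP; apply: Or33; split=> // n hn; apply: nh; exists n.
exists h.
  apply/ptotalP; split=> // x; have [y /hP/Qsym/hP hy] := hT x; by exists y.
have mI : measurable (\bigcap_n AA n) by exact: bigcapT_measurable.
have [N [mN N0 MN iN]] := invariant_null E_pmp M0.
have tr : mu.-negligible ((\bigcap_n AA n) `\` N).
  apply: (transversal_null E_pmp E_aper); first exact: measurableD.
  move=> x y [Ax nx] [Ay ny] Exy; apply: contrapT => xy.
  have [|n gn] := gM _ _ _ Exy xy; first by move=> Mx; apply: nx; exact: MN.
  have Sn : S n x by split; [exact: Ax|exists y => //; exact: Ay].
  by have := Ax n.+1 Logic.I; rewrite AS => -[_]; apply; left.
apply: negligibleS (negligibleU N0 tr) => x /= hx.
have [Nx|nN] := pselect (N x); [by left|right]; split=> // n _.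
apply: contrapT => nA; apply: hx; split=> [hx|Ax hx].
  apply: contrapT => nAx; apply: hx; apply/hP; apply: Or33; split=> // m hm.
  by apply: nAx; apply: (Ale 0%N m) => //; case: hm => [[]//|/TA].
have [m hm] : exists m, (S m `|` T m) x.
  apply: contrapT => nh; apply: nA; elim: n => // n IH; rewrite AS; split=> // hn.
  by apply: nh; exists n.
have /hP[[k Sk gk]|[k Sk gk]|[_ /(_ m)]//] := hx.
  by apply: (ST k x) => //; exact: gE gk.
by apply: (ST k x) => //; exact: gE gk.
Qed.

End supports.

(** * Separability of the full group *)

(** Finite Boolean combinations of countably many sets, as a countable syntax. *)
Inductive bool_term := Atom of nat | Union of bool_term & bool_term | Compl of bool_term.

Fixpoint bool_term_tree (t : bool_term) : GenTree.tree nat := match t with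
  | Atom n => GenTree.Leaf n
  | Union s t => GenTree.Node 0 [:: bool_term_tree s; bool_term_tree t]
  | Compl t => GenTree.Node 1 [:: bool_term_tree t]
  end.

Fixpoint tree_bool_term (t : GenTree.tree nat) : option bool_term := match t with
  | GenTree.Leaf n => Some (Atom n)
  | GenTree.Node 0 [:: s; t] =>
      obind (fun s' => omap (Union s') (tree_bool_term t)) (tree_bool_term s)
  | GenTree.Node _ [:: t] => omap Compl (tree_bool_term t)
  | _ => None
  end.

Lemma bool_term_treeK : pcancel bool_term_tree tree_bool_term.
Proof. by elim=> //= [s -> t ->|t ->]. Qed.

HB.instance Definition _ := Countable.copy bool_term (pcan_type bool_term_treeK).

Fixpoint bool_term_set (T : Type) (a : nat -> set T) (t : bool_term) : set T :=
  match t with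
  | Atom n => a n
  | Union s t => bool_term_set a s `|` bool_term_set a t
  | Compl t => ~` bool_term_set a t
  end.

Section separability.
Context (R : realType) (d : measure_display) (X : standardBorelType R d).
Variable mu : probability X R.

Lemma rmu_vanish (G : nat -> set X) : (forall n, measurable (G n)) ->
  (forall m n, (m <= n)%N -> G n `<=` G m) ->
  mu.-negligible (\bigcap_n G n) ->
  forall e, 0 < e -> exists n, rmu mu (G n) < e.
Proof.
move=> mG Gle G0 e e0.
have mI : measurable (\bigcap_n G n) by exact: bigcapT_measurable.
have cv : mu (G n) @[n --> \oo] --> mu (\bigcap_n G n).
  apply: nonincreasing_cvg_mu => //.
  - apply: le_lt_trans (probability_le1 mu (mG 0%N)) _; exact: ltry.
  - by move=> m n mn; apply/subsetPset; exact: Gle.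
have I0 : mu (\bigcap_n G n) = 0%E by apply/negligibleP.
rewrite I0 in cv.
have cv0 : (fine \o (fun n => mu (G n))) n @[n --> \oo] --> (0 : R) by exact: fine_cvg.
move/cvgrPdist_lt : cv0 => /(_ _ e0)[N _ hN].
exists N; have := hN N (leqnn _).
by rewrite /= sub0r normrN ger0_norm// rmu_ge0.
Qed.

Lemma rmu_bigcup_le (A : nat -> set X) (N : nat) c :
  (forall n, measurable (A n)) -> (forall n, (n < N)%N -> rmu mu (A n) <= c) ->
  rmu mu (\bigcup_(n in [set n | (n < N)%N]) A n) <= N%:R * c.
Proof.
move=> mA; elim: N => [|N IH] h.
  rewrite (_ : \bigcup_(n in _) _ = set0) ?rmu0 ?mul0r//.
  by apply/seteqP; split=> x // [].
rewrite (_ : \bigcup_(n in _) _ =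
  \bigcup_(n in [set n | (n < N)%N]) A n `|` A N); last first.
  apply/seteqP; split=> [x [n /= nN Ax]|x [[n /= nN Ax]|Ax]].
  - move: nN; rewrite ltnS leq_eqVlt => /orP[/eqP<-|nN]; [by right|].
    by left; exists n.
  - by exists n => //=; exact: ltnW.
  - by exists N => /=.
apply: le_trans (rmuUle _ _ _) _ => //.
  by apply: bigcup_measurable => n _.
rewrite -natr1 mulrDl mul1r; apply: lerD; last exact: h.
by apply: IH => n nN; apply: h; exact: ltnW.
Qed.

Let sdiff (A B : set X) : set X := (A `\` B) `|` (B `\` A).

Let msdiff A B : measurable A -> measurable B -> measurable (sdiff A B).
Proof. by move=> mA mB; apply: measurableU; exact: measurableD. Qed.

(** The Borel sets approximated by Boolean combinations of the balls with
centers in the dense sequence form a sigma-algebra, as a countable union is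
approximated by finite ones. *)
Lemma measure_algebra_separable : exists a : nat -> set X,
  (forall n, measurable (a n)) /\
  (forall B e, measurable B -> 0 < e -> exists n, rmu mu (sdiff B (a n)) < e).
Proof.
have [rho [mball gen]] := standard_borel_metric X.
pose b n := let p := odflt (0, 0)%N (unpickle n) in
  [set y | rho (pm_seq rho p.1) y < p.2.+1%:R^-1].
pose den := bool_term_set b.
have mden t : measurable (den t).
  elim: t => [n|s ms t mt|t mt]; [exact: mball|exact: measurableU|exact: measurableC].
pose D (B : set X) := measurable B /\
  forall e, 0 < e -> exists t, rmu mu (sdiff B (den t)) < e.
have sdxx A : sdiff A A = set0 by rewrite /sdiff setDv setU0.
have Dden t : D (den t).
  by split=> // e e0; exists t; rewrite sdxx rmu0.
have DC A : D A -> D (~` A).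
  move=> [mA h]; split; first exact: measurableC.
  move=> e /h[t ht]; exists (Compl t) => /=.
  rewrite (_ : sdiff _ _ = sdiff A (den t))//.
  by rewrite /sdiff /= !setDE !setCK setUC [X in X `|` _]setIC [X in _ `|` X]setIC.
have DUU A B : D A -> D B -> D (A `|` B).
  move=> [mA hA] [mB hB]; split; first exact: measurableU.
  move=> e e0; have e20 : 0 < e / 2 by lra.
  have [s hs] := hA _ e20; have [t ht] := hB _ e20; exists (Union s t).
  apply: (@le_lt_trans _ _ (rmu mu (sdiff A (den s) `|` sdiff B (den t)))).
    apply: rmu_le; [by apply: msdiff; exact: measurableU|by apply: measurableU; exact: msdiff|].
    move=> x [[[Ax|Bx] /= /not_orP[ns nt]]|[[sx|tx] /not_orP[nA nB]]].
    - by left; left.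
    - by right; left.
    - by left; right.
    - by right; right.
  by apply: le_lt_trans (rmuUle _ _ _) _; [exact: msdiff|exact: msdiff|lra].
have D0 : D set0.
  have := Dden (Compl (Union (Atom 0) (Compl (Atom 0)))).
  by rewrite /den /= setUv setCT.
have sD : sigma_closed D.
  split=> // F DF.
  have mF : measurable (\bigcup_n F n) by apply: bigcupT_measurable => n; exact: (DF n).1.
  pose H N := \bigcup_(n in [set n | (n < N)%N]) F n.
  have DH N : D (H N).
    elim: N => [|N IH].
      by rewrite (_ : H 0%N = set0)//; apply/seteqP; split=> x // [].
    rewrite (_ : H N.+1 = H N `|` F N); first exact: DUU.
    apply/seteqP; split=> [x [n /= nN Ax]|x [[n /= nN Ax]|Ax]].
    - move: nN; rewrite ltnS leq_eqVlt => /orP[/eqP<-|nN]; [by right|].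
      by left; exists n.
    - by exists n => //=; exact: ltnW.
    - by exists N => /=.
  split=> // e e0; have e20 : 0 < e / 2 by lra.
  have [N hN] : exists N, rmu mu (\bigcup_n F n `\` H N) < e / 2.
    apply: rmu_vanish e20; first by move=> n; apply: measurableD => //; exact: (DH n).1.
    - move=> m n mn x [Fx nH]; split=> // -[k /= km Fk]; apply: nH.
      by exists k => //=; exact: leq_trans mn.
    apply: negligibleS (negligible_set0 mu) => x h.
    have [[n _ Fx] _] := h 0%N Logic.I.
    by have [_ []] := h n.+1 Logic.I; exists n => /=.
  have [mH /(_ _ e20)[t ht]] := DH N; exists t.
  apply: (@le_lt_trans _ _ (rmu mu ((\bigcup_n F n `\` H N) `|` sdiff (H N) (den t)))).
    apply: rmu_le; [exact: msdiff|apply: measurableU; [exact: measurableD|exact: msdiff]|].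
    move=> x [[Fx nt]|[tx nF]].
      by have [Hx|nH] := pselect (H N x); [right; left|left].
    by right; right; split=> // -[n _ Fx]; apply: nF; exists n.
  apply: le_lt_trans (rmuUle _ _ _) _; [exact: measurableD|exact: msdiff|lra].
have DM B : measurable B -> D B.
  apply: gen => // U oU; apply: (open_sigma_closed sD D0 _ oU) => i k.
  have := Dden (Atom (pickle (i, k))).
  by rewrite /den /= /b pickleK.
exists (fun n => if unpickle n is Some t then den t else set0).
split=> [n|B e mB e0]; first by case: unpickle.
by have [_ /(_ e e0)[t ht]] := DM B mB; exists (pickle t); rewrite pickleK.
Qed.

Variable E : cber X.

Lemma pborel_dist_rmu (g h : pborel E) :
  pborel_dist mu g h = rmu mu [set x | g x <> h x].
Proof. exact: pborel_distE. Qed.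

(** Up to a set of small measure, an element is determined by finitely many of
the sets where it agrees with a map of the covering family; these sets are
approximated within a countable dense part of the measure algebra. *)
Lemma full_group_separable : exists2 D : nat -> pborel E,
  (forall n, ptotal (D n)) &
  forall g e, ptotal g -> 0 < e -> exists n, pborel_dist mu g (D n) < e.
Proof.
have [a [ma ha]] := measure_algebra_separable.
have [gam gamP] := pborel_generators mu E.
pose S n (g : pborel E) := ~` [set x | g x <> gam n x].
have mS n g : measurable (S n g) by apply: measurableC; exact: measurable_pborel_neq.
(* A code lists sets approximating the first agreement sets [S n g], and a
   precision; [D c] is some element fitting the code [c], if there is one. *)
pose P (c : seq nat * nat) (g : pborel E) := ptotal g /\ forall n, (n < size c.1)%N ->
  rmu mu (sdiff (S n g) (a (nth 0%N c.1 n))) < c.2.+1%:R^-1.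
pose D c := if pselect (exists g, P c g) is left h then sval (cid h) else pborel_id E.
have DP c g : P c g -> P c (D c).
  by move=> Pg; rewrite /D; case: pselect => [h|[]]; [exact: (svalP (cid h))|exists g].
have Dt c : ptotal (D c).
  rewrite /D; case: pselect => [h|h]; last exact: ptotal_id.
  exact: (svalP (cid h)).1.
exists (fun n => D (odflt ([::], 0%N) (unpickle n))) => // g e gt e0.
have e20 : 0 < e / 2 by lra.
pose G N := \bigcap_(n in [set n | (n < N)%N]) (~` S n g).
have mG N : measurable (G N).
  rewrite /G -[X in measurable X]setCK setC_bigcap; apply: measurableC.
  by apply: bigcup_measurable => n _; rewrite setCK.
have [N hN] : exists N, rmu mu (G N) < e / 2.
  apply: rmu_vanish e20 => //.
    by move=> m n mn x Gx k /= km; apply: Gx => /=; exact: leq_trans mn.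
  apply: negligibleS gamP => x Gx; have [gd gr] := (ptotalP g).1 gt.
  have [y gy] := gd x; exists y; first exact: pborel_cber gy.
  move=> n gn; apply: (Gx n.+1 Logic.I n) => //=.
  by rewrite /S /= gn gy.
have [m hm] : exists m, m.+1%:R^-1 < e / 2 / (N.+1%:R) / 2.
  by apply: ex_natSinv_lt; rewrite !divr_gt0// ltr0n.
have /(_ _)/cid cex n : exists k, rmu mu (sdiff (S n g) (a k)) < m.+1%:R^-1.
  by apply: ha => //; exact: natSinv_gt0.
pose c := (mkseq (fun n => sval (cex n)) N, m).
have Pg : P c g.
  split=> // n; rewrite size_mkseq => nN; rewrite nth_mkseq//; exact: (svalP (cex n)).
exists (pickle c); rewrite pickleK /=; have [_ Pd] := DP _ _ Pg.
rewrite pborel_dist_rmu.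
have mN n : measurable (S n g `\` S n (D c)) by exact: measurableD.
apply: (@le_lt_trans _ _ (rmu mu (G N `|`
    \bigcup_(n in [set n | (n < N)%N]) (S n g `\` S n (D c))))).
  apply: rmu_le; first exact: measurable_pborel_neq.
    by apply: measurableU => //; apply: bigcup_measurable.
  move=> x /= gx; have [[n nN Sx]|nS] := pselect (exists2 n, (n < N)%N & S n g x).
    right; exists n => //; split=> // Sd; apply: gx.
    by move: Sx Sd => /contrapT-> /contrapT->.
  by left => n /= nN Sx; apply: nS; exists n.
apply: le_lt_trans (rmuUle _ _ _) _ => //; first exact: bigcup_measurable.
have : rmu mu (\bigcup_(n in [set n | (n < N)%N]) (S n g `\` S n (D c)))
    <= N%:R * (m.+1%:R^-1 * 2).
  apply: rmu_bigcup_le => // n nN.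
  have h1 : rmu mu (sdiff (S n g) (a (nth 0%N c.1 n))) < m.+1%:R^-1.
    by apply: Pg.2; rewrite size_mkseq.
  have h2 : rmu mu (sdiff (S n (D c)) (a (nth 0%N c.1 n))) < m.+1%:R^-1.
    by apply: Pd; rewrite size_mkseq.
  apply: (@le_trans _ _ (rmu mu (sdiff (S n g) (a (nth 0%N c.1 n)) `|`
     sdiff (S n (D c)) (a (nth 0%N c.1 n))))).
    apply: rmu_le => //; first by apply: measurableU; exact: msdiff.
    move=> x [Sx nSx]; have [ax|nax] := pselect (a (nth 0%N c.1 n) x).
      by right; right.
    by left; left.
  apply: le_trans (rmuUle _ _ _) _; [exact: msdiff|exact: msdiff|].
  by move: h1 h2; set p := m.+1%:R^-1 => *; lra.
suff h : N%:R * (m.+1%:R^-1 * 2) <= e / 2.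
  by move=> h2; move: (le_trans h2 h) hN => *; lra.
have N0 : 0 < (N.+1%:R : R) by rewrite ltr0n.
move/ltW: hm; rewrite -mulrA -invfM ler_pdivlMr; last by rewrite mulr_gt0.
by apply: le_trans; rewrite mulrCA ler_pM2l ?natSinv_gt0// ler_pM2r ?ltr0n// ler_nat.
Qed.

End separability.

(** * From an embedding of the full group to soficity *)

Section counting_measure.
Context (R : realType) (N : nat).
Implicit Types A B : set 'I_N.
Local Notation mc := (@mu_count R N).

Lemma mu_count_ge0 A : 0 <= mc A.
Proof. by rewrite /mu_count divr_ge0. Qed.

Lemma mu_count_le A B : A `<=` B -> mc A <= mc B.
Proof.
move=> AB; rewrite /mu_count ler_wpM2r ?invr_ge0// ler_nat.
apply/subset_leq_card/fintype.subsetP => i; rewrite !inE; exact: AB.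
Qed.

Lemma mu_countUI A B : mc (A `|` B) + mc (A `&` B) = mc A + mc B.
Proof.
rewrite /mu_count -!mulrDl -!natrD; congr (_%:R / _).
rewrite -[RHS]cardUI; congr (_ + _)%N; apply: eq_card => i.
  by rewrite classical_sets.in_setU !inE.
by rewrite classical_sets.in_setI !inE.
Qed.

Lemma mu_count0 : mc set0 = 0.
Proof.
rewrite /mu_count (_ : #|_| = 0%N) ?mul0r//.
by apply: eq_card0 => i; rewrite classical_sets.in_set0.
Qed.

Lemma mu_countU_le A B : mc (A `|` B) <= mc A + mc B.
Proof. by rewrite -mu_countUI lerDl mu_count_ge0. Qed.

Lemma mu_countT : (0 < N)%N -> mc setT = 1.
Proof.
move=> N0; rewrite /mu_count (_ : #|_| = N); last first.
  by rewrite -[RHS]card_ord; apply: eq_card => i; rewrite classical_sets.in_setT.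
by rewrite divff// pnatr_eq0 -lt0n.
Qed.

Lemma mu_countC A : (0 < N)%N -> mc (~` A) = 1 - mc A.
Proof.
by move=> N0; have := mu_countUI A (~` A); rewrite setUv setICr mu_count0 mu_countT//; lra.
Qed.

Lemma mu_count_preim_perm (s : 'S_N) A : mc (s @^-1` A) = mc A.
Proof.
rewrite /mu_count; congr (_%:R / _).
rewrite -(fintype.card_image (@perm_inj _ s)); apply: eq_card => j.
apply/fintype.imageP/idP => [[i + ->]|]; first by rewrite !inE.
rewrite inE => Aj; exists (s^-1%g j); last by rewrite permKV.
by rewrite inE /= permKV.
Qed.

Lemma pbij_distE (f g : pbij N) : pbij_dist R f g = mc [set i | f i <> g i].
Proof.
rewrite /pbij_dist /pmap_dist pneqE; have := mu_countUI (pdom f `+` pdom g) (pdiff f g).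
by rewrite pneq_disj mu_count0 addr0.
Qed.

Lemma perm_distE_count (s t : 'S_N) : perm_dist R s t = mc [set i | s i <> t i].
Proof.
rewrite /perm_dist pbij_distE; congr mc; apply/seteqP; split=> i /= h.
  by move=> st; apply: h; rewrite st.
by move=> [].
Qed.

End counting_measure.

(** Sequences of finite sets whose normalized size tends to zero along [U] are
the null sets of the ultraproduct of the finite probability spaces. *)
Section ultra_negligible.
Context (R : realType) (U : set_system nat) {UU : UltraFilter U} (n : nat -> nat).
Implicit Types S T : forall k, set 'I_(n k).

Definition unegl S : Prop :=
  forall e : R, 0 < e -> \forall k \near U, mu_count R (S k) < e.

Lemma unegl_sub S T : unegl T -> (forall k, S k `<=` T k) -> unegl S.
Proof.
move=> nT ST e /nT; apply: filterS => k; apply: le_lt_trans; exact: mu_count_le.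
Qed.

Lemma uneglU S T : unegl S -> unegl T -> unegl (fun k => S k `|` T k).
Proof.
move=> nS nT e e0; have e20 : 0 < e / 2 by lra.
apply: filterS2 (nS _ e20) (nT _ e20) => k h1 h2.
by apply: le_lt_trans (mu_countU_le _ _ _) _; lra.
Qed.

Lemma unegl_perm (s : forall k, 'S_(n k)) S :
  unegl S -> unegl (fun k => s k @^-1` S k).
Proof. by move=> nS e /nS; apply: filterS => k; rewrite mu_count_preim_perm. Qed.

Definition ucvg (S : forall k, set 'I_(n k)) (l : R) : Prop :=
  forall e : R, 0 < e -> \forall k \near U, `|mu_count R (S k) - l| < e.

Lemma ucvg0 S : ucvg S 0 -> unegl S.
Proof.
by move=> cS e /cS; apply: filterS => k; rewrite subr0 ger0_norm// mu_count_ge0.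
Qed.

Lemma ucvg_eq S T l : ucvg S l -> unegl (fun k => S k `\` T k) ->
  unegl (fun k => T k `\` S k) -> ucvg T l.
Proof.
move=> cS ST TS e e0; have e20 : 0 < e / 2 by lra.
apply: filterS3 (cS _ e20) (ST _ e20) (TS _ e20) => k h1 h2 h3.
have h4 : mu_count R (S k) <= mu_count R (T k) + mu_count R (S k `\` T k).
  apply: le_trans (mu_countU_le _ _ _); apply: mu_count_le => i Si.
  by have [Ti|nTi] := pselect (T k i); [left|right].
have h5 : mu_count R (T k) <= mu_count R (S k) + mu_count R (T k `\` S k).
  apply: le_trans (mu_countU_le _ _ _); apply: mu_count_le => i Ti.
  by have [Si|nSi] := pselect (S k i); [left|right].
by move: h1; rewrite !ltr_norml => /andP[h1 h1']; apply/andP; split; lra.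
Qed.

End ultra_negligible.

Section semigroup_model.
Context (R : realType) (d : measure_display) (X : standardBorelType R d).
Variables (mu : probability X R) (E : cber X).
Hypothesis E_pmp : measure_preserving mu E.
Hypothesis E_aper : aperiodic mu E.
Variables (U : set_system nat) (UU : UltraFilter U) (n : nat -> nat).
Hypothesis n_gt0 : forall k, (0 < n k)%N.
Variable theta : full_semigroup mu E -> ultraproduct R U n.
Hypothesis thetaM : forall phi psi, full_group mu E phi -> full_group mu E psi ->
  theta (fscomp phi psi) = ucomp (theta phi) (theta psi).
Hypothesis thetaD : forall phi psi, full_group mu E phi -> full_group mu E psi ->
  udist (theta phi) (theta psi) = fsdist phi psi.

Local Notation negl := (@unegl R U n).

Let rho (g : pborel E) k : 'S_(n k) := mrepr (theta (fsclass mu g)) k.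

Let supp (g : pborel E) : set X := [set x | g x <> Some x].
Let mv (g : pborel E) k : set 'I_(n k) := [set i | rho g k i <> i].
Arguments mv : clear implicits.

Let msupp g : measurable (supp g).
Proof. exact: (measurable_pborel_neq g (pborel_id E)). Qed.

Let fg g : ptotal g -> full_group mu E (fsclass mu g).
Proof. by move=> [gd gr]; exists g. Qed.

Let rho_eq (g h : pborel E) : mu.-negligible [set x | g x <> h x] -> rho g = rho h.
Proof.
move=> gh; rewrite /rho; suff -> : fsclass mu g = fsclass mu h by [].
by apply/fsclassP; apply/negligibleP => //; exact: measurable_pborel_neq.
Qed.

Let rho_eqfun (g h : pborel E) : (forall x, g x = h x) -> rho g = rho h.
Proof.
move=> gh; apply: rho_eq; apply: negligibleS (negligible_set0 mu) => x /=.
by rewrite gh.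
Qed.

Let rho_comp g h : ptotal g -> ptotal h ->
  negl (fun k => [set i | rho (pborel_comp g h) k i <> rho g k (rho h k i)]).
Proof.
move=> gt ht e e0.
have := thetaM (fg gt) (fg ht); rewrite fscomp_class// => thE.
have /(mclassP (@seq_pseudometric R U UU n)) : mclass (@seq_pseudometric R U UU n) (rho (pborel_comp g h)) =
    mclass (@seq_pseudometric R U UU n) (fun k => (rho h k * rho g k)%g).
  by rewrite /rho mreprK thE.
move=> /= d0; have := @seq_dist_cvg R U UU n (rho (pborel_comp g h)) (fun k => (rho h k * rho g k)%g).
rewrite d0 => /cvgrPdist_lt/(_ _ e0); apply: filterS => k.
rewrite sub0r normrN ger0_norm ?perm_dist_ge0// perm_distE_count.
apply: le_lt_trans; apply: mu_count_le => i /=; by rewrite permM.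
Qed.

Let rho_dist (g h : pborel E) : ptotal g -> ptotal h ->
  @ucvg R U n (fun k => [set i | rho g k i <> rho h k i])
    (rmu mu [set x | g x <> h x]).
Proof.
move=> gt ht e e0; have := thetaD (fg gt) (fg ht).
rewrite fsdist_class pborel_distE -/(rmu mu _) => <-.
have := @seq_dist_cvg R U UU n (rho g) (rho h).
move=> /cvgrPdist_lt/(_ _ e0); apply: filterS => k.
by rewrite distrC perm_distE_count.
Qed.

Let mv_id : negl (mv (pborel_id E)).
Proof.
have := rho_comp (ptotal_id E) (ptotal_id E).
rewrite (_ : rho (pborel_comp _ _) = rho (pborel_id E)); last first.
  exact: rho_eqfun.
move=> h; apply: unegl_sub h _ => k i /= hi /perm_inj; exact/nesym.
Qed.

Let mv_cvg g : ptotal g -> @ucvg R U n (mv g) (rmu mu (supp g)).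
Proof.
move=> gt; apply: ucvg_eq (rho_dist gt (ptotal_id E)) _ _.
  apply: unegl_sub mv_id _ => k i [/= h1 /contrapT h2] h3; apply: h1.
  by rewrite h2 h3.
apply: unegl_sub mv_id _ => k i [/= h1 /contrapT h2] h3; apply: h1.
by rewrite h2 h3.
Qed.

Let mv_comp g h : ptotal g -> ptotal h ->
  negl (fun k => mv (pborel_comp g h) k `\` (mv g k `|` mv h k)).
Proof.
move=> gt ht; apply: unegl_sub (rho_comp gt ht) _ => k i [h1 /not_orP[h2 h3]] h4.
by apply: h1; rewrite h4 (contrapT h3) (contrapT h2).
Qed.

Let supp_comp g h x : ptotal g -> ptotal h -> ~ (supp g `&` supp h) x ->
  supp (pborel_comp g h) x <-> (supp g `|` supp h) x.
Proof.
move=> /ptotalP[gd gr] /ptotalP[hd hr] nx; split.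
  move=> ghx; apply: contrapT => /not_orP[/contrapT gx /contrapT hx].
  by apply: ghx; apply/pcomp_Some; exists x.
case=> [gx|hx] /pcomp_Some[z hz gz].
  have [hx|hx] := pselect (supp h x); first exact: nx.
  by move: hz; rewrite (contrapT hx) => -[xz]; apply: gx; rewrite [in LHS]xz.
have [gx|gx] := pselect (supp g x); first exact: nx.
by apply: hx; rewrite hz; congr Some; exact: pborel_inj gz (contrapT gx).
Qed.

(** The size of the support of [g h] tends to the sum of those for [g] and [h],
whereas it is, up to a negligible set, at most the size of the union. *)
Let mv_disj g h : ptotal g -> ptotal h -> mu.-negligible (supp g `&` supp h) ->
  negl (fun k => mv g k `&` mv h k).
Proof.
move=> gt ht gh0 e e0.
have ght := ptotal_comp gt ht.
have e40 : 0 < e / 4 by lra.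
have suppE : rmu mu (supp (pborel_comp g h)) = rmu mu (supp g) + rmu mu (supp h).
  rewrite -rmuU_ae//; apply: rmu_eq_ae => //; first exact: measurableU.
    apply: negligibleS gh0 => x [h1 h2]; apply: contrapT => nx.
    by apply: h2; apply/supp_comp.
  apply: negligibleS gh0 => x [h1 h2]; apply: contrapT => nx.
  by apply: h2; apply/supp_comp.
have hA := mv_cvg gt e40; have hB := mv_cvg ht e40.
have hC := mv_cvg ght e40; have hD := mv_comp gt ht e40.
apply: filterS2 (filterI hA hB) (filterI hC hD) => k [h1 h2] [h3 h4].
have := mu_countUI R (mv g k) (mv h k).
have : mu_count R (mv (pborel_comp g h) k) <= mu_count R (mv g k `|` mv h k) +
    mu_count R (mv (pborel_comp g h) k `\` (mv g k `|` mv h k)).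
  apply: le_trans (mu_countU_le _ _ _); apply: mu_count_le => i hi.
  by have [|] := pselect ((mv g k `|` mv h k) i); [left|right].
move: h1 h2 h3; rewrite suppE !ltr_norml => /andP[a1 a2] /andP[b1 b2] /andP[c1 c2].
by move=> u1 u2; lra.
Qed.


(** An element of the full group supported on [A], made total in [A] so that it
can be used as a function of the set. *)
Let flip (A : set X) : pborel E :=
  if pselect (measurable A) is left mA then s2val (cid2 (exists_support E_pmp E_aper mA))
  else pborel_id E.

Let flip_total A : ptotal (flip A).
Proof. by rewrite /flip; case: pselect => [mA|_]; [case: cid2|exact: ptotal_id]. Qed.

Let flip_supp A : measurable A ->
  mu.-negligible [set x | ~ (supp (flip A) x <-> A x)].
Proof. by move=> mA; rewrite /flip; case: pselect => [mA'|//]; case: cid2. Qed.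

Let null2 (A B D : set X) : mu.-negligible A -> mu.-negligible B ->
  (forall x, ~ A x -> ~ B x -> ~ D x) -> mu.-negligible D.
Proof.
move=> nA nB h; apply: negligibleS (negligibleU nA nB) => x Dx.
by apply: contrapT => /not_orP[a b]; exact: h a b Dx.
Qed.

Let null3 (A B C D : set X) : mu.-negligible A -> mu.-negligible B ->
  mu.-negligible C -> (forall x, ~ A x -> ~ B x -> ~ C x -> ~ D x) -> mu.-negligible D.
Proof.
move=> nA nB nC h; apply: null2 nA (negligibleU nB nC) _ => x a /not_orP[b c].
exact: h.
Qed.

(** The finite model of a Borel set.  Another element with the same support would
give the same sets up to negligible ones, by [mv_sub]. *)
Let Smv A k : set 'I_(n k) := mv (flip A) k.
Arguments Smv : clear implicits.

Let S_cvg A : measurable A -> @ucvg R U n (Smv A) (rmu mu A).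
Proof.
move=> mA; have hA := flip_supp mA.
rewrite (_ : rmu mu A = rmu mu (supp (flip A))); first exact/mv_cvg/flip_total.
apply: rmu_eq_ae => //; apply: negligibleS hA => x [h1 h2] /= h;
  by apply: h2; apply/h.
Qed.

(** Inclusion of supports follows from disjointness, applied with an element
supported on the complement: the two supports exhaust the finite sets
asymptotically, by counting. *)
Let mv_sub (g h : pborel E) : ptotal g -> ptotal h ->
  mu.-negligible (supp g `\` supp h) -> negl (fun k => mv g k `\` mv h k).
Proof.
move=> gt ht gh.
pose c := flip (~` supp h).
have mC : measurable (~` supp h) by exact: measurableC.
have ct : ptotal c := flip_total _.
have cP := flip_supp mC.
have hc : negl (fun k => mv h k `&` mv c k).
  apply: mv_disj => //; apply: negligibleS cP => x [hx cx] /= h'.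
  by have := h'.1 cx; apply.
have gc : negl (fun k => mv g k `&` mv c k).
  apply: mv_disj => //; apply: null2 cP gh _ => x h1 h2 [gx cx].
  by apply: h2; split=> // hx; apply: h1 => h'; have := h'.1 cx; apply.
have hcv : negl (fun k => ~` (mv h k `|` mv c k)).
  move=> e e0; have e30 : 0 < e / 3 by lra.
  apply: filterS3 (mv_cvg ht e30) (S_cvg mC e30) (hc _ e30) => k h1 h2 h3.
  rewrite mu_countC//; have := mu_countUI R (mv h k) (mv c k).
  move: h1 h2; rewrite (rmuC mu (msupp h)) !ltr_norml => /andP[a1 a2] /andP[b1 b2].
  by move=> u; move: b1; rewrite /Smv -/c => b1; lra.
apply: unegl_sub (uneglU gc hcv) _ => k i [gi hi].
have [ci|nci] := pselect (mv c k i); first by left.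
by right => -[].
Qed.

Let S_ge g A : ptotal g -> measurable A -> mu.-negligible (A `\` supp g) ->
  negl (fun k => Smv A k `\` mv g k).
Proof.
move=> gt mA gA; apply: mv_sub => //.
apply: null2 (flip_supp mA) gA _ => x /= h1 h2 [sx nx]; apply: h2; split=> //.
by apply: contrapT => nAx; apply: h1 => h; apply: nAx; apply/h.
Qed.

Let S_disj g A : ptotal g -> measurable A -> mu.-negligible (A `&` supp g) ->
  negl (fun k => Smv A k `&` mv g k).
Proof.
move=> gt mA gA; apply: mv_disj => //.
apply: null2 (flip_supp mA) gA _ => x /= h1 h2 [sx gx]; apply: h2; split=> //.
by apply: contrapT => nAx; apply: h1 => h; apply: nAx; apply/h.
Qed.

Let S_sub A B : measurable A -> measurable B -> mu.-negligible (A `\` B) ->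
  negl (fun k => Smv A k `\` Smv B k).
Proof.
move=> mA mB AB; apply: S_ge => //.
apply: null2 (flip_supp mB) AB _ => x /= h1 h2 [Ax sx]; apply: h2; split=> // Bx.
by apply: h1 => h; apply: sx; apply/h.
Qed.

(** The product of elements supported on disjoint sets [A] and [B] is supported on
their union, and its permutation moves only points moved by one of the factors. *)
Let S_union D A B : measurable D -> measurable A -> measurable B ->
  mu.-negligible (D `\` (A `|` B)) -> mu.-negligible (A `&` B) ->
  negl (fun k => Smv D k `\` (Smv A k `|` Smv B k)).
Proof.
move=> mD mA mB DAB AB.
have tA := flip_total A; have tB := flip_total B.
pose m := pborel_comp (flip A) (flip B); have tm : ptotal m by exact: ptotal_comp.
have h1 : negl (fun k => Smv D k `\` mv m k).
  apply: S_ge => //; apply: null3 DAB AB (negligibleU (flip_supp mA) (flip_supp mB)) _.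
  move=> x h1 h2 /not_orP[/contrapT h3 /contrapT h4] [Dx mx].
  have ABx : (A `|` B) x by apply: contrapT => nAB; exact: h1.
  apply: mx; apply/supp_comp => //; first by move=> [/h3 a /h4 b]; exact: h2.
  by case: ABx => [/h3|/h4]; [left|right].
apply: unegl_sub (uneglU h1 (mv_comp tA tB)) _ => k i [Di nAB].
have [mi|nmi] := pselect (mv m k i); first by right.
by left.
Qed.

Let ext_of (phi : pborel E) : pborel E := s2val (cid2 (full_extension E_pmp phi)).

Let ext_total phi : ptotal (ext_of phi).
Proof. by rewrite /ext_of; case: cid2. Qed.

Let ext_ofP (phi : pborel E) :
  mu.-negligible [set x | exists2 y, phi x = Some y & ext_of phi x <> Some y].
Proof. by rewrite /ext_of; case: cid2. Qed.

(** By [full_extension] partial isomorphisms are restrictions of elements of the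
full group, so only their domains need to be modelled separately. *)
Let model_fun (phi : pborel E) k (i : 'I_(n k)) : option 'I_(n k) :=
  if pselect (Smv (pdom phi) k i) then Some (rho (ext_of phi) k i) else None.

Let model_inj (phi : pborel E) k : pinj (@model_fun phi k).
Proof.
move=> i j l; rewrite /model_fun; case: pselect => // _ [<-].
by case: pselect => // _ [] /perm_inj.
Qed.

Let model (phi : pborel E) k : pbij (n k) := PBij (@model_inj phi k).

Let model_Some (phi : pborel E) k i : Smv (pdom phi) k i -> model phi k i = Some (rho (ext_of phi) k i).
Proof. by rewrite /= /model_fun; case: pselect. Qed.

Let model_None (phi : pborel E) k i : ~ Smv (pdom phi) k i -> model phi k i = None.
Proof. by rewrite /= /model_fun; case: pselect. Qed.

Let mpdom (phi : pborel E) : measurable (pdom phi).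
Proof. exact: measurable_pdom. Qed.

(** Two comparisons, each up to negligible sets.  The domain of the composite is
modelled correctly because [p'], the conjugate of [p] by [h], is supported on the
preimage of [A] under [h], so that its permutation moves [i] exactly when the
permutation of [p] moves the image of [i].  The values agree because [kk], the
quotient of the two extensions of the composite, is supported off its domain. *)
Let model_comp (phi psi chi : pborel E) :
  mu.-negligible [set x | chi x <> pborel_comp phi psi x] ->
  negl (fun k => [set i | model chi k i <> pbij_comp (model phi k) (model psi k) i]).
Proof.
move=> chiE.
set g := ext_of phi; set h := ext_of psi; set l := ext_of chi.
set A := pdom phi; set B := pdom psi; set C := pdom chi.
have gt : ptotal g := ext_total _; have ht : ptotal h := ext_total _.
have lt : ptotal l := ext_total _.
have gP : mu.-negligible (ppre psi [set x | exists2 y, phi x = Some y & g x <> Some y]).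
  by apply: negligible_ppre => //; exact: ext_ofP.
have hP := ext_ofP psi; have lP := ext_ofP chi; rewrite -/h -/l in hP lP.
have ght : ptotal (pborel_comp g h) := ptotal_comp gt ht.
have [h' h't h'P] := ptotal_inv ht.
have [gh' gh't gh'P] := ptotal_inv ght.
pose p := flip A; have pt : ptotal p := flip_total A.
pose p' := pborel_comp h' (pborel_comp p h).
have p't : ptotal p' by do 2?apply: ptotal_comp.
have hp' x : pborel_comp h p' x = pborel_comp p h x.
  have [y py] := ((ptotalP _).1 (ptotal_comp pt ht)).1 x.
  have [z hz] := ((ptotalP _).1 h't).1 y.
  rewrite py; apply/pcomp_Some; exists z; last exact/h'P.
  by apply/pcomp_Some; exists y.
have suppp' x : supp p' x <-> exists2 y, h x = Some y & supp p y.
  have [y hy] := ((ptotalP _).1 ht).1 x.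
  split=> [p'x|[z hz pz] p'x].
    exists y => // py; apply: p'x; apply/pcomp_Some; exists y; last exact/h'P.
    by apply/pcomp_Some; exists y.
  have /pcomp_Some[w /pcomp_Some[u hu pu] /h'P hw] := p'x.
  by apply: pz; move: hz hw pu; rewrite hu => -[<-] [<-].
pose kk := pborel_comp gh' l; have kt : ptotal kk := ptotal_comp gh't lt.
have lE x : pborel_comp (pborel_comp g h) kk x = l x.
  have [y ly] := ((ptotalP _).1 lt).1 x.
  have [z hz] := ((ptotalP _).1 gh't).1 y.
  rewrite ly; apply/pcomp_Some; exists z; last exact/gh'P.
  by apply/pcomp_Some; exists y.
have onC x : C x -> ~ [set x | chi x <> pborel_comp phi psi x] x ->
    ~ [set x | exists2 y, psi x = Some y & h x <> Some y] x ->
    exists y z, [/\ psi x = Some y, h x = Some y, phi y = Some z & chi x = Some z].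
  move=> [z cz] /contrapT cE hx; move: (cz); rewrite cE => /pcomp_Some[y py pz].
  have hy : h x = Some y by apply: contrapT => hy; apply: hx; exists y.
  by exists y, z; split=> //; rewrite -cE.
have mA : measurable A := mpdom _; have mB : measurable B := mpdom _.
have mC : measurable C := mpdom _.
have e1 := rho_comp ht p't; have e2 := rho_comp pt ht.
rewrite (rho_eqfun hp') in e1.
have e4 := rho_comp ght kt; rewrite (rho_eqfun lE) in e4.
have e5 := rho_comp gt ht.
have e3 : negl (fun k => Smv C k `&` mv kk k).
  apply: S_disj => //.
  apply: null3 chiE (negligibleU hP lP) gP _ => x h1 /not_orP[h2 h3] h4 [Cx kx].
  have [y [z [py hy pz cz]]] := onC x Cx h1 h2.
  apply: kx; apply/pcomp_Some; exists z.
    by apply: contrapT => lx; apply: h3; exists z.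
  apply/gh'P; apply/pcomp_Some; exists y => //.
  by apply: contrapT => gy; apply: h4; exists y => //; exists z.
have e6 : negl (fun k => Smv C k `\` Smv B k).
  apply: S_sub => //; apply: null2 chiE hP _ => x h1 h2 [Cx nB].
  by have [y [z [py _ _ _]]] := onC x Cx h1 h2; apply: nB; exists y.
have pA := flip_supp mA.
have psiA : mu.-negligible (ppre psi [set x | ~ (supp p x <-> A x)]).
  exact: negligible_ppre.
have e7 : negl (fun k => Smv C k `\` mv p' k).
  apply: S_ge => //; apply: null3 chiE hP psiA _ => x h1 h2 h3 [Cx np].
  have [y [z [py hy pz cz]]] := onC x Cx h1 h2.
  apply: np; apply/suppp'; exists y => //.
  apply: contrapT => npy; apply: h3; exists y => // hh; apply: npy; apply/hh.
  by exists z.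
have e8 : negl (fun k => Smv B k `\` (Smv C k `|` Smv (B `\` C) k)).
  apply: S_union => //; first exact: measurableD.
    apply: negligibleS (negligible_set0 mu) => x [Bx /not_orP[Cx BC]].
    by apply: BC.
  by apply: negligibleS (negligible_set0 mu) => x [Cx [_ /(_ Cx)]].
have e9 : negl (fun k => Smv (B `\` C) k `&` mv p' k).
  apply: S_disj => //; first exact: measurableD.
  apply: null3 chiE hP psiA _ => x /contrapT h1 h2 h3 [[[y py] nC] /suppp'[z hz sz]].
  have hy : h x = Some y by apply: contrapT => hy; apply: h2; exists y.
  have yz : y = z by move: hz; rewrite hy => -[].
  rewrite -yz in sz; have [w pw] : A y.
    by apply: contrapT => nA; apply: h3; exists y => // hh; apply: nA; apply/hh.
  by apply: nC; exists w; rewrite h1; apply/pcomp_Some; exists y.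
apply: unegl_sub (uneglU e1 (uneglU e2 (uneglU e3 (uneglU e4 (uneglU e5 (uneglU e6
  (uneglU e7 (uneglU e8 e9)))))))) _ => k i hi.
apply: contrapT => /not_orP[/contrapT f1 /not_orP[/contrapT f2 /not_orP[f3
  /not_orP[/contrapT f4 /not_orP[/contrapT f5 /not_orP[f6 /not_orP[f7 /not_orP[f8 f9]]]]]]]].
apply: hi.
have mvp' : mv p' k i <-> mv p k (rho h k i).
  rewrite /mv /=; split=> [a b|a b]; apply: a.
    by apply: (@perm_inj _ (rho h k)); rewrite -f1 f2 b.
  by rewrite -f2 f1 b.
have [Ci|nC] := pselect (Smv C k i).
  rewrite (model_Some Ci); apply/esym/pcomp_Some.
  have Bi : Smv B k i by apply: contrapT => nB; apply: f6.
  have p'i : mv p' k i by apply: contrapT => nB; apply: f7.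
  exists (rho h k i); first exact: model_Some.
  rewrite model_Some; last exact/mvp'.
  have ki : rho kk k i = i by apply: contrapT => ki; apply: f3.
  by rewrite -/l f4 ki f5.
rewrite (model_None nC); apply/esym; case pE : (pbij_comp (model phi k) (model psi k) i) => [j|//]; exfalso.
move: pE => /pcomp_Some[u].
have [Bi|nB] := pselect (Smv B k i); last by rewrite (model_None nB).
rewrite (model_Some Bi) => -[<-].
have [Ai|nA] := pselect (Smv A k (rho h k i)); last by rewrite (model_None nA).
move=> _; have p'i : mv p' k i by apply/mvp'.
apply: f8; split=> // -[//|BCi]; exact: f9.
Qed.

Let model_fix (phi : pborel E) :
  @ucvg R U n (fun k => pfix (model phi k)) (rmu mu (pfix phi)).
Proof.
have mF : measurable (pfix phi) by exact: measurable_pfix.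
have mA := mpdom phi; set g := ext_of phi; have gt : ptotal g := ext_total _.
have gP : mu.-negligible [set x | exists2 y, phi x = Some y & g x <> Some y].
  exact: ext_ofP.
have FA : pfix phi `<=` pdom phi by move=> x fx; exists x.
have e1 : negl (fun k => Smv (pdom phi) k `\` (Smv (pfix phi) k `|` Smv (pdom phi `\` pfix phi) k)).
  apply: S_union => //; first exact: measurableD.
    apply: negligibleS (negligible_set0 mu) => x [Ax /not_orP[Fx h]].
    by apply: h.
  by apply: negligibleS (negligible_set0 mu) => x [Cx [_ /(_ Cx)]].
have e2 : negl (fun k => Smv (pdom phi `\` pfix phi) k `\` mv g k).
  apply: S_ge => //; first exact: measurableD.
  apply: negligibleS gP => x [[[y py] nf] /contrapT gx]; exists y => //.
  by rewrite gx => -[xy]; apply: nf; rewrite /pfix /= py xy.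
have e3 : negl (fun k => Smv (pfix phi) k `\` Smv (pdom phi) k).
  by apply: S_sub => //; apply: negligibleS (negligible_set0 mu) => x [/FA].
have e4 : negl (fun k => Smv (pfix phi) k `&` mv g k).
  apply: S_disj => //; apply: negligibleS gP => x [fx gx]; by exists x.
apply: ucvg_eq (S_cvg mF) _ _.
  apply: unegl_sub (uneglU e3 e4) _ => k i [Fi nf].
  have [Ai|nA] := pselect (Smv (pdom phi) k i); last by left.
  right; split=> // gi; apply: nf; rewrite /pfix /mkset model_Some//.
  by rewrite -/g gi.
apply: unegl_sub (uneglU e1 e2) _ => k i [fi nF].
have [Ai|nA] := pselect (Smv (pdom phi) k i); last first.
  by move: fi; rewrite /pfix /mkset model_None.
have gi : rho g k i = i by move: fi; rewrite /pfix /mkset model_Some// => -[].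
have [Di|nD] := pselect (Smv (pdom phi `\` pfix phi) k i).
  by right; split=> // mi; exact: mi gi.
by left; split=> // -[].
Qed.

Let model_id (phi : pborel E) : mu.-negligible [set x | phi x <> Some x] ->
  negl (fun k => [set i | model phi k i <> Some i]).
Proof.
move=> idE; have mA := mpdom phi.
have mT : @measurable _ X setT by exact: measurableT.
have extE : rho (ext_of phi) = rho (pborel_id E).
  apply: rho_eq; apply: null2 idE (ext_ofP phi) _ => x /contrapT h1 h2 /= gx.
  by apply: h2; exists x.
have e1 : negl (fun k => ~` Smv (pdom phi) k).
  have h := S_cvg mA; rewrite (_ : rmu mu (pdom phi) = 1) in h.
    move=> e /h; apply: filterS => k; rewrite mu_countC// ltr_norml => /andP[h1 h2].
    by lra.
  rewrite -(rmuT mu); apply: rmu_eq_ae => //.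
    by apply: negligibleS (negligible_set0 mu) => x [_ /(_ Logic.I)].
  apply: negligibleS idE => x [_ nx] px; apply: nx; by exists x.
apply: unegl_sub (uneglU e1 mv_id) _ => k i /= hi.
have [Ai|nA] := pselect (Smv (pdom phi) k i); last by left.
right; rewrite /mv /= -extE => ri; apply: hi.
by have /= -> := model_Some Ai; rewrite ri.
Qed.

Let model_empty (phi : pborel E) : mu.-negligible [set x | phi x <> None] ->
  negl (fun k => [set i | model phi k i <> None]).
Proof.
move=> eE; have mA := mpdom phi.
have h := S_cvg mA; rewrite (_ : rmu mu (pdom phi) = 0) in h.
  apply: unegl_sub (ucvg0 h) _ => k i /= hi; apply: contrapT => nA; apply: hi.
  exact: model_None.
by apply/rmu_eq0 => //; apply: negligibleS eE => x [y py] /=; rewrite py.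
Qed.


(** Soficity asks for exact values at the identity and at the empty map. *)
Let pi k (phi : full_semigroup mu E) : pbij (n k) :=
  if pselect (phi = fsid mu E) then pbij_id (n k)
  else if pselect (phi = fsempty mu E) then pbij_empty (n k)
  else model (mrepr phi) k.

Let mrepr_ae (g : pborel E) : mu.-negligible [set x | mrepr (fsclass mu g) x <> g x].
Proof.
apply/negligibleP; first exact: measurable_pborel_neq.
by apply/fsclassP; exact: mreprK.
Qed.

Let pi_model phi : negl (fun k => [set i | pi k phi i <> model (mrepr phi) k i]).
Proof.
rewrite /pi; case: pselect => [pE|_] /=.
  have m0 : mu.-negligible [set x | mrepr phi x <> Some x].
    by rewrite pE; exact: (mrepr_ae (pborel_id E)).
  by apply: unegl_sub (model_id m0) _ => k i /= /nesym.
case: pselect => [pE|_] /=.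
  have m0 : mu.-negligible [set x | mrepr phi x <> None].
    by rewrite pE; exact: (mrepr_ae (pborel_empty E)).
  by apply: unegl_sub (model_empty m0) _ => k i /= /nesym.
move=> e e0; apply: filterE => k; rewrite (_ : mkset _ = set0) ?mu_count0//.
by apply/seteqP; split=> i // /(_ erefl).
Qed.

Let fsempty_neq_id : fsempty mu E <> fsid mu E.
Proof.
move=> /fsclassP; rewrite (_ : mkset _ = setT) ?probability_setT.
  by move=> /eqP; rewrite onee_eq0.
by apply/seteqP; split.
Qed.

Let pi_comp phi psi : negl (fun k =>
  [set i | pi k (fscomp phi psi) i <> pbij_comp (pi k phi) (pi k psi) i]).
Proof.
have e1 := pi_model (fscomp phi psi).
have e2 := model_comp (mrepr_ae (pborel_comp (mrepr phi) (mrepr psi))).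
have e3 := pi_model psi.
have e4 := @unegl_perm R U UU n (rho (ext_of (mrepr psi))) _ (pi_model phi).
apply: unegl_sub (uneglU e1 (uneglU e2 (uneglU e3 e4))) _ => k i hi.
apply: contrapT => /not_orP[/contrapT f1 /not_orP[/contrapT f2
  /not_orP[/contrapT f3 f4]]]; apply: hi.
rewrite f1 f2; change (pcomp (model (mrepr phi) k) (model (mrepr psi) k) i =
  pcomp (pi k phi) (pi k psi) i); rewrite /pcomp f3.
have [Bi|nB] := pselect (Smv (pdom (mrepr psi)) k i).
  by rewrite (model_Some Bi); exact: (esym (contrapT f4)).
by rewrite (model_None nB).
Qed.

Let pi_fix phi : @ucvg R U n (fun k => pfix (pi k phi)) (fsfix phi).
Proof.
have e1 := pi_model phi.
apply: ucvg_eq (model_fix (mrepr phi)) _ _;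
  by apply: unegl_sub e1 _ => k i [h1 h2] /= h; apply: h2; rewrite /pfix /= -h1 h.
Qed.

Let near_finite (T : Type) (K : set T) (P : T -> nat -> Prop) : finite_set K ->
  (forall a, K a -> \forall k \near U, P a k) ->
  \forall k \near U, forall a, K a -> P a k.
Proof.
move=> /(@finite_seqP {classic T})[s sK].
have {sK} Ks a : K a <-> (a : {classic T}) \in s by rewrite sK.
move=> h; have {}h a : (a : {classic T}) \in s -> \forall k \near U, P a k by move/Ks/h.
suff : \forall k \near U, forall a, (a : {classic T}) \in s -> P a k.
  by apply: filterS => k hk a /Ks; exact: hk.
elim: s {Ks} h => [|a s IH] h; first exact: filterE.
have hs := IH (fun b bs => h b (mem_behead (s := a :: s) bs)).
apply: filterS2 (h a (mem_head _ _)) hs => k ha hk b.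
by rewrite in_cons => /predU1P[->|]; [|exact: hk].
Qed.

Lemma embedding_sofic : sofic mu E.
Proof.
move=> K e Kf e0.
have h1 : \forall k \near U, forall phi, K phi -> forall psi, K psi ->
    mu_count R [set i | pi k (fscomp phi psi) i <> pbij_comp (pi k phi) (pi k psi) i] < e.
  apply: near_finite => // phi _; apply: near_finite => // psi _.
  exact: pi_comp.
have h2 : \forall k \near U, forall phi, K phi ->
    `|mu_count R (pfix (pi k phi)) - fsfix phi| < e.
  by apply: near_finite => // phi _; exact: pi_fix.
have [k [k1 k2]] := filter_ex (filterI h1 h2).
exists (n k), (pi k); split=> //; split.
- split; rewrite /pi; first by case: pselect.
  case: pselect => [h|h0]; first by case: (fsempty_neq_id h).
  by case: pselect.
- by move=> phi psi Kphi Kpsi; rewrite pbij_distE; exact: k1.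
- by move=> phi Kphi; rewrite distrC; exact: k2.
Qed.

End semigroup_model.

(** * From soficity to an embedding *)

(** A permutation agreeing with [f] at as many points as possible agrees with it
on its whole domain: otherwise composing with a transposition would gain one. *)
Lemma perm_completion (N : nat) (f : pbij N) :
  exists s : 'S_N, forall i j, f i = Some j -> s i = j.
Proof.
pose m (s : 'S_N) := #|[pred i | f i == Some (s i)]|.
have [s _ smax] := @arg_maxnP _ (1%g : 'S_N) xpredT m isT.
exists s => i j fi; apply/eqP; apply/negPn/negP => sij.
pose t := (s * tperm (s i) j)%g.
have : (m t <= m s)%N by exact: smax.
rewrite leqNgt => /negP; apply; apply: proper_card; apply/properP; split.
  apply/fintype.subsetP => l; rewrite !inE permM => /eqP fl.
  have il : l != i by apply: contra_neq sij => li; move: fl; rewrite li fi => -[].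
  rewrite tpermD ?fl//.
    by rewrite (inj_eq perm_inj) eq_sym.
  by apply: contra_neq il => jl; apply: (@pbij_inj _ f _ _ j) => //; rewrite fl jl.
exists i; first by rewrite inE permM tpermL fi.
by rewrite inE fi; apply: contra_neq sij => -[].
Qed.

Section sofic_to_permutations.
Context (R : realType) (d : measure_display) (X : standardBorelType R d).
Variables (mu : probability X R) (E : cber X).
Hypothesis E_pmp : measure_preserving mu E.
Hypothesis E_sofic : sofic mu E.

Let inv (g : pborel E) : pborel E := sval (cid (pborel_inv g)).
Let invP g x y : inv g x = Some y <-> g y = Some x.
Proof. exact: (svalP (cid (pborel_inv g)) x y). Qed.

Local Notation dist := (pborel_dist mu).

Let fs g := fsclass mu (g : pborel E).

(** The bound is wanted on products as well, because the image of a product must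
be compared with the image of its nearest point in the dense set. *)
Lemma sofic_permutations (L : set (pborel E)) (e : R) : finite_set L ->
  (forall a, L a -> ptotal a) -> 0 < e ->
  let L2 := L `|` [set pborel_comp a b | a in L & b in L] in
  exists N (q : pborel E -> 'S_N), [/\ (0 < N)%N,
    forall a b, L a -> L b -> perm_dist R (q (pborel_comp a b)) (q b * q a)%g < e &
    forall a b, L2 a -> L2 b -> `|perm_dist R (q a) (q b) - dist a b| < e].
Proof.
move=> Lfin Ltot e0 L2.
have L2tot a : L2 a -> ptotal a.
  by move=> [/Ltot//|[b Lb [c Lc <-]]]; apply: ptotal_comp; exact: Ltot.
have L2fin : finite_set L2.
  by rewrite finite_setU; split=> //; exact: finite_image2.
pose K := (fs @` L2) `|` (fs \o inv) @` L2 `|`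
  [set fs (pborel_comp (inv a) b) | a in L2 & b in L2].
have Kfin : finite_set K.
  rewrite !finite_setU; split; last exact: finite_image2.
  by split; exact: finite_image.
have e80 : 0 < e / 8 by lra.
have [N [p [N0 [[p1 _] pM pfixP]]]] := E_sofic Kfin e80.
pose P a : pbij N := p (fs a).
have /(_ _)/cid qex a := perm_completion (P a).
pose q a : 'S_N := sval (qex a).
have qP a i j : P a i = Some j -> q a i = j by exact: (svalP (qex a)).
have K1 a : L2 a -> K (fs a) by move=> La; left; left; exists a.
have K2 a : L2 a -> K (fs (inv a)) by move=> La; left; right; exists a.
have K3 a b : L2 a -> L2 b -> K (fs (pborel_comp (inv a) b)).
  by move=> La Lb; right; exists a => //; exists b.
have mult a b : K (fs a) -> K (fs b) ->
    mu_count R [set i | P (pborel_comp a b) i <> pbij_comp (P a) (P b) i] < e / 8.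
  by move=> Ka Kb; rewrite -pbij_distE /P /fs -fscomp_class//; exact: pM.
have invE a : L2 a -> P (pborel_comp (inv a) a) = pbij_id N.
  move=> /L2tot/ptotalP[ad _]; rewrite -p1 /P; congr p; apply/fsclassP.
  rewrite (_ : mkset _ = set0) ?measure0//; apply/seteqP; split=> x //; apply.
  have [y ay] := ad x; apply/pcomp_Some; exists y => //; exact/invP.
have inverse a : L2 a -> mu_count R [set i | pbij_comp (P (inv a)) (P a) i <> Some i] < e / 8.
  move=> La; have := mult _ _ (K2 _ La) (K1 _ La); rewrite invE//.
  by apply: le_lt_trans; apply: mu_count_le => i /= /nesym.
(* Where the composite with [P (inv a)] is the identity, [P a] is defined, so it
   agrees there with its completion [q a]. *)
have F1 a : L2 a -> mu_count R [set i | P a i <> Some (q a i)] < e / 8.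
  move=> La; apply: le_lt_trans (inverse a La); apply: mu_count_le => i /= h /pcomp_Some[j Pj _].
  by apply: h; rewrite Pj; congr Some; apply/esym/qP.
have F2 a : L2 a -> mu_count R [set i | P (inv a) (q a i) <> Some i] < e / 8.
  move=> La; apply: le_lt_trans (inverse a La); apply: mu_count_le => i /= h /pcomp_Some[j Pj Pij].
  by apply: h; rewrite (qP _ _ _ Pj).
(* Each estimate below accumulates at most four of these errors. *)
have mc4 (A B1 B2 B3 B4 : set 'I_N) : A `<=` B1 `|` (B2 `|` (B3 `|` B4)) ->
    mu_count R B1 < e / 8 -> mu_count R B2 < e / 8 -> mu_count R B3 < e / 8 ->
    mu_count R B4 < e / 8 -> mu_count R A < e / 2.
  move=> /(@mu_count_le R) h h1 h2 h3 h4; have g1 := mu_countU_le R B1 (B2 `|` (B3 `|` B4)).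
  by have g2 := mu_countU_le R B2 (B3 `|` B4); have g3 := mu_countU_le R B3 B4; lra.
exists N, q; split=> // [a b La Lb|a b La Lb].
  have La2 : L2 a by left. have Lb2 : L2 b by left.
  have Lab : L2 (pborel_comp a b) by right; exists a => //; exists b.
  rewrite perm_distE_count; apply: (@lt_le_trans _ _ (e / 2)); last by lra.
  have F1a : mu_count R ((q b) @^-1` [set i | P a i <> Some (q a i)]) < e / 8.
    by rewrite mu_count_preim_perm; exact: F1.
  apply: mc4 (F1 _ Lab) (mult _ _ (K1 _ La2) (K1 _ Lb2)) (F1 _ Lb2) F1a => i /= h.
  apply: contrapT => /not_orP[/contrapT f1 /not_orP[/contrapT f2 /not_orP[/contrapT f3
    /contrapT f4]]].
  apply: h; rewrite permM; apply: Some_inj.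
  by rewrite -f1 f2; apply/pcomp_Some; exists (q b i).
pose c := pborel_comp (inv a) b.
have fixc : rmu mu (pfix c) = 1 - dist a b.
  rewrite pborel_dist_rmu -rmuC; last exact: measurable_pborel_neq.
  congr rmu; apply/seteqP; split=> x; rewrite /= /pfix /=.
    by move=> /pcomp_Some[y bx /invP ay] /=; rewrite ay bx.
  move=> /contrapT ab; have [y ay] := ((ptotalP _).1 (L2tot _ La)).1 x.
  by apply/pcomp_Some; exists y; [rewrite -ab|apply/invP].
have := pfixP _ (K3 _ _ La Lb); rewrite fsfix_class -/(rmu mu _) fixc.
have mM := mult _ _ (K2 _ La) (K1 _ Lb).
(* The points where [q a] and [q b] agree are nearly the fixed points of [P c],
   as [c] is a quotient of [a] and [b]. *)
have d1 : mu_count R (~` [set i | q a i <> q b i] `\` pfix (P c)) < e / 2.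
  apply: (mc4 _ _ _ _ _ _ (F1 _ Lb) (F2 _ La) mM mM) => i [/contrapT qq nf].
  apply: contrapT => /not_orP[/contrapT f1 /not_orP[/contrapT f2 /not_orP[/contrapT f3 _]]].
  apply: nf; rewrite /pfix /= f3; apply/pcomp_Some; exists (q b i) => //.
  by rewrite -qq.
have d2 : mu_count R (pfix (P c) `\` ~` [set i | q a i <> q b i]) < e / 2.
  apply: (mc4 _ _ _ _ _ _ (F1 _ Lb) (F2 _ La) mM mM) => i [fi /contrapT /= qq].
  apply: contrapT => /not_orP[/contrapT f1 /not_orP[/contrapT f2 /not_orP[/contrapT f3 _]]].
  apply: qq; move: fi; rewrite /pfix /= f3 => /pcomp_Some[j Pj Pij].
  by rewrite (qP _ _ _ Pj); apply: pbij_inj f2 Pij.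
rewrite perm_distE_count.
have := mu_countC R [set i | q a i <> q b i] N0.
have h1 : mu_count R (~` [set i | q a i <> q b i]) <= mu_count R (pfix (P c)) +
    mu_count R (~` [set i | q a i <> q b i] `\` pfix (P c)).
  apply: le_trans (mu_countU_le _ _ _); apply: mu_count_le => i hi.
  by have [|] := pselect (pfix (P c) i); [left|right].
have h2 : mu_count R (pfix (P c)) <= mu_count R (~` [set i | q a i <> q b i]) +
    mu_count R (pfix (P c) `\` ~` [set i | q a i <> q b i]).
  apply: le_trans (mu_countU_le _ _ _); apply: mu_count_le => i hi.
  by have [|] := pselect ((~` [set i | q a i <> q b i]) i); [left|right].
rewrite -/(fs c) -/(P c) => h3; rewrite !ltr_norml => /andP[h4 h5].
by apply/andP; split; lra.
Qed.

Lemma pborel_dist_comp (u v b c : pborel E) :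
  dist (pborel_comp u v) (pborel_comp b c) <= dist u b + dist v c.
Proof.
rewrite !pborel_dist_rmu; set N := [set x | u x <> b x].
have mN : measurable N by exact: measurable_pborel_neq.
have mp : measurable (ppre c N) by exact: pborel_pre.
have : rmu mu (ppre c N) <= rmu mu N.
  rewrite -(@rmu_pimg _ _ _ _ _ E_pmp c _ mp); last by move=> x [y _ cy]; exists y.
  apply: rmu_le => //; first exact: pborel_img.
  by move=> y [x [z Nz cz]]; rewrite cz => -[<-].
move=> h; rewrite addrC; apply: le_trans (lerD (lexx _) h).
apply: le_trans (rmuUle _ _ _) => //; last exact: measurable_pborel_neq.
apply: rmu_le; first exact: measurable_pborel_neq.
  by apply: measurableU => //; exact: measurable_pborel_neq.
move=> x /= h'; have [vc|] := pselect (v x = c x); last by left.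
right; move: h'; rewrite /= /pcomp vc; case cx : (c x) => [y|] //= uy.
by exists y.
Qed.

End sofic_to_permutations.

Section sofic_to_ultraproduct.
Context (R : realType) (d : measure_display) (X : standardBorelType R d).
Variables (mu : probability X R) (E : cber X).
Hypothesis E_pmp : measure_preserving mu E.
Hypothesis E_sofic : sofic mu E.

Local Notation dist := (pborel_dist mu).

Let dist_tri (h g k : pborel E) : dist g k <= dist g h + dist h k.
Proof. exact: (pdist_triangle (pborel_pseudometric mu E)). Qed.

Let distC (g h : pborel E) : dist g h = dist h g.
Proof. exact: (pdistC (pborel_pseudometric mu E)). Qed.

(** Only finitely many points of the dense set are available at stage [k]; the
nearest of them approximates any given element better and better, which is all
that the limit along [U] sees. *)
Lemma sofic_embedding (U : set_system nat) {UU : UltraFilter U} :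
  (forall m, \forall k \near U, (m <= k)%N) ->
  exists2 n : nat -> nat, forall k, (0 < n k)%N & embeds_isometrically mu E U n.
Proof.
move=> Uoo.
have [D Dtot Ddense] := full_group_separable mu E.
pose L k : set (pborel E) := D @` `I_k.+1.
have Lfin k : finite_set (L k) by apply: finite_image; exact: finite_II.
have Ltot k a : L k a -> ptotal a by move=> [j _ <-].
have /(_ _)/cid Nex k := sofic_permutations E_pmp E_sofic (Lfin k) (@Ltot k) (natSinv_gt0 R k).
pose n k := sval (Nex k).
have /(_ _)/cid qex k := svalP (Nex k).
pose q k : pborel E -> 'S_(n k) := sval (qex k).
have n_gt0 k : (0 < n k)%N by have [] := svalP (qex k).
have qM k a b : L k a -> L k b ->
    perm_dist R (q k (pborel_comp a b)) (q k b * q k a)%g < k.+1%:R^-1.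
  by have [_ h _] := svalP (qex k); exact: h.
have qD1 k a b : L k a -> L k b ->
    `|perm_dist R (q k a) (q k b) - dist a b| < k.+1%:R^-1.
  by have [_ _ h] := svalP (qex k) => La Lb; apply: h; left.
have qD2 k a b c : L k a -> L k b -> L k c ->
    `|perm_dist R (q k a) (q k (pborel_comp b c)) - dist a (pborel_comp b c)| < k.+1%:R^-1.
  have [_ _ h] := svalP (qex k) => La Lb Lc; apply: h; first by left.
  by right; exists b => //; exists c.
(* [A k g] is the point nearest to [g] among those treated at stage [k]. *)
pose near_idx k g : 'I_k.+1 := [arg min_(i < ord0) dist g (D (i : 'I_k.+1))]%O.
pose A k (g : pborel E) := D (near_idx k g).
have LA k g : L k (A k g) by exists (near_idx k g : nat) => //; exact: ltn_ord.
have Amin k g j : (j <= k)%N -> dist g (A k g) <= dist g (D j).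
  move=> jk; rewrite /A /near_idx; case: arg_minP => // i _ h.
  exact: (h (Ordinal (jk : (j < k.+1)%N))).
pose u (phi : full_semigroup mu E) : pborel E := mrepr phi.
have Aapprox phi : full_group mu E phi -> forall e, 0 < e ->
    \forall k \near U, dist (u phi) (A k (u phi)) < e.
  move=> [g gt gphi] e e0; have [j hj] := Ddense g e gt e0.
  apply: filterS (Uoo j) => k jk; apply: le_lt_trans (Amin _ _ _ jk) _.
  apply: le_lt_trans (dist_tri g _ _) _.
  have -> : dist (u phi) g = 0 by rewrite /u -gphi; exact: (mrepr_class (pborel_pseudometric mu E)).
  by rewrite add0r.
have Sapprox e : 0 < e -> \forall k \near U, (k.+1%:R^-1 : R) < e.
  move=> /ex_natSinv_lt[m hm]; apply: filterS (Uoo m) => k mk.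
  by apply: le_lt_trans hm; exact: natSinv_anti.
pose th phi : forall k, 'S_(n k) := fun k => q k (A k (u phi)).
have seq_dist_eq (x y : forall k, 'S_(n k)) (l : R) :
    (forall e, 0 < e -> \forall k \near U, `|perm_dist R (x k) (y k) - l| < e) ->
    seq_dist R U x y = l.
  move=> h; apply: cvg_lim => //; apply/cvgrPdist_lt => e /h.
  by apply: filterS => k; rewrite distrC.
exists n => //; exists (fun phi => @uclass R U UU n (th phi)); split=> phi psi phiG psiG.
  have compG := full_group_comp E_pmp phiG psiG.
  rewrite ucomp_class; apply/(mclassP (@seq_pseudometric R U UU n)).
  apply: seq_dist_eq => e e0; have e50 : 0 < e / 5 by lra.
  have h1 := Aapprox _ phiG _ e50; have h2 := Aapprox _ psiG _ e50.
  have h3 := Aapprox _ compG _ e50; have h4 := Sapprox _ e50.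
  apply: filterS2 (filterI h1 h2) (filterI h3 h4) => k [k1 k2] [k3 k4].
  rewrite subr0 ger0_norm ?perm_dist_ge0//.
  set a := A k (u (fscomp phi psi)); set b := A k (u phi); set c := A k (u psi).
  have t1 := perm_dist_triangle R (q k (pborel_comp b c)) (q k a) (q k c * q k b)%g.
  have t2 := qM k b c (LA _ _) (LA _ _).
  have := qD2 k a b c (LA _ _) (LA _ _) (LA _ _); rewrite ltr_norml => /andP[_ t3].
  have t4 := dist_tri (u (fscomp phi psi)) a (pborel_comp b c).
  have t5 := dist_tri (pborel_comp (u phi) (u psi)) (u (fscomp phi psi)) (pborel_comp b c).
  have t6 : dist (u (fscomp phi psi)) (pborel_comp (u phi) (u psi)) = 0.
    exact: (mrepr_class (pborel_pseudometric mu E)).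
  have t7 := pborel_dist_comp E_pmp (u phi) (u psi) b c.
  rewrite (distC a (u (fscomp phi psi))) in t4; rewrite -/a in k3; rewrite -/b in k1; rewrite -/c in k2.
  apply: le_lt_trans t1 _.
  move: k4 t2 t3; set r := k.+1%:R^-1 => k4 t2 t3; lra.
rewrite /udist mdist_quotientE; apply: seq_dist_eq => e e0.
have e30 : 0 < e / 3 by lra.
apply: filterS3 (Aapprox _ phiG _ e30) (Aapprox _ psiG _ e30) (Sapprox _ e30) => k k1 k2 k3.
rewrite -/(dist (u phi) (u psi)) /th.
move: k1 k2; set b := A k (u phi); set c := A k (u psi) => k1 k2.
have := qD1 k b c (LA _ _) (LA _ _); rewrite !ltr_norml => /andP[t1 t2].
have t3 := dist_tri (u phi) b c; have t4 := dist_tri (u psi) (u phi) c.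
have t5 := dist_tri b (u phi) (u psi); have t6 := dist_tri c b (u psi).
rewrite (distC b (u phi)) in t3; rewrite (distC c (u psi)) in t6.
rewrite -[fsdist phi psi]/(dist (u phi) (u psi)).
by move: k3 t1 t2; set r := k.+1%:R^-1 => k3 t1 t2; apply/andP; split; lra.
Qed.

End sofic_to_ultraproduct.

Lemma free_ultrafilter : exists (U : set_system nat), [/\ UltraFilter U,
  free_filter U & forall m, \forall k \near U, (m <= k)%N].
Proof.
have [U [UU sU]] := ultraFilterLemma (eventually_filter : ProperFilter \oo).
have Uoo m : \forall k \near U, (m <= k)%N by apply: sU; exists m.
exists U; split=> //; apply/seteqP; split=> // x h.
by have := h [set k | (x < k)%N] (Uoo x.+1); rewrite /= ltnn.
Qed.

Theorem theorem4p2 (R : realType) (d : measure_display)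
    (X : standardBorelType R d) (mu : probability X R) (E : cber X)
    (E_pmp : measure_preserving mu E) (E_aper : aperiodic mu E) :
  sofic mu E <->
  exists (U : set_system nat) (UU : UltraFilter U) (n : nat -> nat),
    [/\ free_filter U, forall k, (0 < n k)%N & embeds_isometrically mu E U n].
Proof.
split=> [sE|[U [UU [n [_ n0 [theta [thM thD]]]]]]].
  have [U [UU Ufree Uoo]] := free_ultrafilter.
  have [n n0 emb] := @sofic_embedding _ _ _ _ _ E_pmp sE U UU Uoo.
  by exists U, UU, n.
exact: (embedding_sofic E_pmp E_aper n0 thM thD).
Qed.
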